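(* Let $\mathfrak g=\mathfrak{pe}(n)$ with $n$ a positive integer, and let $\mathfrak p$ be a reduced parabolic subalgebra with $\mathfrak p_{\bar 1}=\mathfrak g_1$. Suppose that $M\in\mathcal O^{\mathfrak p}$ is a non-zero quotient of $\Delta^{\mathfrak p}(\lambda)$ for some $\lambda\in\Sigma^+_{\mathfrak p}$. Then the associated variety $X_M$ is non-zero. In particular, $$\mathrm{pd}_{\mathcal O}M=\mathrm{pd}_{\mathcal O^{\mathfrak p}}M=\infty.$$ In particular, the modules $L(\lambda)$, $K(\lambda)$ and $\Delta^{\mathfrak p}(\lambda)$ all have infinite projective dimension in both $\mathcal O$ and $\mathcal O^{\mathfrak p}$.
   Context: Everything is over $\mathbb C$; modules are supermodules and parities are not tracked. The periplectic Lie superalgebra $\mathfrak{pe}(n)\subset\mathfrak{gl}(n|n)$ consists of the block matrices $\begin{pmatrix}A&B\\ C&-A^t\end{pmatrix}$ with $A,B,C\in\mathbb C^{n\times n}$, $B^t=B$, $C^t=-C$, with the super commutator; $\mathfrak g_{\bar 0}=\mathfrak g_0\cong\mathfrak{gl}(n)$ is the subalgebra $B=C=0$, $\mathfrak g_1$ is given by $A=C=0$ and $\mathfrak g_{-1}$ by $A=B=0$; $\mathfrak g_{\bar 1}=\mathfrak g_1\oplus\mathfrak g_{-1}$. $\mathfrak h$ is the subalgebra of diagonal matrices. $\mathfrak b_{\bar0}=\mathfrak h\oplus\mathfrak n_{\bar0}$ is the Borel subalgebra of $\mathfrak g_{\bar 0}$ given by upper triangular $A$; $\mathfrak b=\mathfrak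 b_{\bar 0}\oplus\mathfrak g_1$ and $\mathfrak n=\mathfrak n_{\bar 0}\oplus\mathfrak g_1$. The reduced parabolic subalgebras with $\mathfrak p_{\bar 1}=\mathfrak g_1$ are $\mathfrak p=\mathfrak p_{\bar 0}\oplus\mathfrak g_1$ with $\mathfrak p_{\bar 0}\supseteq\mathfrak b_{\bar 0}$ a parabolic subalgebra of $\mathfrak g_{\bar 0}$, with Levi subalgebra $\mathfrak l\supseteq\mathfrak h$. $\mathcal O$ is the category of finitely generated $\mathfrak g$-modules that are $\mathfrak h$-semisimple and locally $U(\mathfrak n)$-finite; $\mathcal O^{\mathfrak p}$ is its full subcategory of modules on which $\mathfrak p$ acts locally finitely. $\Sigma^+_{\mathfrak p}=\{\lambda\in\mathfrak h^*:\langle\lambda,\alpha^\vee\rangle\in\mathbb Z_{\ge0}\text{ for all positive roots }\alpha\text{ of }\mathfrak l\}$. $\Delta^{\mathfrak p}(\lambda)=\mathrm{Ind}_{\mathfrak p}^{\mathfrak g}L^{\mathfrak l}(\lambda)$ with $L^{\mathfrak l}(\lambda)$ the simple $\mathfrak l$-module of highest weight $\lambda$; $L(\lambda)$ is the simple $\mathfrak g$-module of $\mathfrak b$-highest weight $\lambda$; $K(\lambda)=U(\mathfrak g)\otimes_{U(\mathfrak g_0\oplus\mathfrak g_1)}L_{\bar 0}(\lambda)$ is the Kac module, where $L_{\bar 0}(\lambda)$ is the simple $\mathfrak g_{\bar 0}$-module of highest weight $\lambda$ with trivial $\mathfrak g_1$-action. $\mathrm{pd}_{\mathcal A}$ is projective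 dimension in $\mathcal A$. For a $\mathfrak g$-module $M$ and $x\in\mathfrak g_{\bar 1}$ with $[x,x]=0$ put $M_x=\ker(x:M\to M)/xM$. The associated variety is $X_M=\{x\in\mathfrak g_{\bar 1}:[x,x]=0,\ M_x\ne0\}$; it is non-zero if it contains a non-zero element. *)

(* Defs.v *)
From HB Require Import structures.
From mathcomp Require Import all_boot all_order all_algebra generic_quotient ring.
From mathcomp Require Export complex.
From mathcomp Require Export boolp classical_sets reals.

Set Implicit Arguments.
Unset Strict Implicit.
Unset Printing Implicit Defensive.
Import Order.TTheory GRing.Theory Num.Theory.
Local Open Scope ring_scope.
Local Open Scope classical_set_scope.
Local Open Scope quotient_scope.

(* The theory is written over an arbitrary [K : numFieldType] (so the
   characteristic is 0) and is meant to be used with the complex numbers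
   K := R[i], R : realType. *)

Section Superalgebra.
Variables (K : numFieldType) (n : nat).
Local Notation gl := 'M[K]_(n + n).

Definition mx_even (x : gl) : gl := block_mx (ulsubmx x) 0 0 (drsubmx x).
Definition mx_odd (x : gl) : gl := block_mx 0 (ursubmx x) (dlsubmx x) 0.

(* Parity is a boolean: [false] is even, [true] is odd. *)
Definition homog (b : bool) (x : gl) : Prop :=
  x = if b then mx_odd x else mx_even x.

Definition mx_theta (x : gl) : gl := mx_even x - mx_odd x.

(* The bilinear extension of [x, y] = x y - (-1)^(|x||y|) y x. *)
Definition scomm (x y : gl) : gl :=
  x *m y - (mx_even y *m mx_even x + mx_even y *m mx_odd x
            + mx_odd y *m mx_even x - mx_odd y *m mx_odd x).

Fact submx_lin a (x y : gl) :
  [/\ ulsubmx (a *: x + y) = a *: ulsubmx x + ulsubmx y,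
      ursubmx (a *: x + y) = a *: ursubmx x + ursubmx y,
      dlsubmx (a *: x + y) = a *: dlsubmx x + dlsubmx y
    & drsubmx (a *: x + y) = a *: drsubmx x + drsubmx y].
Proof. by split; apply/matrixP=> i j; rewrite !mxE. Qed.

Lemma mx_thetaE x :
  mx_theta x = block_mx (ulsubmx x) (- ursubmx x) (- dlsubmx x) (drsubmx x).
Proof.
by rewrite /mx_theta /mx_even /mx_odd opp_block_mx add_block_mx !oppr0 !addr0 !add0r.
Qed.

Lemma mx_thetaK : involutive mx_theta.
Proof.
move=> x; rewrite !mx_thetaE block_mxKul block_mxKur block_mxKdl block_mxKdr.
by rewrite !opprK submxK.
Qed.

Lemma mx_evenD x : mx_even x + mx_odd x = x.
Proof. by rewrite /mx_even /mx_odd add_block_mx !addr0 !add0r submxK. Qed.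

Lemma mx_theta_lin a x y : mx_theta (a *: x + y) = a *: mx_theta x + mx_theta y.
Proof.
rewrite !mx_thetaE scale_block_mx add_block_mx.
by rewrite -{1 2 3 4}[x]submxK -{1 2 3 4}[y]submxK scale_block_mx add_block_mx
   block_mxKul block_mxKur block_mxKdl block_mxKdr !scalerN -!opprD.
Qed.

Lemma mx_thetaM x y : mx_theta (x *m y) = mx_theta x *m mx_theta y.
Proof.
rewrite !mx_thetaE mulmx_block -{1 2 3 4}[x]submxK -{1 2 3 4}[y]submxK.
rewrite mulmx_block block_mxKul block_mxKur block_mxKdl block_mxKdr.
by rewrite !mulmxN !mulNmx !opprK -!opprD.
Qed.

Lemma mx_evenE x : mx_even (mx_theta x) = mx_even x.
Proof. by rewrite mx_thetaE /mx_even block_mxKul block_mxKdr. Qed.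

Lemma mx_oddE x : mx_odd (mx_theta x) = - mx_odd x.
Proof.
by rewrite mx_thetaE /mx_odd block_mxKur block_mxKdl opp_block_mx !oppr0.
Qed.

Lemma mx_theta_even x : mx_theta (mx_even x) = mx_even x.
Proof.
by rewrite mx_thetaE /mx_even block_mxKul block_mxKur block_mxKdl block_mxKdr !oppr0.
Qed.

Lemma mx_theta_odd x : mx_theta (mx_odd x) = - mx_odd x.
Proof.
by rewrite mx_thetaE /mx_odd block_mxKul block_mxKur block_mxKdl block_mxKdr
  opp_block_mx !oppr0.
Qed.

Lemma mx_thetaD x y : mx_theta (x + y) = mx_theta x + mx_theta y.
Proof. by rewrite -[x]scale1r mx_theta_lin !scale1r. Qed.

Lemma mx_thetaN x : mx_theta (- x) = - mx_theta x.
Proof.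
have theta0 : mx_theta 0 = 0.
  by have := mx_theta_lin (-1) 0 0; rewrite scaler0 addr0 scaleN1r addNr.
by rewrite -[- x]addr0 -scaleN1r mx_theta_lin theta0 addr0 scaleN1r.
Qed.

Lemma mx_theta_scomm x y : mx_theta (scomm x y) = scomm (mx_theta x) (mx_theta y).
Proof.
rewrite /scomm !(mx_thetaD, mx_thetaN, mx_thetaM).
by rewrite !(mx_theta_even, mx_theta_odd, mx_evenE, mx_oddE).
Qed.

Lemma homog_even x : homog false (mx_even x).
Proof. by rewrite /homog /mx_even block_mxKul block_mxKdr. Qed.

Lemma homog_odd x : homog true (mx_odd x).
Proof. by rewrite /homog /mx_odd block_mxKur block_mxKdl. Qed.

Lemma homog_theta b x : homog b x -> mx_theta x = (-1) ^+ b *: x.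
Proof.
by case: b => -> /=; rewrite ?mx_theta_even ?mx_theta_odd ?expr1 ?expr0
  ?scaleN1r ?scale1r.
Qed.

Lemma homog_thetaP b x : homog b x -> homog b (mx_theta x).
Proof.
rewrite /homog => hx; rewrite {1}hx.
by case: b {hx}; rewrite ?mx_theta_even ?mx_theta_odd ?mx_evenE ?mx_oddE.
Qed.

(* Subalgebras are given as subsets of gl(n|n). *)
Definition pe : set gl :=
  [set x | [/\ drsubmx x = - (ulsubmx x)^T,
               (ursubmx x)^T = ursubmx x
             & (dlsubmx x)^T = - dlsubmx x]].

Lemma pe_theta x : pe x -> pe (mx_theta x).
Proof.
move=> [h1 h2 h3]; rewrite mx_thetaE /pe /=.
rewrite block_mxKul block_mxKur block_mxKdl block_mxKdr.
by split=> //; rewrite linearN /= ?h2 ?h3.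
Qed.

Lemma pe_lin a x y : pe x -> pe y -> pe (a *: x + y).
Proof.
move=> [h1 h2 h3] [k1 k2 k3].
have [e1 e2 e3 e4] := submx_lin a x y.
rewrite /pe /= e1 e2 e3 e4 h1 k1 !linearP /= h2 h3 k2 k3.
by split; rewrite // ?scalerN ?opprD.
Qed.

Lemma pe0 : pe 0.
Proof. by split; apply/matrixP=> i j; rewrite !mxE ?oppr0. Qed.

Lemma scomm_block (A B C D A' B' C' D' : 'M[K]_n) :
  scomm (block_mx A B C D) (block_mx A' B' C' D')
  = block_mx (A *m A' + B *m C' - (A' *m A - B' *m C))
             (A *m B' + B *m D' - (A' *m B + B' *m D))
             (C *m A' + D *m C' - (D' *m C + C' *m A))
             (C *m B' + D *m D' - (D' *m D - C' *m B)).
Proof.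
rewrite /scomm /mx_even /mx_odd.
rewrite !(block_mxKul, block_mxKur, block_mxKdl, block_mxKdr) !mulmx_block.
rewrite !(mul0mx, mulmx0) !(add0r, addr0).
by rewrite !(opp_block_mx, add_block_mx) !(oppr0, add0r, addr0).
Qed.

Lemma pe_scomm x y : pe x -> pe y -> pe (scomm x y).
Proof.
move=> [h1 h2 h3] [k1 k2 k3].
rewrite -[x]submxK -[y]submxK h1 k1 scomm_block /pe /=.
rewrite block_mxKul block_mxKur block_mxKdl block_mxKdr.
move: (ulsubmx x) (ursubmx x) (dlsubmx x) h2 h3 => A B C h2 h3.
move: (ulsubmx y) (ursubmx y) (dlsubmx y) k2 k3 => A' B' C' k2 k3.
have trD (X Y : 'M[K]_n) : (X + Y)^T = X^T + Y^T by apply: linearD.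
have trN (X : 'M[K]_n) : (- X)^T = - X^T by apply: linearN.
rewrite !(trD, trN) !trmx_mul !(trN, trmxK) h2 h3 k2 k3.
rewrite !(mulmxN, mulNmx, opprK).
by split; apply/matrixP=> i j; rewrite !mxE; ring.
Qed.

Lemma pe_even x : pe x -> pe (mx_even x).
Proof.
move=> [h1 h2 h3]; rewrite /pe /= /mx_even.
by rewrite block_mxKul block_mxKur block_mxKdl block_mxKdr trmx0 oppr0.
Qed.

Lemma pe_odd x : pe x -> pe (mx_odd x).
Proof.
move=> [h1 h2 h3]; rewrite /pe /= /mx_odd.
by rewrite block_mxKul block_mxKur block_mxKdl block_mxKdr trmx0 oppr0.
Qed.

Definition pe_0 : set gl := [set x | [/\ pe x, ursubmx x = 0 & dlsubmx x = 0]].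
Definition pe_1 : set gl := [set x | [/\ pe x, ulsubmx x = 0 & dlsubmx x = 0]].
Definition pe_ge0 : set gl := [set x | pe x /\ dlsubmx x = 0].

Definition cartan : set gl := [set x | pe x /\ is_diag_mx x].

Definition nilp : set gl :=
  [set x | pe_ge0 x /\ forall i j : 'I_n, (j <= i)%N -> ulsubmx x i j = 0].

(* A weight lambda : h -> K is encoded by its coordinates in the basis
   epsilon_1, ..., epsilon_n dual to the diagonal entries of the block A. *)
Definition wt (lambda : 'rV[K]_n) (x : gl) : K :=
  \sum_(i < n) lambda 0 i * ulsubmx x i i.

Section Parabolic.
Variable p0 : set 'M[K]_n.

Definition parabolic : Prop :=
  [/\ forall a A B, p0 A -> p0 B -> p0 (a *: A + B),
      forall A B, p0 A -> p0 B -> p0 (A *m B - B *m A)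
    & forall A : 'M[K]_n, (forall i j : 'I_n, (j < i)%N -> A i j = 0) -> p0 A].

Definition par : set gl := [set x | pe_ge0 x /\ p0 (ulsubmx x)].

(* The elementary matrix E_ij spans the root space of epsilon_i - epsilon_j
   (i <> j); such a root belongs to the Levi subalgebra containing h exactly
   when it and its opposite are both roots of p0. *)
Definition levi_root (i j : 'I_n) : Prop :=
  p0 (delta_mx i j) /\ p0 (delta_mx j i).

Definition levi : set gl :=
  [set x | pe_0 x /\ forall i j, ulsubmx x i j != 0 -> levi_root i j].

(* The complement of [levi] in [par]: the nilradical of p0 plus g_1. *)
Definition nilrad : set gl :=
  [set x | par x /\ forall i j, levi_root i j -> ulsubmx x i j = 0].

Definition dominant (lambda : 'rV[K]_n) : Prop :=
  forall i j : 'I_n, (i < j)%N -> levi_root i j ->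
    exists k : nat, lambda 0 i - lambda 0 j = k%:R.

End Parabolic.

End Superalgebra.

Arguments pe {K} n.
Arguments pe_0 {K} n.
Arguments pe_1 {K} n.
Arguments pe_ge0 {K} n.
Arguments cartan {K n}.
Arguments nilp {K n}.

Section Modules.
Variables (K : numFieldType) (n : nat).
Local Notation gl := 'M[K]_(n + n).

(* Supermodules over the graded subalgebra [s].  The Z/2-grading of the
   carrier is recorded by its parity involution [sgn] : v |-> (-1)^|v| v, i.e.
   the component of parity b is the (-1)^b-eigenspace of [sgn].  The values of
   [act] outside [s] are irrelevant. *)
Record smod (s : set gl) := SMod {
  scarrier :> lmodType K;
  act : gl -> scarrier -> scarrier;
  sgn : scarrier -> scarrier;
  act_linl : forall a x y v, s x -> s y ->
    act (a *: x + y) v = a *: act x v + act y v;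
  act_linr : forall x a u v, s x -> act x (a *: u + v) = a *: act x u + act x v;
  act_scomm : forall b c x y v, s x -> s y -> homog b x -> homog c y ->
    act (scomm x y) v = act x (act y v) - (-1) ^+ (b && c) *: act y (act x v);
  sgn_lin : forall a u v, sgn (a *: u + v) = a *: sgn u + sgn v;
  sgnK : forall v, sgn (sgn v) = v;
  sgn_act : forall b x v, s x -> homog b x ->
    sgn (act x v) = (-1) ^+ b *: act x (sgn v)
}.

Section Over.
Variable s : set gl.

(* Morphisms are even. *)
Definition is_hom (M N : smod s) (f : M -> N) : Prop :=
  [/\ forall a u v, f (a *: u + v) = a *: f u + f v,
      forall x v, s x -> f (act x v) = act x (f v)
    & forall v, f (sgn v) = sgn (f v)].

Definition nonzero (M : smod s) : Prop := exists v : M, v != 0.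

Lemma sgn0 (M : smod s) : sgn (0 : M) = 0.
Proof. by have := sgn_lin (-1) (0 : M) 0; rewrite scaler0 addr0 scaleN1r addNr. Qed.

Section OneModule.
Variable M : smod s.

Definition subspace (S : set M) : Prop :=
  S 0 /\ forall a u v, S u -> S v -> S (a *: u + v).

Definition stable (t : set gl) (S : set M) : Prop :=
  forall x v, t x -> S v -> S (act x v).

(* U(t)G, the t-submodule generated by G. *)
Definition Uspan (t : set gl) (G : set M) : set M :=
  smallest [set S | subspace S /\ stable t S] G.

Definition findim (S : set M) : Prop :=
  exists (k : nat) (b : 'I_k -> M),
    forall v, S v -> exists c : 'I_k -> K, v = \sum_(i < k) c i *: b i.

Definition fin_gen : Prop :=
  exists (k : nat) (b : 'I_k -> M), Uspan s (range b) = setT.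

Definition loc_finite (t : set gl) : Prop :=
  forall v : M, findim (Uspan t [set v]).

Definition weight_vector (mu : 'rV[K]_n) (v : M) : Prop :=
  forall x, cartan x -> act x v = wt mu x *: v.

Definition h_semisimple : Prop :=
  forall v : M, exists (k : nat) (mu : 'I_k -> 'rV[K]_n) (u : 'I_k -> M),
    (forall i, weight_vector (mu i) (u i)) /\ v = \sum_(i < k) u i.

(* [M] is simple as a supermodule over the subalgebra [t] of [s]. *)
Definition simple_over (t : set gl) : Prop :=
  nonzero M /\
  forall S : set M, subspace S -> stable t S -> (forall v, S v -> S (sgn v)) ->
    S = [set 0] \/ S = setT.

(* [M], restricted to the subalgebra [t] of [s], is the simple module of
   highest weight lambda with respect to the Borel subalgebra of [t] cut out by
   [cartan] and [nilp]. *)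
Definition simple_hw (t : set gl) (lambda : 'rV[K]_n) : Prop :=
  simple_over t /\
  exists v : M, [/\ v != 0, weight_vector lambda v
                  & forall x, t x -> nilp x -> act x v = 0].

End OneModule.
End Over.

Definition assoc_var (M : smod (pe n)) : set gl :=
  [set x | [/\ pe n x, homog true x, scomm x x = 0
             & [set v : M | act x v = 0] `\` range (fun v : M => act x v)
                 !=set0]].

Definition is_surj (T U : Type) (f : T -> U) : Prop := forall y, exists x, f x = y.

Definition catO (M : smod (pe n)) : Prop :=
  [/\ fin_gen M, h_semisimple M & loc_finite M nilp].

Definition catOp (p0 : set 'M[K]_n) (M : smod (pe n)) : Prop :=
  catO M /\ loc_finite M (par p0).

Section ProjectiveDimension.
(* The full subcategory on the g-modules satisfying A; it is used for A closed
   under submodules, quotients and finite sums, where epimorphisms are the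
   surjections and exactness is that of vector spaces. *)
Variable A : smod (pe n) -> Prop.

Definition projective (P : smod (pe n)) : Prop :=
  A P /\
  forall (M N : smod (pe n)) (f : M -> N) (g : P -> N),
    A M -> A N -> is_hom f -> is_surj f -> is_hom g ->
    exists h : P -> M, is_hom h /\ forall v, f (h v) = g v.

(* An exact sequence 0 -> P_d -> ... -> P_0 -> M -> 0 with projective P_i,
   extended by P_i = 0 for i > d. *)
Definition proj_resolution (M : smod (pe n)) (d : nat) : Prop :=
  exists (P : nat -> smod (pe n)) (diff : forall i, P i.+1 -> P i)
         (eps : P 0%N -> M),
    [/\ forall i, projective (P i),
        (forall i, is_hom (@diff i)) /\ is_hom eps,
        is_surj eps /\ [set v | eps v = 0] = range (@diff 0%N),
        forall i, [set v | @diff i v = 0] = range (@diff i.+1)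
      & forall i, (d < i)%N -> forall v : P i, v = 0].

(* The least length of a projective resolution; [None] stands for infinity. *)
Definition pd (M : smod (pe n)) : option nat :=
  match pselect (exists d, `[< proj_resolution M d >]) with
  | left e => Some (ex_minn e)
  | right _ => None
  end.

End ProjectiveDimension.

Definition infinite_pd (A : smod (pe n) -> Prop) (M : smod (pe n)) : Prop :=
  pd A M = None.

End Modules.

(* The induced module Ind_t^g N = U(g) (x)_{U(t)} N for g = pe(n) and a graded
   subalgebra t of g.  Its elements are classes of formal expressions: [IGen v]
   stands for 1 (x) v and [IAct x m] for x m, so that x_1 ... x_k (x) v is
   IAct x_1 (... (IAct x_k (IGen v))).  The relations are those of a vector
   space, those of U(g) (linearity in x and the bracket relation), linearity in
   v, and the balancing relation y (x) v = 1 (x) y v for y in t.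
   [ind_frobenius] below is the corresponding universal property. *)
Section Induction.
Variables (K : numFieldType) (n : nat) (t : set 'M[K]_(n + n)) (N : smod t).
Local Notation gl := 'M[K]_(n + n).

Inductive iterm : Type :=
| IZero
| IAdd of iterm & iterm
| IScale of K & iterm
| IGen of N
| IAct of gl & iterm.

Inductive ieq : iterm -> iterm -> Prop :=
| ieq_refl m : ieq m m
| ieq_sym m m' : ieq m m' -> ieq m' m
| ieq_trans m1 m2 m3 : ieq m1 m2 -> ieq m2 m3 -> ieq m1 m3
| ieq_add m1 m1' m2 m2' :
    ieq m1 m1' -> ieq m2 m2' -> ieq (IAdd m1 m2) (IAdd m1' m2')
| ieq_scale a m m' : ieq m m' -> ieq (IScale a m) (IScale a m')
| ieq_act x m m' : ieq m m' -> ieq (IAct x m) (IAct x m')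
| ieq_addA m1 m2 m3 : ieq (IAdd m1 (IAdd m2 m3)) (IAdd (IAdd m1 m2) m3)
| ieq_addC m1 m2 : ieq (IAdd m1 m2) (IAdd m2 m1)
| ieq_add0 m : ieq (IAdd IZero m) m
| ieq_scale0 m : ieq (IScale 0 m) IZero
| ieq_scale1 m : ieq (IScale 1 m) m
| ieq_scaleA a b m : ieq (IScale a (IScale b m)) (IScale (a * b) m)
| ieq_scaleDr a m1 m2 :
    ieq (IScale a (IAdd m1 m2)) (IAdd (IScale a m1) (IScale a m2))
| ieq_scaleDl a b m : ieq (IScale (a + b) m) (IAdd (IScale a m) (IScale b m))
| ieq_act_linr x a m1 m2 :
    ieq (IAct x (IAdd (IScale a m1) m2)) (IAdd (IScale a (IAct x m1)) (IAct x m2))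
| ieq_act_linl a x y m : pe n x -> pe n y ->
    ieq (IAct (a *: x + y) m) (IAdd (IScale a (IAct x m)) (IAct y m))
| ieq_act_scomm b c x y m : pe n x -> pe n y -> homog b x -> homog c y ->
    ieq (IAct (scomm x y) m)
        (IAdd (IAct x (IAct y m)) (IScale (- (-1) ^+ (b && c)) (IAct y (IAct x m))))
(* Matrices outside g are not acting: their action is set to zero. *)
| ieq_act_out x m : ~ pe n x -> ieq (IAct x m) IZero
| ieq_gen_lin a u v : ieq (IGen (a *: u + v)) (IAdd (IScale a (IGen u)) (IGen v))
| ieq_gen_act b y v : t y -> homog b y -> ieq (IAct y (IGen v)) (IGen (act y v)).

HB.instance Definition _ := gen_eqMixin iterm.
HB.instance Definition _ := gen_choiceMixin iterm.

Definition ieqb (m m' : iterm) : bool := `[< ieq m m' >].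

Lemma ieqb_equiv : equiv_class_of ieqb.
Proof.
split.
- by move=> m; apply/asboolP; apply: ieq_refl.
- by move=> m m'; apply/asboolP/asboolP; apply: ieq_sym.
- by move=> m2 m1 m3 /asboolP h1 /asboolP h2; apply/asboolP; apply: ieq_trans h2.
Qed.

Canonical ieq_equiv := EquivRelPack ieqb_equiv.

Definition ind_type : Type := {eq_quot ieq_equiv}.
HB.instance Definition _ := Choice.on ind_type.

Definition icls (m : iterm) : ind_type := \pi_({eq_quot ieq_equiv}) m.
Definition irep (u : ind_type) : iterm := repr (u : {eq_quot ieq_equiv}).

Lemma icls_eq m m' : ieq m m' <-> icls m = icls m'.
Proof.
split=> [h|/eqmodP]; first by apply/eqmodP; apply/asboolP.
by move/asboolP.
Qed.

Lemma irepK u : icls (irep u) = u.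
Proof. exact: reprK. Qed.

Lemma icls_rep m : ieq (irep (icls m)) m.
Proof. by apply/icls_eq; rewrite irepK. Qed.

Lemma icls_ind (P : ind_type -> Prop) : (forall m, P (icls m)) -> forall u, P u.
Proof. by move=> h u; rewrite -[u]irepK. Qed.

Definition ind_add u v := icls (IAdd (irep u) (irep v)).
Definition ind_opp u := icls (IScale (- 1) (irep u)).
Definition ind_scale a u := icls (IScale a (irep u)).
Definition ind_gen (v : N) : ind_type := icls (IGen v).
Definition ind_act x u := icls (IAct x (irep u)).

Lemma ind_addE m m' : ind_add (icls m) (icls m') = icls (IAdd m m').
Proof. by apply/icls_eq/ieq_add; apply: icls_rep. Qed.

Lemma ind_scaleE a m : ind_scale a (icls m) = icls (IScale a m).
Proof. by apply/icls_eq/ieq_scale/icls_rep. Qed.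

Lemma ind_actE x m : ind_act x (icls m) = icls (IAct x m).
Proof. by apply/icls_eq/ieq_act/icls_rep. Qed.

Fact ind_addA : associative ind_add.
Proof.
elim/icls_ind=> m1; elim/icls_ind=> m2; elim/icls_ind=> m3.
by rewrite !ind_addE; apply/icls_eq/ieq_addA.
Qed.

Fact ind_addC : commutative ind_add.
Proof.
elim/icls_ind=> m1; elim/icls_ind=> m2.
by rewrite !ind_addE; apply/icls_eq/ieq_addC.
Qed.

Fact ind_add0 : left_id (icls IZero) ind_add.
Proof. by elim/icls_ind=> m; rewrite ind_addE; apply/icls_eq/ieq_add0. Qed.

Fact ind_addN : left_inverse (icls IZero) ind_opp ind_add.
Proof.
elim/icls_ind=> m; rewrite /ind_opp -/(ind_scale _ _) ind_scaleE ind_addE.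
apply/icls_eq; apply: ieq_trans (ieq_scale0 m).
rewrite -(addNr 1); apply: ieq_sym; apply: ieq_trans (ieq_scaleDl _ _ _) _.
by apply: ieq_add (ieq_refl _) (ieq_scale1 _).
Qed.

HB.instance Definition _ :=
  GRing.isZmodule.Build ind_type ind_addA ind_addC ind_add0 ind_addN.

Fact ind_scaleA a b u : ind_scale a (ind_scale b u) = ind_scale (a * b) u.
Proof.
by elim/icls_ind: u => m; rewrite !ind_scaleE; apply/icls_eq/ieq_scaleA.
Qed.

Fact ind_scale1 : left_id 1 ind_scale.
Proof. by elim/icls_ind=> m; rewrite ind_scaleE; apply/icls_eq/ieq_scale1. Qed.

Fact ind_scaleDr : right_distributive ind_scale +%R.
Proof.
move=> a; elim/icls_ind=> m1; elim/icls_ind=> m2.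
rewrite /GRing.add /= !(ind_addE, ind_scaleE).
by apply/icls_eq/ieq_scaleDr.
Qed.

Fact ind_scaleDl u : {morph ind_scale^~ u : a b / a + b}.
Proof.
elim/icls_ind: u => m a b.
rewrite [RHS]/GRing.add /= !(ind_addE, ind_scaleE).
by apply/icls_eq/ieq_scaleDl.
Qed.

HB.instance Definition _ := GRing.Zmodule_isLmodule.Build K ind_type
  ind_scaleA ind_scale1 ind_scaleDr ind_scaleDl.

Lemma icls_lin a m m' : icls (IAdd (IScale a m) m') = a *: icls m + icls m'.
Proof. by rewrite /GRing.scale /GRing.add /= ind_scaleE ind_addE. Qed.

Lemma icls0 : icls IZero = 0. Proof. by []. Qed.

Lemma icls_gen0 : icls (IGen 0) = 0.
Proof.
have /icls_eq := ieq_gen_lin (-1) 0 0.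
by rewrite icls_lin scaler0 addr0 scaleN1r addNr.
Qed.

Lemma icls_act0 m : icls (IAct 0 m) = 0.
Proof.
have /icls_eq := ieq_act_linl (-1) m (@pe0 K n) (@pe0 K n).
by rewrite icls_lin scaler0 addr0 scaleN1r addNr.
Qed.

(* The grading: |x_1 ... x_k (x) v| = |x_1| + ... + |x_k| + |v|. *)
Fixpoint isgn (m : iterm) : iterm :=
  match m with
  | IZero => IZero
  | IAdd m1 m2 => IAdd (isgn m1) (isgn m2)
  | IScale a m => IScale a (isgn m)
  | IGen v => IGen (sgn v)
  | IAct x m => IAct (mx_theta x) (isgn m)
  end.

Lemma isgn_eq m m' : ieq m m' -> ieq (isgn m) (isgn m').
Proof.
elim=> /=; try by move=> *; eauto using ieq.
- move=> a x y m0 hx hy; rewrite mx_theta_lin.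
  by apply: ieq_act_linl; apply: pe_theta.
- move=> b c x y m0 hx hy hbx hcy; rewrite mx_theta_scomm.
  apply: ieq_act_scomm.
  + exact: pe_theta.
  + exact: pe_theta.
  + exact: homog_thetaP.
  + exact: homog_thetaP.
- move=> x m0 hx; apply: ieq_act_out => /pe_theta.
  by rewrite mx_thetaK.
- by move=> a u v; rewrite sgn_lin; apply: ieq_gen_lin.
- move=> b y v ty hy; rewrite (sgn_act _ ty hy) (homog_theta hy).
  have [py|py] := pselect (pe n y).
    apply/icls_eq.
    have /icls_eq := ieq_act_linl ((-1) ^+ b) (IGen (sgn v)) py (@pe0 _ _).
    rewrite addr0 => ->.
    have /icls_eq := ieq_gen_lin ((-1) ^+ b) (act y (sgn v)) 0.
    rewrite addr0 => ->.
    rewrite !icls_lin; congr (_ *: _ + _); first exact/icls_eq/(ieq_gen_act _ ty hy).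
    by rewrite icls_act0 icls_gen0.
  have e0 : ieq (IGen (act y (sgn v))) IZero.
    apply: ieq_trans (ieq_sym (ieq_gen_act _ ty hy)) _.
    exact: ieq_act_out.
  case: b hy => hy; rewrite ?expr0 ?expr1 ?scale1r ?scaleN1r; last first.
    by apply: ieq_gen_act hy.
  apply: ieq_trans (ieq_act_out _ _) _.
    by move=> /(pe_lin (-1) (y := 0)) h; apply: py; move: (h (@pe0 _ _)); rewrite addr0 scaleN1r opprK.
  apply/icls_eq.
  have /icls_eq := ieq_gen_lin (-1) (act y (sgn v)) 0.
  rewrite addr0 scaleN1r => ->; rewrite icls_lin icls_gen0 addr0.
  by rewrite ((icls_eq _ _).1 e0) icls0 scaler0.
Qed.

Definition ind_sgn u := icls (isgn (irep u)).

Lemma ind_sgnE m : ind_sgn (icls m) = icls (isgn m).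
Proof. exact/icls_eq/isgn_eq/icls_rep. Qed.

Fact ind_act_linl a x y u : pe n x -> pe n y ->
  ind_act (a *: x + y) u = a *: ind_act x u + ind_act y u.
Proof.
elim/icls_ind: u => m hx hy; rewrite !ind_actE -icls_lin.
exact/icls_eq/ieq_act_linl.
Qed.

Fact ind_act_linr x a u v : pe n x ->
  ind_act x (a *: u + v) = a *: ind_act x u + ind_act x v.
Proof.
move=> _; elim/icls_ind: u => m; elim/icls_ind: v => m'.
rewrite -icls_lin !ind_actE -icls_lin.
exact/icls_eq/ieq_act_linr.
Qed.

Fact ind_act_scomm b c x y u : pe n x -> pe n y -> homog b x -> homog c y ->
  ind_act (scomm x y) u
  = ind_act x (ind_act y u) - (-1) ^+ (b && c) *: ind_act y (ind_act x u).
Proof.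
elim/icls_ind: u => m hx hy hb hc; rewrite !ind_actE -scaleNr addrC -icls_lin.
apply/icls_eq; apply: ieq_trans (ieq_addC _ _).
exact: ieq_act_scomm.
Qed.

Fact ind_sgn_lin a u v : ind_sgn (a *: u + v) = a *: ind_sgn u + ind_sgn v.
Proof.
elim/icls_ind: u => m; elim/icls_ind: v => m'.
by rewrite -icls_lin !ind_sgnE /= icls_lin.
Qed.

Fact ind_sgnK u : ind_sgn (ind_sgn u) = u.
Proof.
elim/icls_ind: u => m; rewrite !ind_sgnE; congr icls.
by elim: m => //= [? -> ? ->|? ? ->|?|? ? ->] //; rewrite ?sgnK ?mx_thetaK.
Qed.

Fact ind_sgn_act b x u : pe n x -> homog b x ->
  ind_sgn (ind_act x u) = (-1) ^+ b *: ind_act x (ind_sgn u).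
Proof.
elim/icls_ind: u => m hx hb; rewrite !(ind_actE, ind_sgnE) /= (homog_theta hb).
have /icls_eq := ieq_act_linl ((-1) ^+ b) (isgn m) hx (@pe0 _ _).
by rewrite addr0 => ->; rewrite icls_lin icls_act0 addr0.
Qed.

Definition Ind : smod (pe n) :=
  SMod ind_act_linl ind_act_linr ind_act_scomm ind_sgn_lin ind_sgnK ind_sgn_act.

(* Universal property (Frobenius reciprocity). *)
Section Frobenius.
Variables (X : smod (@pe K n)) (f : N -> X).
Hypothesis t_pe : t `<=` @pe K n.
Hypothesis f_lin : forall a u v, f (a *: u + v) = a *: f u + f v.
Hypothesis f_act : forall y v, t y -> f (act y v) = act y (f v).
Hypothesis f_sgn : forall v, f (sgn v) = sgn (f v).

Fixpoint iev (m : iterm) : X :=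
  match m with
  | IZero => 0
  | IAdd m1 m2 => iev m1 + iev m2
  | IScale a m => a *: iev m
  | IGen v => f v
  | IAct x m => if `[< @pe K n x >] then act x (iev m) else 0
  end.

Lemma iev_eq m m' : ieq m m' -> iev m = iev m'.
Proof.
elim=> //=.
- by move=> m1 m2 m3 _ -> _ ->.
- by move=> m1 m1' m2 m2' _ -> _ ->.
- by move=> a m1 m2 _ ->.
- by move=> x m1 m2 _ ->.
- by move=> *; rewrite addrA.
- by move=> *; rewrite addrC.
- by move=> *; rewrite add0r.
- by move=> *; rewrite scale0r.
- by move=> *; rewrite scale1r.
- by move=> *; rewrite scalerA.
- by move=> *; rewrite scalerDr.
- by move=> *; rewrite scalerDl.
- move=> x a m1 m2; case: asboolP => hx; first exact: act_linr.
  by rewrite scaler0 addr0.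
- move=> a x y m1 hx hy; rewrite !asboolT //; first exact: act_linl.
  exact: pe_lin.
- move=> b c x y m1 hx hy hb hc; rewrite !asboolT //; last exact: pe_scomm.
  by rewrite (act_scomm _ hx hy hb hc) scaleNr.
- by move=> x m1 hx; rewrite asboolF.
- by move=> b y v ty _; rewrite asboolT ?f_act //; apply: t_pe.
Qed.

Lemma ind_frobenius :
  exists F : Ind -> X, [/\ is_hom F, forall v, F (ind_gen v) = f v
    & forall G : Ind -> X, is_hom G -> (forall v, G (ind_gen v) = f v) -> G =1 F].
Proof.
pose F (u : Ind) := iev (irep u).
have FE m : F (icls m) = iev m by apply/iev_eq/icls_rep.
exists F; split.
- split=> [a|x|].
  + elim/icls_ind=> m; elim/icls_ind=> m'.
    by rewrite -icls_lin !FE.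
  + elim/icls_ind=> m hx; rewrite /act /= ind_actE !FE /= asboolT //.
  + elim/icls_ind=> m; rewrite [sgn _]ind_sgnE !FE.
    elim: m => /=.
    * by rewrite sgn0.
    * move=> m1 -> m2 ->; rewrite -[iev m1]scale1r sgn_lin.
      by rewrite !scale1r.
    * move=> a m1 ->; have := sgn_lin a (iev m1) 0; rewrite addr0 => ->.
      by rewrite sgn0 addr0.
    * by move=> v.
    * move=> x m1 ->; have [hx|hx] := pselect (pe n x); last first.
        have hx' : ~ pe n (mx_theta x) by move/pe_theta; rewrite mx_thetaK.
        by rewrite !asboolF // sgn0.
      rewrite !asboolT //; last exact: pe_theta.
      move: (iev m1) => w; have he := pe_even hx; have ho := pe_odd hx.
      have hwe := sgn_act w he (homog_even x).
      have hwo := sgn_act w ho (homog_odd x).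
      have -> : mx_theta x = (-1) *: mx_odd x + mx_even x.
        by rewrite scaleN1r addrC.
      rewrite act_linl // addrC -{3}[x]mx_evenD -[mx_even x in RHS]scale1r.
      by rewrite act_linl // sgn_lin hwe hwo expr0 expr1 !scale1r.
- by move=> v; rewrite FE.
- move=> G [Glin Gact _] Gf u.
  elim/icls_ind: u => m; rewrite FE.
  have G0 : G 0 = 0.
    by have := Glin (-1) 0 0; rewrite scaler0 addr0 scaleN1r addNr.
  elim: m => /=.
  + by rewrite icls0.
  + move=> m1 <- m2 <-; have := Glin 1 (icls m1) (icls m2).
    rewrite !scale1r => <-; congr G; rewrite -ind_addE //.
  + move=> a m1 <-; have := Glin a (icls m1) 0; rewrite G0 !addr0 => <-.
    by congr G; rewrite -ind_scaleE.
  + exact: Gf.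
  + move=> x m1 <-; case: asboolP => hx.
      by rewrite -Gact // /act /= ind_actE.
    by rewrite -G0 -icls0; congr G; apply/icls_eq/ieq_act_out.
Qed.

End Frobenius.

End Induction.

Section NamedModules.
Variables (K : numFieldType) (n : nat).

(* L^l(lambda) as a p-module: the nilradical of p0 and g_1 act by zero. *)
Definition is_Llevi (p0 : set 'M[K]_n) (lambda : 'rV[K]_n) (N : smod (par p0)) :=
  simple_hw N (levi p0) lambda /\ forall x (v : N), nilrad p0 x -> act x v = 0.

(* L_0(lambda) as a module over g_0 + g_1, with g_1 acting by zero. *)
Definition is_L0 (lambda : 'rV[K]_n) (N : smod (pe_ge0 n)) :=
  simple_hw N (pe_0 n) lambda /\ forall x (v : N), pe_1 n x -> act x v = 0.

Definition is_L (lambda : 'rV[K]_n) (L : smod (pe n)) := simple_hw L (pe n) lambda.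

(* Delta^p(lambda) and K(lambda) are [Delta N] and [Kac N] for N as in
   [is_Llevi] and [is_L0]. *)
Definition Delta (p0 : set 'M[K]_n) (N : smod (par p0)) : smod (pe n) := Ind N.
Definition Kac (N : smod (@pe_ge0 K n)) : smod (pe n) := Ind N.

End NamedModules.

(* Main.v *)
Require Import Defs.
From HB Require Import structures.
From mathcomp Require Import all_boot all_order all_algebra ring zify.

(* Let x be the root vector of weight 2 epsilon_n in g_1.

   In a module M generated by a vector v of weight lambda killed by n, every
   weight is lambda plus a sum of roots of the opposite of the Borel subalgebra.
   Grade by the element of h with eigenvalues n-1, ..., 1, 0: these roots have
   negative degree and x has degree 0.  Hence v is not in xM, whereas xv = 0.

   The Kac module E of the trivial g_{<=0}-module is the exterior algebra of
   g_1, where g_1 acts by multiplication, gl(n) by first order and g_{-1} by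
   second order differential operators.  It is finite-dimensional, has the
   trivial module as a quotient, and x has a contracting homotopy on it (the
   derivative dual to x).  For P projective in O or O^p the surjection from
   P (x) E to P splits, so ker x = im x on P.  This property passes along finite
   exact sequences to every module of finite projective dimension.

   It remains to see that Delta^p(lambda) and K(lambda) are nonzero.  For a
   grading of g in which p is the nonnegative part, g acts on the functions on
   words in positive elements with values in N which are compatible with
   brackets, as on Hom_{U(p^-)}(U(g), N); the functions supported on the empty
   word form a copy of N, so induction does not kill N. *)

Set Implicit Arguments.
Unset Strict Implicit.
Unset Printing Implicit Defensive.
Import Order.TTheory GRing.Theory Num.Theory.
Local Open Scope ring_scope.
Local Open Scope classical_set_scope.

(** The argument rests on an asymmetry of pe(n): 2 epsilon_n is a root but -2 epsilon_n is not,
    because the block C is antisymmetric. Hence lambda - 2 epsilon_n is not a weight of M, and there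
    is no vector that x could carry to v. E is finite-dimensional and semisimple over h so that P
    (x) E stays in the category, and its trivial quotient provides the surjection onto P. The
    contracting homotopy is only linear, not g-linear; it is inserted between the section P -> P (x)
    E and the contraction P (x) E -> P, which are morphisms and so commute with x. That an induced
    module does not vanish is usually read off from the PBW theorem. Here the injectivity of N ->
    Ind N suffices, and it follows from any g-module containing a copy of N on which p acts as it
    does on N. The coinduced module is such a module, and its relations can be checked by induction
    on words. *)

Section ModuleExpressions.
Variables (K : comNzRingType) (V : lmodType K).

(** Reflection for linear identities in a module: both sides are reified over a list of atoms, and
    the identity reduces to one ring identity between coefficients for each atom. *)
Inductive mexp := MVar of nat | MZero | MAdd of mexp & mexp | MOpp of mexp
  | MScale of K & mexp.

Fixpoint meval (env : seq V) e : V :=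
  match e with
  | MVar i => nth 0 env i
  | MZero => 0
  | MAdd a b => meval env a + meval env b
  | MOpp a => - meval env a
  | MScale c a => c *: meval env a
  end.

Fixpoint mcoef e (i : nat) : K :=
  match e with
  | MVar j => if eqn j i then 1 else 0
  | MZero => 0
  | MAdd a b => mcoef a i + mcoef b i
  | MOpp a => - mcoef a i
  | MScale c a => c * mcoef a i
  end.

(** A nested conjunction rather than a bounded quantifier, so that computation leaves one ring goal
    per atom. *)
Fixpoint mcoef_eq e1 e2 (m : nat) : Prop :=
  if m is k.+1 then mcoef e1 k = mcoef e2 k /\ mcoef_eq e1 e2 k else True.

Fixpoint mwf (m : nat) e : bool :=
  match e with
  | MVar i => (i < m)%N
  | MZero => true
  | MAdd a b => mwf m a && mwf m b
  | MOpp a => mwf m a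
  | MScale _ a => mwf m a
  end.

Lemma mevalE env e : mwf (size env) e ->
  meval env e = \sum_(i < size env) mcoef e i *: env`_i.
Proof.
elim: e => /= [j|_|a IHa b IHb /andP[/IHa-> /IHb->]|a IHa /IHa->|c a IHa /IHa->].
- move=> hj; rewrite (bigD1 (Ordinal hj)) //= -[eqn j j]/(j == j) eqxx scale1r.
  rewrite big1 ?addr0 // => i; rewrite -val_eqE /= -[eqn j i]/(j == i) eq_sym.
  by move=> /negPf->; rewrite scale0r.
- by rewrite big1 // => i _; rewrite scale0r.
- by rewrite -big_split; apply: eq_bigr => i _; rewrite scalerDl.
- by rewrite -sumrN; apply: eq_bigr => i _; rewrite scaleNr.
- by rewrite scaler_sumr; apply: eq_bigr => i _; rewrite scalerA.
Qed.

Lemma meval_eq env e1 e2 : mwf (size env) e1 -> mwf (size env) e2 ->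
  mcoef_eq e1 e2 (size env) -> meval env e1 = meval env e2.
Proof.
move=> w1 w2; rewrite !mevalE // => h; apply: eq_bigr => -[i hi] _ /=.
congr (_ *: _); elim: (size env) h hi => //= m IHm [em h].
by rewrite ltnS leq_eqVlt => /orP[/eqP->|/IHm]; [|apply].
Qed.

End ModuleExpressions.

Ltac mindex x l :=
  match l with
  | ?y :: _ => let _ := match goal with _ => constr_eq x y end in constr:(0%N)
  | _ :: ?l' => let k := mindex x l' in constr:(k.+1)
  end.

(* For matrices syntactic equality is not enough: the same product may occur
   with different canonical ring structures. *)
Ltac mfind x l :=
  match l with
  | _ => mindex x l
  | ?y :: _ =>
    let _ := lazymatch type of x with context [matrix] => unify x y end in
    constr:(0%N)
  | _ :: ?l' => let k := mfind x l' in constr:(k.+1)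
  end.

Ltac minsert x l :=
  match l with
  | _ => let _ := mfind x l in l
  | _ => constr:(x :: l)
  end.

Ltac matoms t l :=
  lazymatch t with
  | @GRing.add _ ?a ?b => let l' := matoms a l in matoms b l'
  | @GRing.opp _ ?a => matoms a l
  | @GRing.scale _ _ ?c ?a => matoms a l
  | @GRing.zero _ => l
  | _ => minsert t l
  end.

Ltac mreify K t l :=
  lazymatch t with
  | @GRing.add _ ?a ?b =>
    let a' := mreify K a l in let b' := mreify K b l in constr:(@MAdd K a' b')
  | @GRing.opp _ ?a => let a' := mreify K a l in constr:(@MOpp K a')
  | @GRing.scale _ _ ?c ?a => let a' := mreify K a l in constr:(@MScale K c a')
  | @GRing.zero _ => constr:(@MZero K)
  | _ => let i := mfind t l in constr:(@MVar K i)
  end.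

Ltac lmod K :=
  lazymatch goal with
  | |- @eq ?T ?a ?b =>
    let l := matoms a (@nil T) in
    let l := matoms b l in
    let ea := mreify K a l in
    let eb := mreify K b l in
    refine (@meval_eq K _ l ea eb isT isT _);
    cbn [mcoef_eq mcoef size eqn]; repeat split; try ring
  end.

(** * Fock spaces *)

Section Fock.
Variable K : numFieldType.

(* Creation operators z, annihilation operators D, parity s, vacuum Om and dual
   vacuum e; the last condition expresses that Om is cyclic for the z i. *)
Definition fock_axioms m d (z D : nat -> 'M[K]_d) (s : 'M[K]_d)
    (Om : 'cV[K]_d) (e : 'rV[K]_d) : Prop :=
  [/\ [/\ forall i j, (i < m)%N -> (j < m)%N -> z i *m z j + z j *m z i = 0,
          forall i j, (i < m)%N -> (j < m)%N ->
            D i *m z j + z j *m D i = (i == j)%:R%:M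
        & forall i, (i < m)%N -> is_diag_mx (z i *m D i)],
      [/\ s *m s = 1%:M, forall i, (i < m)%N -> s *m z i = - (z i *m s)
        & forall i, (i < m)%N -> s *m D i = - (D i *m s)],
      [/\ e != 0, e *m s = e & forall i, (i < m)%N -> e *m z i = 0],
      forall i, (i < m)%N -> D i *m Om = 0
    & forall (t : K) T, t != 0 ->
        (forall i, (i < m)%N -> T *m z i = t *: (z i *m T)) ->
        T *m Om = 0 -> T = 0].

(** Jordan-Wigner construction: each new creation operator doubles the space and moves the first
    summand to the second. The old operators act as diag(a, -a), which makes them anticommute with
    the new ones. *)
Lemma fock_exists m : exists d (z D : nat -> 'M[K]_d) s Om e,
  fock_axioms m z D s Om e.
Proof.
elim: m => [|m [d [z [D [s [Om [e [[zz Dz zD] [ss sz sD] [e0 es ez] DOm uniq]]]]]]]].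
  exists 1%N, (fun=> 0), (fun=> 0), 1%:M, 1%:M, 1%:M; split=> //.
  - by split=> //; rewrite ?mulmx1.
  - by split=> //; rewrite ?mulmx1 // oner_neq0.
  - by move=> t T _ _; rewrite mulmx1.
pose ext (a : nat -> 'M[K]_d) (a0 : 'M[K]_(d + d)) i :=
  if i is j.+1 then block_mx (a j) 0 0 (- a j) else a0.
pose z' := ext z (block_mx 0 0 1%:M 0).
pose D' := ext D (block_mx 0 1%:M 0 0).
pose s' : 'M[K]_(d + d) := block_mx s 0 0 (- s).
pose simpm := (mulmx_block, mulmx0, mul0mx, addr0, add0r, mulmxN, mulNmx,
  mulmx1, mul1mx, oppr0, add_block_mx, opp_block_mx, opprK).
have b0 : block_mx 0 0 0 0 = 0 :> 'M[K]_(d + d) by rewrite block_mx0.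
exists (d + d)%N, z', D', s', (col_mx Om 0), (row_mx e 0); split.
- split=> [[|i] [|j] hi hj|[|i] [|j] hi hj|[|i] hi]; rewrite /z' /D' /ext ?simpm.
  + by rewrite b0.
  + by rewrite addrN b0.
  + by rewrite addNr b0.
  + by rewrite zz // oppr0 b0.
  + by rewrite -scalar_mx_block.
  + by rewrite addNr b0 raddf0.
  + by rewrite addNr b0 raddf0.
  + by rewrite Dz // eqSS -scalar_mx_block.
  + by rewrite is_diag_block_mx // !eqxx !mx0_is_diag scalar_mx_is_diag.
  + by rewrite is_diag_block_mx // !eqxx !zD.
- split=> [|[|i] hi|[|i] hi]; rewrite /z' /D' /s' /ext !simpm.
  + by rewrite ss -scalar_mx_block.
  + by [].
  + by rewrite sz.
  + by [].
  + by rewrite sD.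
- split.
  + by apply: contra e0 => /eqP h; rewrite -(row_mxKl e (0 : 'rV_d)) h linear0.
  + by rewrite mul_row_block !simpm es.
  + case=> [|i] hi; rewrite /z' /ext mul_row_block !simpm ?row_mx0 //.
    by rewrite ez // row_mx0.
- case=> [|i] hi; rewrite /D' /ext mul_block_col !simpm ?col_mx0 //.
  by rewrite DOm // col_mx0.
move=> t T t0 hT; rewrite -[T]submxK.
move: (ulsubmx T) (ursubmx T) (dlsubmx T) (drsubmx T) (submxK T) => a b c f ET.
rewrite -{}ET in hT *; rewrite mul_block_col !simpm => hOm.
have [aOm cOm] : a *m Om = 0 /\ c *m Om = 0.
  by split; [have := congr1 usubmx hOm | have := congr1 dsubmx hOm];
     rewrite ?col_mxKu ?col_mxKd linear0.
(* The new creation operator makes the upper right block of T vanish and the lower right one equal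
   to t a, so only the left column remains. *)
have := hT 0%N isT; rewrite /z' /ext !simpm scale_block_mx !scaler0.
case/eq_block_mx=> -> _ -> _.
(* The old creation operators carry a sign on the second summand, so the lower left block satisfies
   the hypothesis with - t. This is why uniqueness is stated for arbitrary t. *)
have hz i : (i < m)%N -> a *m z i = t *: (z i *m a) /\ c *m z i = (- t) *: (z i *m c).
  move=> hi; have := hT i.+1 hi; rewrite /z' /ext !simpm scale_block_mx.
  by case/eq_block_mx=> -> _ -> _; rewrite scaleNr scalerN.
have -> : a = 0 by apply: (uniq t) => // i /hz[].
have -> : c = 0 by apply: (uniq (- t)); rewrite ?oppr_eq0 // => i /hz[].
by rewrite scaler0.
Qed.

End Fock.

(** * Fock space with generators indexed by unordered pairs *)

Section SymmetricFock.
Variables (K : numFieldType) (n : nat).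

(** The derivative of the symmetric variable Z_kl with respect to Z_ij, normalized without case
    distinction; its value is 2 when all indices agree. *)
Definition sym_delta (i j k l : 'I_n) : K :=
  ((i == k) && (j == l))%:R + ((i == l) && (j == k))%:R.

Definition sym_fock_axioms d (Z D : 'I_n -> 'I_n -> 'M[K]_d) (s : 'M[K]_d)
    (Om : 'cV[K]_d) (e : 'rV[K]_d) : Prop :=
  [/\ [/\ forall i j k l, Z i j *m Z k l + Z k l *m Z i j = 0,
          forall i j k l, D i j *m Z k l + Z k l *m D i j = (sym_delta i j k l)%:M,
          forall i j, is_diag_mx (Z i j *m D i j),
          forall i j, Z i j = Z j i
        & forall i j, D i j = D j i],
      [/\ s *m s = 1%:M, forall i j, s *m Z i j = - (Z i j *m s)
        & forall i j, s *m D i j = - (D i j *m s)],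
      [/\ e != 0, e *m s = e & forall i j, e *m Z i j = 0],
      forall i j, D i j *m Om = 0
    & forall (t : K) T, t != 0 ->
        (forall i j, T *m Z i j = t *: (Z i j *m T)) ->
        T *m Om = 0 -> T = 0].

Lemma eq_set2 (i j k l : 'I_n) : ([set i; j] == [set k; l])%SET =
  ((i == k) && (j == l)) || ((i == l) && (j == k)).
Proof.
apply/eqP/orP => [h|[]/andP[/eqP-> /eqP->] //]; last exact: setUC.
have hi : i \in [set k; l]%SET by rewrite -h set21.
have hj : j \in [set k; l]%SET by rewrite -h set22.
have hk : k \in [set i; j]%SET by rewrite h set21.
have hl : l \in [set i; j]%SET by rewrite h set22.
rewrite !inE in hi hj hk hl.
case/orP: hi => /eqP Ei; case/orP: hj => /eqP Ej; subst i j;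
  rewrite ?eqxx; auto; move: hk hl.
- by rewrite !orbb => _ /eqP->; rewrite eqxx; left.

- by rewrite !orbb => /eqP-> _; rewrite eqxx; left.
Qed.

Lemma sym_fock_exists : exists d (Z D : 'I_n -> 'I_n -> 'M[K]_d) s Om e,
  sym_fock_axioms Z D s Om e.
Proof.
pose L := undup [seq [set p.1; p.2]%SET | p : 'I_n * 'I_n].
pose idx i j := index [set i; j]%SET L.
have mL i j : [set i; j]%SET \in L.
  by rewrite mem_undup; apply/mapP; exists (i, j); rewrite ?mem_enum.
have idx_lt i j : (idx i j < size L)%N by rewrite index_mem.
have idxC i j : idx i j = idx j i by rewrite /idx setUC.
have idx_eq i j k l : (idx i j == idx k l) = ([set i; j] == [set k; l])%SET.
  rewrite /idx; apply/eqP/eqP => [h|-> //].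
  by rewrite -(nth_index (finset.set0) (mL i j)) h nth_index.
have idx_surj u : (u < size L)%N -> exists i j, u = idx i j.
  move=> hu; have := mem_nth finset.set0 hu; rewrite mem_undup => /mapP[[i j] _ /= E].
  by exists i, j; rewrite /idx -E index_uniq ?undup_uniq.
have [d [z [D [s [Om [e [[zz Dz zD] [ss sz sD] [e0 es ez] DOm uniq]]]]]]] :=
  fock_exists K (size L).
(* Both terms of [sym_delta] are nonzero on a diagonal pair, hence the factor 2 for i = j. *)
exists d, (fun i j => z (idx i j)), (fun i j => (1 + (i == j)%:R) *: D (idx i j)).
exists s, Om, e; split.
- split=> [i j k l|i j k l|i j|i j|i j].
  + exact: zz.
  + rewrite -scalemxAl -scalemxAr -scalerDr Dz // idx_eq eq_set2 scale_scalar_mx.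
    congr _%:M; rewrite /sym_delta.
    have [->|nij] := eqVneq i j.
      rewrite [_ && _]andbC; case: (_ && _); rewrite /= ?mulr0 ?addr0 ?mulr1 //.
    rewrite addr0 mul1r.
    case: (eqVneq i k) nij => [->|_]; case: (eqVneq j l) => [->|_] nij //=.
    * by rewrite (negPf nij) addr0.
    * by rewrite [j == k]eq_sym (negPf nij) andbF addr0.
    * by rewrite add0r.
    * by rewrite add0r.
  + rewrite -scalemxAr; have /is_diag_mxP h := zD _ (idx_lt i j).
    by apply/is_diag_mxP => k l kl; rewrite mxE h ?mulr0.
  + by rewrite idxC.
  + by rewrite idxC eq_sym.
- split=> // i j; first exact: sz.
  by rewrite -scalemxAl -scalemxAr sD // scalerN.
- by split=> // i j; apply: ez.
- by move=> i j; rewrite -scalemxAl DOm // scaler0.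
move=> t T t0 hT; apply: (uniq t) => // u /idx_surj[i [j ->]]; exact: hT.
Qed.

End SymmetricFock.

(** * A finite-dimensional module on which x is acyclic *)

Section PeRepresentation.
Variables (K : numFieldType) (n d : nat).
Variables (Z D : 'I_n -> 'I_n -> 'M[K]_d) (s : 'M[K]_d).
Variables (Om : 'cV[K]_d) (e : 'rV[K]_d).
Hypothesis fock : sym_fock_axioms Z D s Om e.

(** As Z is symmetric, this depends only on the symmetric part of M, so products of matrices can be
    inserted without symmetrizing them. The 1/2 in [beta] compensates B + B^T = 2 B for symmetric
    B. *)
Definition Zsum (M : 'M[K]_n) : 'M[K]_d := \sum_i \sum_j M i j *: Z i j.

Fact Zsum_is_linear : linear Zsum.
Proof.
move=> a M N; rewrite /Zsum scaler_sumr -big_split; apply: eq_bigr => i _ /=.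
rewrite scaler_sumr -big_split; apply: eq_bigr => j _ /=.
by rewrite !mxE scalerDl scalerA.
Qed.
HB.instance Definition _ := GRing.isLinear.Build K 'M[K]_n 'M[K]_d *:%R Zsum
  Zsum_is_linear.

(* On the exterior algebra of g_1 the block B acts by beta B, the block A by
   alpha A = sum A_ki Z_kj D_ij, and the block C by
   gamma C = - 1/2 sum C_pi Z_kj D_kp D_ij. *)
Definition alpha (A : 'M[K]_n) : 'M[K]_d :=
  \sum_i \sum_j Zsum (A *m delta_mx i j) *m D i j.

Fact alpha_is_linear : linear alpha.
Proof.
move=> a M N; rewrite /alpha scaler_sumr -big_split; apply: eq_bigr => i _ /=.
rewrite scaler_sumr -big_split; apply: eq_bigr => j _ /=.
by rewrite mulmxDl -scalemxAl linearP mulmxDl -scalemxAl.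
Qed.
HB.instance Definition _ := GRing.isLinear.Build K 'M[K]_n 'M[K]_d *:%R alpha
  alpha_is_linear.

Definition gamma (C : 'M[K]_n) : 'M[K]_d :=
  2^-1 *: \sum_k \sum_p alpha (delta_mx k p *m C) *m D k p.

Fact gamma_is_linear : linear gamma.
Proof.
move=> a M N; rewrite /gamma scalerA mulrC -scalerA -scalerDr; congr (_ *: _).
rewrite scaler_sumr -big_split; apply: eq_bigr => i _ /=.
rewrite scaler_sumr -big_split; apply: eq_bigr => j _ /=.
by rewrite mulmxDr -scalemxAr linearP mulmxDl -scalemxAl.
Qed.
HB.instance Definition _ := GRing.isLinear.Build K 'M[K]_n 'M[K]_d *:%R gamma
  gamma_is_linear.

Definition beta (B : 'M[K]_n) : 'M[K]_d := 2^-1 *: Zsum B.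

Lemma Zsum_delta i j : Zsum (delta_mx i j) = Z i j.
Proof.
rewrite /Zsum (bigD1 i) //= (bigD1 j) //= mxE !eqxx scale1r.
rewrite big1 ?addr0 => [|k /negPf nk]; last by rewrite mxE nk andbF scale0r.
rewrite big1 ?addr0 // => k /negPf nk.
by apply: big1 => l _; rewrite mxE nk scale0r.
Qed.

Lemma Zsum_tr M : Zsum M^T = Zsum M.
Proof.
have [[_ _ _ Zs _] _ _ _ _] := fock.
rewrite /Zsum exchange_big; apply: eq_bigr => i _; apply: eq_bigr => j _.
by rewrite mxE Zs.
Qed.

Lemma Zsum_anti M N : Zsum M *m Zsum N = - (Zsum N *m Zsum M).
Proof.
have [[ZZ _ _ _ _] _ _ _ _] := fock.
have h i j : Z i j *m Zsum N = - (Zsum N *m Z i j).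
  apply/eqP; rewrite -addr_eq0; apply/eqP.
  rewrite mulmx_sumr mulmx_suml -big_split big1 //= => k _.
  rewrite mulmx_sumr mulmx_suml -big_split big1 //= => l _.
  by rewrite -scalemxAl -scalemxAr -scalerDr ZZ scaler0.
pose X := Zsum N; rewrite -/X in h *; move: X h => X h.
rewrite mulmx_suml mulmx_sumr -sumrN; apply: eq_bigr => i _.
rewrite mulmx_suml mulmx_sumr -sumrN; apply: eq_bigr => j _.
by rewrite -scalemxAl -scalemxAr h scalerN.
Qed.

Lemma D_Zsum i j B : D i j *m Zsum B + Zsum B *m D i j = ((B + B^T) i j)%:M.
Proof.
have [[_ DZ _ _ _] _ _ _ _] := fock.
rewrite mulmx_sumr mulmx_suml -big_split /=.
transitivity (\sum_k \sum_l (B k l * sym_delta K i j k l)%:M : 'M[K]_d).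
  apply: eq_bigr => k _; rewrite mulmx_sumr mulmx_suml -big_split /=.
  by apply: eq_bigr => l _;
    rewrite -scalemxAl -scalemxAr -scalerDr DZ scale_scalar_mx.
under eq_bigr do rewrite -raddf_sum.
rewrite -raddf_sum; congr _%:M; rewrite !mxE /sym_delta.
under eq_bigr do under eq_bigr do rewrite mulrDr.
under eq_bigr do rewrite big_split.
rewrite big_split /=; congr (_ + _).
  rewrite (bigD1 i) //= (bigD1 j) //= !eqxx mulr1.
  rewrite big1 ?addr0 => [|k /negPf nk]; last by rewrite eq_sym nk andbF mulr0.
  rewrite big1 ?addr0 // => k /negPf nk.
  by apply: big1 => l _; rewrite eq_sym nk mulr0.
rewrite (bigD1 j) //= (bigD1 i) //= !eqxx mulr1.
rewrite big1 ?addr0 => [|k /negPf nk].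
  rewrite big1 ?addr0 // => k /negPf nk.
  by apply: big1 => l _; rewrite [j == k]eq_sym nk andbF mulr0.
by rewrite [i == k]eq_sym nk mulr0.
Qed.

(** [alpha A] is a sum of terms Zsum * D. Moving Zsum B to the left through both factors costs two
    signs, which cancel, and the contraction of D with Zsum B remains. *)
Lemma alphaZ A B :
  alpha A *m Zsum B = Zsum B *m alpha A + Zsum (A *m (B + B^T)).
Proof.
apply/eqP; rewrite -subr_eq0 opprD addrA subr_eq0; apply/eqP.
transitivity (\sum_i \sum_j Zsum (A *m ((B + B^T) i j *: delta_mx i j))).
  have hZ M := Zsum_anti M B; have hD i j := D_Zsum i j B.
  move: (Zsum B) hZ hD => X hZ hD.
  rewrite mulmx_suml mulmx_sumr -sumrB; apply: eq_bigr => i _.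
  rewrite mulmx_suml mulmx_sumr -sumrB; apply: eq_bigr => j _.
  rewrite [X *m _]mulmxA -[X *m _]opprK -hZ mulNmx opprK -!mulmxA -mulmxDr hD.
  by rewrite mul_mx_scalar -scalemxAr linearZ.
rewrite {2}[B + B^T]matrix_sum_delta mulmx_sumr linear_sum.
by apply: eq_bigr => i _; rewrite mulmx_sumr linear_sum.
Qed.

(** When Zsum B meets the derivative inside [alpha], the outer D_kp of [gamma] survives; the
    symmetry of Z and D turns the resulting sum back into an [alpha]. *)
Lemma alpha_tr M : \sum_k \sum_p Zsum (delta_mx k p *m M) *m D k p = alpha M^T.
Proof.
have [[_ _ _ _ Ds] _ _ _ _] := fock.
rewrite exchange_big /alpha; apply: eq_bigr => p _; apply: eq_bigr => k _.
by rewrite Ds -Zsum_tr trmx_mul trmx_delta.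
Qed.

(** With S = B + B^T, the two contractions contribute alpha (S C) and - alpha ((C S)^T). These agree
    because C is antisymmetric and S symmetric, which absorbs the 1/2 in [gamma]. *)
Lemma gammaZ C B : C^T = - C ->
  gamma C *m Zsum B = - (Zsum B *m gamma C) + alpha ((B + B^T) *m C).
Proof.
move=> aC; pose S := B + B^T.
have St : S^T = S by rewrite /S linearD /= trmxK addrC.
apply/eqP; rewrite -subr_eq0 opprD addrA opprK subr_eq0; apply/eqP.
transitivity (2^-1 *: (alpha (S *m C) - alpha (C *m S)^T)); last first.
  rewrite trmx_mul St aC mulmxN linearN opprK -mulr2n -scaler_nat scalerA.
  by rewrite mulVf ?scale1r ?pnatr_eq0.
have hS : alpha (S *m C) = \sum_k \sum_p S k p *: alpha (delta_mx k p *m C).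
  rewrite {1}[S]matrix_sum_delta mulmx_suml linear_sum; apply: eq_bigr => k _.
  rewrite mulmx_suml linear_sum; apply: eq_bigr => p _.
  by rewrite -scalemxAl linearZ.
rewrite -alpha_tr hS -sumrB /gamma.
have hA M := alphaZ M B; have hD i j := D_Zsum i j B.
rewrite -/S in hA hD; clearbody S; move: (Zsum B) hA hD => X hA hD.
rewrite -scalemxAl -scalemxAr -scalerDr; congr (_ *: _).
rewrite mulmx_suml mulmx_sumr -big_split; apply: eq_bigr => k _ /=.
rewrite mulmx_suml mulmx_sumr -big_split -sumrB.
apply: eq_bigr => p _ /=.
by rewrite -mul_mx_scalar -hD mulmxDr !mulmxA hA mulmxDl addrA addrK.
Qed.

Lemma alphaOm A : alpha A *m Om = 0.
Proof.
have [_ _ _ DOm _] := fock.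
rewrite mulmx_suml big1 // => i _; rewrite mulmx_suml big1 // => j _.
by rewrite -mulmxA DOm mulmx0.
Qed.

Lemma gammaOm C : gamma C *m Om = 0.
Proof.
have [_ _ _ DOm _] := fock.
rewrite -scalemxAl mulmx_suml big1 ?scaler0 // => i _; rewrite mulmx_suml big1 // => j _.
by rewrite -mulmxA DOm mulmx0.
Qed.

Lemma s_Zsum M : s *m Zsum M = - (Zsum M *m s).
Proof.
have [_ [_ sZ _] _ _ _] := fock.
rewrite mulmx_sumr mulmx_suml -sumrN; apply: eq_bigr => i _.
rewrite mulmx_sumr mulmx_suml -sumrN; apply: eq_bigr => j _.
by rewrite -scalemxAl -scalemxAr sZ scalerN.
Qed.

Lemma s_alpha A : s *m alpha A = alpha A *m s.
Proof.
have [_ [_ _ sD] _ _ _] := fock.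
rewrite mulmx_sumr mulmx_suml; apply: eq_bigr => i _.
rewrite mulmx_sumr mulmx_suml; apply: eq_bigr => j _.
by rewrite mulmxA s_Zsum mulNmx -!mulmxA sD mulmxN opprK.
Qed.

Lemma s_gamma C : s *m gamma C = - (gamma C *m s).
Proof.
have [_ [_ _ sD] _ _ _] := fock.
rewrite -scalemxAr -scalemxAl -scalerN; congr (_ *: _).
rewrite mulmx_sumr mulmx_suml -sumrN; apply: eq_bigr => i _.
rewrite mulmx_sumr mulmx_suml -sumrN; apply: eq_bigr => j _.
by rewrite mulmxA s_alpha -!mulmxA sD mulmxN.
Qed.

Lemma e_Zsum M : e *m Zsum M = 0.
Proof.
have [_ _ [_ _ eZ] _ _] := fock.
rewrite mulmx_sumr big1 // => i _; rewrite mulmx_sumr big1 // => j _.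
by rewrite -scalemxAr eZ scaler0.
Qed.

Lemma e_alpha A : e *m alpha A = 0.
Proof.
rewrite mulmx_sumr big1 // => i _; rewrite mulmx_sumr big1 // => j _.
by rewrite mulmxA e_Zsum mul0mx.
Qed.

Lemma e_gamma C : e *m gamma C = 0.
Proof.
rewrite -scalemxAr mulmx_sumr big1 ?scaler0 // => i _; rewrite mulmx_sumr big1 // => j _.
by rewrite mulmxA e_alpha mul0mx.
Qed.

Lemma alpha_diag (A : 'M[K]_n) : (forall i j, i != j -> A i j = 0) ->
  alpha A = \sum_i \sum_j A i i *: (Z i j *m D i j).
Proof.
move=> dA; apply: eq_bigr => i _; apply: eq_bigr => j _.
have -> : A *m delta_mx i j = A i i *: delta_mx i j.
  apply/matrixP=> k l; rewrite !mxE (bigD1 i) //= !mxE eqxx /= big1 ?addr0.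
    by case: (eqVneq k i) => [->|/dA->]; rewrite ?mulr0 ?mul0r.
  by move=> p /negPf np; rewrite !mxE np mulr0.
by rewrite linearZ /= Zsum_delta -scalemxAl.
Qed.

Lemma ZsumD M N : Zsum (M + N) = Zsum M + Zsum N. Proof. exact: linearD. Qed.
Lemma ZsumN M : Zsum (- M) = - Zsum M. Proof. exact: linearN. Qed.
Lemma alphaD A B : alpha (A + B) = alpha A + alpha B. Proof. exact: linearD. Qed.
Lemma alphaN A : alpha (- A) = - alpha A. Proof. exact: linearN. Qed.
Lemma gammaD C C' : gamma (C + C') = gamma C + gamma C'. Proof. exact: linearD. Qed.
Lemma gammaN C : gamma (- C) = - gamma C. Proof. exact: linearN. Qed.

Opaque Zsum alpha gamma.

(* An operator is determined by its commutators with the Z i j and its value at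
   the vacuum; this reduces the brackets of alpha and gamma to alphaZ and gammaZ. *)
Lemma commute_eq0 (t : K) T : t != 0 ->
  (forall B, T *m Zsum B = t *: (Zsum B *m T)) -> T *m Om = 0 -> T = 0.
Proof.
have [_ _ _ _ uniq] := fock.
by move=> t0 hT; apply: uniq t0 _ => i j; rewrite -Zsum_delta.
Qed.

Lemma tr_symm (B : 'M[K]_n) : (B + B^T)^T = B + B^T.
Proof. by rewrite linearD /= trmxK addrC. Qed.

Lemma alpha_comm A A' :
  alpha A *m alpha A' - alpha A' *m alpha A = alpha (A *m A' - A' *m A).
Proof.
apply/eqP; rewrite -subr_eq0; apply/eqP; apply: (@commute_eq0 1).
- exact: oner_neq0.
- move=> B; rewrite scale1r; have hA M := alphaZ M B.
  have hA' M N := alphaZ M (N *m (B + B^T)).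
  have St := tr_symm B; move: (B + B^T) hA hA' St => S hA hA' St.
  have eM M N : alpha M *m alpha N *m Zsum B = Zsum B *m (alpha M *m alpha N)
      + Zsum (M *m S) *m alpha N + Zsum (N *m S) *m alpha M
      + Zsum (M *m (N *m S + S *m N^T)).
    rewrite -mulmxA hA mulmxDr mulmxA hA mulmxDl -mulmxA hA' trmx_mul St.
    by rewrite !addrA.
  rewrite !mulmxBl !eM !mulmxBr hA !mulmxBl !mulmxDr (alphaD, alphaN) !ZsumD.
  (* The term A S A'^T of one product is the transpose of the term A' S A^T of the other, so [Zsum]
     identifies them and they cancel. *)
  rewrite -(Zsum_tr (A *m (S *m A'^T))) !trmx_mul trmxK St !mulmxA.
  rewrite ZsumN.
  lmod K.
- by rewrite !mulmxBl -!mulmxA !alphaOm !mulmx0 !subr0.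
Qed.

Lemma alpha_gamma A C : C^T = - C ->
  alpha A *m gamma C - gamma C *m alpha A = - gamma (A^T *m C + C *m A).
Proof.
move=> aC; apply/eqP; rewrite -subr_eq0 opprK; apply/eqP.
(* The operator in question is odd, so what has to be shown is that it anticommutes with the
   creation operators. *)
apply: (@commute_eq0 (-1)).
- by rewrite oppr_eq0 oner_neq0.
- move=> B; rewrite scaleN1r; have hA M := alphaZ M B.
  have aC' : (A^T *m C + C *m A)^T = - (A^T *m C + C *m A).
    by rewrite linearD /= !trmx_mul trmxK aC mulmxN mulNmx opprD addrC.
  have hC := gammaZ B aC; have hC' := gammaZ B aC'.
  have hCA := gammaZ (A *m (B + B^T)) aC.
  have St := tr_symm B; move: (B + B^T) hA hC hC' hCA St => S hA hC hC' hCA St.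
  have := alpha_comm A (S *m C); rewrite alphaD alphaN mulmxA => /eqP.
  rewrite subr_eq addrC => /eqP E.
  rewrite !mulmxDl mulNmx hC' -[alpha A *m _ *m _]mulmxA -[gamma C *m _ *m _]mulmxA hC hA.
  rewrite !mulmxDr !mulmxN !mulmxA hA hC hCA E !mulmxDl mulNmx.
  rewrite trmx_mul St !(alphaD, alphaN).
  lmod K.
- by rewrite mulmxDl mulmxBl -!mulmxA !gammaOm alphaOm !mulmx0 subr0 addr0.
Qed.

Lemma gamma_comm C C' : C^T = - C -> C'^T = - C' ->
  gamma C *m gamma C' + gamma C' *m gamma C = 0.
Proof.
move=> aC aC'; apply: (@commute_eq0 1).
- exact: oner_neq0.
- move=> B; rewrite scale1r.
  have hC := gammaZ B aC; have hC' := gammaZ B aC'.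
  have St := tr_symm B; move: (B + B^T) hC hC' St => S hC hC' St.
  have E M N : N^T = - N -> M^T = - M -> gamma N *m alpha (S *m M)
     = alpha (S *m M) *m gamma N + gamma (N *m S *m M - M *m S *m N).
    move=> aN aM; have /eqP := alpha_gamma (S *m M) aN.
    rewrite trmx_mul St aM mulNmx !mulmxA addrC -eqr_opp opprD !opprK mulNmx.
    rewrite subr_eq => /eqP->; rewrite addrC.
    by congr (_ + gamma _); rewrite addrC.
  rewrite !mulmxDl -![_ *m gamma _ *m _]mulmxA hC hC' !mulmxDr !mulmxN !mulmxA.
  rewrite hC hC' !E // !mulmxDl !mulNmx !(gammaD, gammaN).
  lmod K.
- by rewrite mulmxDl -!mulmxA !gammaOm !mulmx0 addr0.
Qed.

Definition rho (x : 'M[K]_(n + n)) : 'M[K]_d :=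
  alpha (ulsubmx x) + (beta (ursubmx x) + gamma (dlsubmx x)).

Lemma rho_lin a x y : rho (a *: x + y) = a *: rho x + rho y.
Proof.
have [e1 e2 e3 e4] := submx_lin a x y.
by rewrite /rho /beta e1 e2 e3 !linearP /=; lmod K.
Qed.

Lemma betaN B : beta (- B) = - beta B.
Proof. by rewrite /beta linearN scalerN. Qed.

Lemma beta_comm B B' : beta B *m beta B' + beta B' *m beta B = 0.
Proof.
by rewrite -!scalemxAl -!scalemxAr (Zsum_anti B) !scalerN addNr.
Qed.

Lemma half_symm (B : 'M[K]_n) : B^T = B -> 2^-1 *: (B + B^T) = B.
Proof. by move=> ->; rewrite -mulr2n -scaler_nat scalerA mulVf ?scale1r ?pnatr_eq0. Qed.

Lemma alpha_beta A B : B^T = B ->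
  alpha A *m beta B - beta B *m alpha A = beta (A *m B + B *m A^T).
Proof.
move=> sB; rewrite -scalemxAr -scalemxAl alphaZ scalerDr addrAC subrr add0r.
rewrite -linearZ scalemxAr half_symm // /beta linearD /= -(Zsum_tr (B *m _)).
by rewrite trmx_mul trmxK sB -mulr2n -scaler_nat scalerA mulVf ?scale1r ?pnatr_eq0.
Qed.

Lemma gamma_beta C B : C^T = - C -> B^T = B ->
  gamma C *m beta B + beta B *m gamma C = alpha (B *m C).
Proof.
move=> aC sB; rewrite /beta -(scalemxAr _ _ (Zsum B)) -(scalemxAl _ (Zsum B)) gammaZ //.
rewrite scalerDr addrAC scalerN addNr.
by rewrite add0r -linearZ scalemxAl half_symm.
Qed.

Lemma homog_evenE (x : 'M[K]_(n + n)) :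
  homog false x -> x = block_mx (ulsubmx x) 0 0 (drsubmx x).
Proof. by []. Qed.

Lemma homog_oddE (x : 'M[K]_(n + n)) :
  homog true x -> x = block_mx 0 (ursubmx x) (dlsubmx x) 0.
Proof. by []. Qed.

Lemma s_beta B : s *m beta B = - (beta B *m s).
Proof. by rewrite /beta -scalemxAr -scalemxAl s_Zsum scalerN. Qed.

Lemma rho_s b x : homog b x -> s *m rho x = (-1) ^+ b *: (rho x *m s).
Proof.
case: b => [/homog_oddE|/homog_evenE] ->; rewrite /rho.
  rewrite block_mxKul block_mxKur block_mxKdl linear0 add0r expr1 scaleN1r.
  by rewrite mulmxDr mulmxDl s_gamma s_beta -opprD.
rewrite block_mxKul block_mxKur block_mxKdl linear0 addr0 /beta linear0 scaler0.
by rewrite addr0 expr0 scale1r s_alpha.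
Qed.

Lemma rho_scomm b c x y : pe n x -> pe n y -> homog b x -> homog c y ->
  rho (scomm x y) = rho x *m rho y - (-1) ^+ (b && c) *: (rho y *m rho x).
Proof.
move=> px py.
have beta0 : beta 0 = 0 by rewrite /beta linear0 scaler0.
case: b; case: c; rewrite ?expr0 ?expr1 ?scale1r ?scaleN1r ?opprK.
- move=> /homog_oddE ex /homog_oddE ey; rewrite {}ex {}ey in px py *.
  move: px py; set B := ursubmx x; set C := dlsubmx x.
  set B' := ursubmx y; set C' := dlsubmx y.
  case=> _; rewrite block_mxKur block_mxKdl => sB aC.
  case=> _; rewrite block_mxKur block_mxKdl => sB' aC'.
  rewrite scomm_block /rho !block_mxKul !block_mxKur !block_mxKdl !linear0 !add0r.
  rewrite !(mul0mx, mulmx0, subr0, add0r, addr0, linear0, beta0) opprK.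
  rewrite linearD /= -(gamma_beta aC' sB) -(gamma_beta aC sB') !mulmxDl !mulmxDr.
  have /eqP := beta_comm B B'; rewrite addr_eq0 => /eqP ->.
  have /eqP := gamma_comm aC aC'; rewrite addr_eq0 => /eqP ->.
  lmod K.
- move=> /homog_oddE ex /homog_evenE ey; rewrite {}ex {}ey in px py *.
  move: px py; set B := ursubmx x; set C := dlsubmx x; set A := ulsubmx y.
  case=> _; rewrite block_mxKur block_mxKdl => sB aC.
  case; rewrite block_mxKul block_mxKdr => -> _ _.
  rewrite scomm_block /rho !block_mxKul !block_mxKur !block_mxKdl !linear0 !add0r.
  rewrite !(mul0mx, mulmx0, subr0, add0r, addr0, linear0, beta0).
  rewrite mulmxN mulNmx opprK mulmxDl mulmxDr.
  rewrite [C *m A + _]addrC -[gamma (_ + _)]opprK -alpha_gamma //.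
  rewrite -opprD [B *m _ + _]addrC betaN -alpha_beta //.
  lmod K.
- move=> /homog_evenE ex /homog_oddE ey; rewrite {}ex {}ey in px py *.
  move: px py; set B := ursubmx y; set C := dlsubmx y; set A := ulsubmx x.
  case; rewrite block_mxKul block_mxKdr => -> _ _.
  case=> _; rewrite block_mxKur block_mxKdl => sB aC.
  rewrite scomm_block /rho !block_mxKul !block_mxKur !block_mxKdl !linear0 !add0r.
  rewrite !(mul0mx, mulmx0, subr0, add0r, addr0, linear0, beta0).
  rewrite mulmxN mulNmx opprK mulmxDl mulmxDr.
  rewrite -opprD linearN -alpha_gamma // -alpha_beta //.
  lmod K.
- move=> /homog_evenE ex /homog_evenE ey; rewrite {}ex {}ey in px py *.
  rewrite scomm_block /rho !block_mxKul !block_mxKur !block_mxKdl.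
  rewrite !(mul0mx, mulmx0, subr0, add0r, addr0, linear0, beta0).
  by rewrite alpha_comm.
Qed.

Lemma e_rho x : e *m rho x = 0.
Proof.
by rewrite !mulmxDr e_alpha e_gamma /beta -scalemxAr e_Zsum scaler0 !addr0.
Qed.

(** A diagonal A acts through the operators Z_ij D_ij, which are diagonal in the chosen basis. This
    makes P (x) E semisimple over h. *)
Lemma rho_cartan : exists mu : 'I_d -> 'rV[K]_n, forall y, cartan y ->
  rho y = diag_mx (\row_k wt (mu k) y).
Proof.
have [[_ _ ZD _ _] _ _ _ _] := fock.
exists (fun k => \row_i \sum_j (Z i j *m D i j) k k) => y [_ /is_diag_mxP dy].
have -> : rho y = alpha (ulsubmx y).
  rewrite /rho; have -> : ursubmx y = 0.
    by apply/matrixP=> i j; rewrite !mxE dy //=; have := ltn_ord i; lia.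
  have -> : dlsubmx y = 0.
    by apply/matrixP=> i j; rewrite !mxE dy //=; have := ltn_ord j; lia.
  by rewrite /beta !linear0 ?scaler0 !addr0.
set A := ulsubmx y.
have dA i j : i != j -> A i j = 0.
  by move=> ij; rewrite !mxE dy.
rewrite /wt -/A; move: A dA => A dA.
rewrite (alpha_diag dA).
apply/matrixP=> k l; rewrite summxE mxE.
have [->|kl] := eqVneq k l.
  rewrite mulr1n mxE; apply: eq_bigr => i _; rewrite summxE mxE mulr_suml.
  by apply: eq_bigr => j _; rewrite mxE mulrC.
rewrite mulr0n big1 // => i _; rewrite summxE big1 // => j _.
by have /is_diag_mxP h := ZD i j; rewrite mxE h ?mulr0.
Qed.

(** x acts as Z_ii / 2, and the anticommutator of Z_ii with D_ii is 2. *)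
Lemma rho_homotopy i :
  let x := block_mx 0 (delta_mx i i) 0 0 in
  rho x *m D i i + D i i *m rho x = 1%:M /\ s *m D i i = - (D i i *m s).
Proof.
have [_ [_ _ sD] _ _ _] := fock.
rewrite /rho /= block_mxKul block_mxKur block_mxKdl !linear0 addr0 add0r.
split=> //; rewrite -scalemxAl -scalemxAr -scalerDr addrC D_Zsum !mxE !eqxx.
by rewrite scale_scalar_mx -mulr2n mulVf ?pnatr_eq0.
Qed.

End PeRepresentation.

Transparent Zsum alpha gamma.

Section AcyclicRepresentation.
Variables (K : numFieldType) (n d : nat) (x : 'M[K]_(n + n)).

(** The module E in coordinates, with action r, parity s, an even map e onto the trivial module and
    an odd contracting homotopy h for x. The sections on tensor products rely on these properties
    alone. *)
Definition acyclic_rep (r : 'M[K]_(n + n) -> 'M[K]_d) (s h : 'M[K]_d)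
    (e : 'rV[K]_d) : Prop :=
  [/\ [/\ forall a y z, r (a *: y + z) = a *: r y + r z,
          forall b c y z, pe n y -> pe n z -> homog b y -> homog c z ->
            r (scomm y z) = r y *m r z - (-1) ^+ (b && c) *: (r z *m r y)
        & exists mu : 'I_d -> 'rV[K]_n, forall y, cartan y ->
            r y = diag_mx (\row_k wt (mu k) y)],
      s *m s = 1%:M /\ (forall b y, homog b y -> s *m r y = (-1) ^+ b *: (r y *m s)),
      [/\ e != 0, e *m s = e & forall y, e *m r y = 0]
    & r x *m h + h *m r x = 1%:M /\ s *m h = - (h *m s)].

End AcyclicRepresentation.

Lemma acyclic_rep_exists (K : numFieldType) n (i : 'I_n) :
  exists d (r : 'M[K]_(n + n) -> 'M[K]_d) s h e,
    acyclic_rep (block_mx 0 (delta_mx i i) 0 0) r s h e.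
Proof.
have [d [Z [D [s [Om [e fock]]]]]] := sym_fock_exists K n.
exists d, (rho Z D), s, (D i i), e; split.
- split; [exact: rho_lin | exact: rho_scomm fock | exact: rho_cartan fock].
- by split; [have [_ []] := fock | exact: rho_s fock].
- by split; [have [_ _ []] := fock | have [_ _ []] := fock | exact: e_rho fock].
- exact: rho_homotopy fock i.
Qed.

(** * Tensor products *)

Section GradedAlgebra.
Variables (K : numFieldType) (n : nat).
Local Notation gl := 'M[K]_(n + n).
Implicit Types x y : gl.

Lemma mx_even_lin a x y : mx_even (a *: x + y) = a *: mx_even x + mx_even y.
Proof.
have [e1 _ _ e4] := submx_lin a x y.
by rewrite /mx_even e1 e4 scale_block_mx add_block_mx !scaler0 !addr0.
Qed.

Lemma mx_odd_lin a x y : mx_odd (a *: x + y) = a *: mx_odd x + mx_odd y.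
Proof.
have [_ e2 e3 _] := submx_lin a x y.
by rewrite /mx_odd e2 e3 scale_block_mx add_block_mx !scaler0 !addr0.
Qed.

Lemma mx_even_homog b x : homog b x -> mx_even x = if b then 0 else x.
Proof.
case: b => [->|<-//]; rewrite /mx_even /mx_odd block_mxKul block_mxKdr.
exact: block_mx0.
Qed.

Lemma mx_odd_homog b x : homog b x -> mx_odd x = if b then x else 0.
Proof.
case: b => [<-//|->]; rewrite /mx_even /mx_odd block_mxKur block_mxKdl.
exact: block_mx0.
Qed.

Lemma scommE b c x y : homog b x -> homog c y ->
  scomm x y = x *m y - (-1) ^+ (b && c) *: (y *m x).
Proof.
move=> hx hy; rewrite /scomm !(mx_even_homog hx, mx_odd_homog hx).
rewrite !(mx_even_homog hy, mx_odd_homog hy).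
by case: b {hx}; case: c {hy}; rewrite !(mulmx0, mul0mx) ?add0r ?addr0 ?subr0
  ?sub0r ?expr0 ?expr1 ?scale1r ?scaleN1r ?oppr0 ?addr0.
Qed.

Lemma mx_theta0 : mx_theta 0 = 0 :> gl.
Proof. by have := mx_theta_lin (-1) 0 (0 : gl); rewrite scaler0 addr0 scaleN1r addNr. Qed.

Lemma mx_thetaZ a x : mx_theta (a *: x) = a *: mx_theta x.
Proof. by rewrite -[a *: x]addr0 mx_theta_lin mx_theta0 addr0. Qed.

Lemma homogP (p : bool) x : mx_theta x = (-1) ^+ p *: x -> homog p x.
Proof.
move=> ex; rewrite /homog; have : mx_theta x = mx_even x - mx_odd x by [].
rewrite ex -{1}[x]mx_evenD; case: p {ex}.
  rewrite expr1 scaleN1r opprD => /addIr /eqP; rewrite -subr_eq0 -opprD oppr_eq0.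
  rewrite -mulr2n -scaler_nat scaler_eq0 pnatr_eq0 /= => /eqP e0.
  by rewrite -{1}[x]mx_evenD e0 add0r.
rewrite expr0 scale1r => /addrI /eqP; rewrite -subr_eq0 opprK.
rewrite -mulr2n -scaler_nat scaler_eq0 pnatr_eq0 /= => /eqP e0.
by rewrite -{1}[x]mx_evenD e0 addr0.
Qed.

Lemma homog_scomm b c x y : homog b x -> homog c y -> homog (b (+) c) (scomm x y).
Proof.
move=> hx hy; apply: homogP; rewrite (scommE hx hy) mx_thetaD mx_thetaN mx_thetaZ.
rewrite !mx_thetaM (homog_theta hx) (homog_theta hy) -!scalemxAl -!scalemxAr.
rewrite !scalerA !scalerBr !scalerA signr_addb; congr (_ - _ *: _).
by rewrite -mulrA mulrC [X in X * _ = _]mulrC.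
Qed.

Lemma homog_scale b a x : homog b x -> homog b (a *: x).
Proof. by move=> hx; apply: homogP; rewrite mx_thetaZ (homog_theta hx) !scalerA mulrC. Qed.

Lemma homog_add b x y : homog b x -> homog b y -> homog b (x + y).
Proof.
by move=> hx hy; apply: homogP; rewrite mx_thetaD (homog_theta hx) (homog_theta hy) scalerDr.
Qed.

Lemma homog0 b : homog b (0 : gl).
Proof. by apply: homogP; rewrite mx_theta0 scaler0. Qed.

Lemma pe_scale a x : pe n x -> pe n (a *: x).
Proof. by move=> px; rewrite -[a *: x]addr0; apply: pe_lin (@pe0 _ _). Qed.

Lemma pe_add x y : pe n x -> pe n y -> pe n (x + y).
Proof. by move=> px py; rewrite -[x]scale1r; apply: pe_lin. Qed.

Lemma pe_opp x : pe n x -> pe n (- x).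
Proof. by move=> px; rewrite -scaleN1r; apply: pe_scale. Qed.

End GradedAlgebra.

(** * Elementary rules for actions, parities and generated submodules *)

Section SmodTheory.
Variables (K : numFieldType) (n : nat) (t : set 'M[K]_(n + n)) (M : smod t).
Local Notation gl := 'M[K]_(n + n).
Implicit Types (x y : gl) (u v : M) (a : K).

Lemma act0r x : t x -> act x (0 : M) = 0.
Proof.
by move=> tx; have := act_linr (-1) (0 : M) 0 tx; rewrite scaler0 addr0 scaleN1r addNr.
Qed.

Lemma actZr x a u : t x -> act x (a *: u) = a *: act x u.
Proof. by move=> tx; rewrite -[a *: u]addr0 act_linr // act0r // addr0. Qed.

Lemma actDr x u v : t x -> act x (u + v) = act x u + act x v.
Proof. by move=> tx; rewrite -[u]scale1r act_linr // !scale1r. Qed.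

Lemma actNr x u : t x -> act x (- u) = - act x u.
Proof. by move=> tx; rewrite -scaleN1r actZr // scaleN1r. Qed.

Lemma actBr x u v : t x -> act x (u - v) = act x u - act x v.
Proof. by move=> tx; rewrite actDr // actNr. Qed.

Lemma act_sumr x (I : Type) (r : seq I) (Q : pred I) (F : I -> M) : t x ->
  act x (\sum_(i <- r | Q i) F i) = \sum_(i <- r | Q i) act x (F i).
Proof.
move=> tx; elim/big_rec2: _ => [|i u v _ <-]; [exact: act0r | exact: actDr].
Qed.

Lemma act0l u : t 0 -> act 0 u = 0.
Proof.
by move=> t0; have := act_linl (-1) u t0 t0; rewrite scaler0 addr0 scaleN1r addNr.
Qed.

Lemma actZl x a u : t 0 -> t x -> act (a *: x) u = a *: act x u.
Proof. by move=> t0 tx; rewrite -[a *: x]addr0 act_linl // act0l // addr0. Qed.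

Lemma actDl x y u : t x -> t y -> act (x + y) u = act x u + act y u.
Proof. by move=> tx ty; rewrite -[x]scale1r act_linl // !scale1r. Qed.

Lemma sgnZ a u : sgn (a *: u) = a *: sgn u.
Proof. by rewrite -[a *: u]addr0 sgn_lin sgn0 addr0. Qed.

Lemma sgnD u v : sgn (u + v) = sgn u + sgn v.
Proof. by rewrite -[u]scale1r sgn_lin !scale1r. Qed.

Lemma sgn_sum (I : Type) (r : seq I) (Q : pred I) (F : I -> M) :
  sgn (\sum_(i <- r | Q i) F i) = \sum_(i <- r | Q i) sgn (F i).
Proof. by elim/big_rec2: _ => [|i u v _ <-]; rewrite ?sgn0 ?sgnD. Qed.

Lemma act_even_odd x u : t (mx_even x) -> t (mx_odd x) ->
  act x u = act (mx_even x) u + act (mx_odd x) u.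
Proof. by move=> te to; rewrite -{1}[x]mx_evenD actDl. Qed.

Lemma sgn_act_theta x u : t (mx_even x) -> t (mx_odd x) ->
  sgn (act x u) = act (mx_theta x) (sgn u).
Proof.
move=> te to; rewrite act_even_odd // sgnD (sgn_act _ te (homog_even x)).
rewrite (sgn_act _ to (homog_odd x)) expr0 expr1 scale1r.
by rewrite /mx_theta addrC [in RHS]addrC -[- mx_odd x]scaleN1r act_linl.
Qed.

Lemma Uspan_sub (u : set gl) (G : set M) : G `<=` Uspan u G.
Proof. exact: sub_smallest. Qed.

Lemma Uspan_min (u : set gl) (G S : set M) :
  subspace S -> stable u S -> G `<=` S -> Uspan u G `<=` S.
Proof. by move=> hS sS GS; apply: smallest_sub. Qed.

Lemma Uspan_subspace (u : set gl) (G : set M) : subspace (Uspan u G).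
Proof.
split=> [S [[[S0 _] _] _] //|a x y hx hy S hS].
by apply: (hS.1.1.2); [apply: hx | apply: hy].
Qed.

Lemma Uspan_stable (u : set gl) (G : set M) : stable u (Uspan u G).
Proof. by move=> x v ux hv S hS; apply: hS.1.2 => //; apply: hv. Qed.

End SmodTheory.

Lemma findim_sub (K : numFieldType) n (t : set 'M[K]_(n + n)) (M : smod t)
    (S S' : set M) :
  S `<=` S' -> findim S' -> findim S.
Proof. by move=> sub [k [b hb]]; exists k, b => v /sub /hb. Qed.

Section TensorRepresentation.
Variables (K : numFieldType) (n d : nat) (x0 : 'M[K]_(n + n)).
Variables (r : 'M[K]_(n + n) -> 'M[K]_d) (s h : 'M[K]_d) (e : 'rV[K]_d).
Hypothesis rep : acyclic_rep x0 r s h e.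
Variable P : smod (@pe K n).
Local Notation gl := 'M[K]_(n + n).
Local Notation Q := {ffun 'I_d -> P}.
Implicit Types (x y : gl) (m : 'M[K]_d) (f g : Q) (a : K).

Definition mxop m f : Q := [ffun k => \sum_l m k l *: f l].
Definition actop x f : Q := [ffun k => act x (f k)].
Definition sgnop f : Q := [ffun k => sgn (f k)].

(** P (x) E in the coordinates given by the basis of E. In x (v (x) u) = x v (x) u + (-1)^(|x||v|) v
    (x) x u, the Koszul sign becomes [sgnop] next to the odd part of x. *)
Definition tact x f : Q :=
  actop x f + mxop (r (mx_even x)) f + mxop (r (mx_odd x)) (sgnop f).
Definition tsgn f : Q := mxop s (sgnop f).

Lemma mxopM m m' f : mxop m (mxop m' f) = mxop (m *m m') f.
Proof.
apply/ffunP=> k; rewrite !ffunE.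
under eq_bigr => l _ do rewrite ffunE scaler_sumr.
rewrite exchange_big; apply: eq_bigr => l _ /=; rewrite mxE scaler_suml.
by apply: eq_bigr => j _; rewrite scalerA.
Qed.

Lemma mxop1 f : mxop 1%:M f = f.
Proof.
apply/ffunP=> k; rewrite ffunE (bigD1 k) //= mxE eqxx scale1r big1 ?addr0 // => l.
by rewrite mxE eq_sym => /negPf->; rewrite scale0r.
Qed.

Lemma mxop_linl a m m' f : mxop (a *: m + m') f = a *: mxop m f + mxop m' f.
Proof.
apply/ffunP=> k; rewrite !ffunE scaler_sumr -big_split; apply: eq_bigr => l _ /=.
by rewrite !mxE scalerDl scalerA.
Qed.

Lemma mxop_linr a m f g : mxop m (a *: f + g) = a *: mxop m f + mxop m g.
Proof.
apply/ffunP=> k; rewrite !ffunE scaler_sumr -big_split; apply: eq_bigr => l _ /=.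
by rewrite !ffunE scalerDr !scalerA mulrC.
Qed.

Lemma mxop0l f : mxop 0 f = 0.
Proof. by apply/ffunP=> k; rewrite !ffunE big1 // => l _; rewrite mxE scale0r. Qed.

Lemma mxop0r m : mxop m 0 = 0.
Proof. by apply/ffunP=> k; rewrite !ffunE big1 // => l _; rewrite ffunE scaler0. Qed.

Lemma mxopZr m a f : mxop m (a *: f) = a *: mxop m f.
Proof. by rewrite -[a *: f]addr0 mxop_linr mxop0r addr0. Qed.

Lemma mxopDr m f g : mxop m (f + g) = mxop m f + mxop m g.
Proof. by rewrite -[f]scale1r mxop_linr !scale1r. Qed.

Lemma mxopZl m a f : mxop (a *: m) f = a *: mxop m f.
Proof. by rewrite -[a *: m]addr0 mxop_linl mxop0l addr0. Qed.

Lemma mxopDl m m' f : mxop (m + m') f = mxop m f + mxop m' f.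
Proof. by rewrite -[m]scale1r mxop_linl !scale1r. Qed.

Lemma mxopNl m f : mxop (- m) f = - mxop m f.
Proof. by rewrite -scaleN1r mxopZl scaleN1r. Qed.

Lemma actop_linr a x f g : pe n x -> actop x (a *: f + g) = a *: actop x f + actop x g.
Proof. by move=> px; apply/ffunP=> k; rewrite !ffunE act_linr. Qed.

Lemma actopDr x f g : pe n x -> actop x (f + g) = actop x f + actop x g.
Proof. by move=> px; apply/ffunP=> k; rewrite !ffunE actDr. Qed.

Lemma actop_mxop x m f : pe n x -> actop x (mxop m f) = mxop m (actop x f).
Proof.
move=> px; apply/ffunP=> k; rewrite !ffunE act_sumr //; apply: eq_bigr => l _.
by rewrite !ffunE actZr.
Qed.

Lemma sgnop_lin a f g : sgnop (a *: f + g) = a *: sgnop f + sgnop g.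
Proof. by apply/ffunP=> k; rewrite !ffunE sgn_lin. Qed.

Lemma sgnopD f g : sgnop (f + g) = sgnop f + sgnop g.
Proof. by rewrite -[f]scale1r sgnop_lin !scale1r. Qed.

Lemma sgnopK f : sgnop (sgnop f) = f.
Proof. by apply/ffunP=> k; rewrite !ffunE sgnK. Qed.

Lemma sgnop_mxop m f : sgnop (mxop m f) = mxop m (sgnop f).
Proof.
apply/ffunP=> k; rewrite !ffunE sgn_sum; apply: eq_bigr => l _.
by rewrite !ffunE sgnZ.
Qed.

Lemma sgnop_actop b x f : pe n x -> homog b x ->
  sgnop (actop x f) = (-1) ^+ b *: actop x (sgnop f).
Proof. by move=> px hx; apply/ffunP=> k; rewrite !ffunE (sgn_act _ px hx). Qed.

Lemma rep0 : r 0 = 0.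
Proof.
have [[rl _ _] _ _ _] := rep.
by have := rl (-1) 0 0; rewrite scaler0 addr0 scaleN1r addNr.
Qed.

Lemma tactE b x f : homog b x ->
  tact x f = actop x f + mxop (r x) (if b then sgnop f else f).
Proof.
move=> hx; rewrite /tact (mx_even_homog hx) (mx_odd_homog hx).
by case: b {hx}; rewrite rep0 mxop0l addr0.
Qed.

Fact tact_linl a x y f : pe n x -> pe n y -> tact (a *: x + y) f = a *: tact x f + tact y f.
Proof.
move=> px py; have [[rl _ _] _ _ _] := rep.
have e1 : actop (a *: x + y) f = a *: actop x f + actop y f.
  by apply/ffunP=> k; rewrite !ffunE act_linl.
by rewrite /tact e1 mx_even_lin mx_odd_lin !rl !mxop_linl; lmod K.
Qed.

Fact tact_linr x a f g : pe n x -> tact x (a *: f + g) = a *: tact x f + tact x g.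
Proof.
by move=> px; rewrite /tact actop_linr // sgnop_lin !mxop_linr; lmod K.
Qed.

Fact tact_scomm b c x y f : pe n x -> pe n y -> homog b x -> homog c y ->
  tact (scomm x y) f = tact x (tact y f) - (-1) ^+ (b && c) *: tact y (tact x f).
Proof.
move=> px py hx hy; have [[_ rs _] _ _ _] := rep.
rewrite (tactE _ (homog_scomm hx hy)) (rs b c) // !(tactE _ hx) !(tactE _ hy).
have -> : actop (scomm x y) f
    = actop x (actop y f) - (-1) ^+ (b && c) *: actop y (actop x f).
  by apply/ffunP=> k; rewrite !ffunE (act_scomm _ px py hx hy).
rewrite !actopDr // !actop_mxop // mxopDl mxopNl mxopZl.
have sx g := sgnop_actop g px hx; have sy g := sgnop_actop g py hy.
case: b hx sx; case: c hy sy => hy sy hx sx /=;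
  rewrite ?sgnopD !mxopDr ?sgnop_mxop ?sx ?sy ?sgnopK !mxopM ?mxopZr;
  rewrite ?expr0 ?expr1; lmod K.
Qed.

Fact tsgn_lin a f g : tsgn (a *: f + g) = a *: tsgn f + tsgn g.
Proof. by rewrite /tsgn sgnop_lin mxop_linr. Qed.

Fact tsgnK f : tsgn (tsgn f) = f.
Proof.
have [_ [ss _] _ _] := rep.
by rewrite /tsgn sgnop_mxop sgnopK mxopM ss mxop1.
Qed.

Fact tsgn_act b x f : pe n x -> homog b x -> tsgn (tact x f) = (-1) ^+ b *: tact x (tsgn f).
Proof.
move=> px hx; have [_ [_ sr] _ _] := rep.
rewrite !(tactE _ hx) /tsgn sgnopD (sgnop_actop _ px hx) sgnop_mxop.
rewrite !mxopDr mxopZr mxopM (sr _ _ hx) mxopZl -mxopM.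
rewrite actop_mxop // scalerDr; congr (_ + _ *: mxop _ _).
by case: b {hx}; rewrite ?sgnop_mxop.
Qed.

Definition tensor : smod (@pe K n) :=
  SMod tact_linl tact_linr tact_scomm tsgn_lin tsgnK tsgn_act.

Definition tcontract (f : tensor) : P := \sum_k e 0 k *: (f : Q) k.

(** [e *m r y = 0] removes the part of the action on E, and [e *m s = e] makes the contraction
    even. *)
Lemma tcontract_hom : is_hom tcontract.
Proof.
have [_ _ [_ es er] _] := rep.
have em m f : tcontract (mxop m f) = \sum_l (e *m m) 0 l *: f l.
  rewrite /tcontract; under eq_bigr => k _ do rewrite ffunE scaler_sumr.
  rewrite exchange_big; apply: eq_bigr => l _ /=; rewrite mxE scaler_suml.
  by apply: eq_bigr => j _; rewrite scalerA.
have e0 y f : tcontract (mxop (r y) f) = 0.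
  by rewrite em er big1 // => l _; rewrite mxE scale0r.
have elin a f g : tcontract (a *: f + g) = a *: tcontract f + tcontract g.
  rewrite /tcontract scaler_sumr -big_split; apply: eq_bigr => k _ /=.
  by rewrite !ffunE scalerDr !scalerA mulrC.
have eD f g : tcontract (f + g) = tcontract f + tcontract g.
  by rewrite -[f]scale1r elin !scale1r.
split=> [a f g|x f px|f].
- exact: elin.
- rewrite [act x f]/(tact x f) !eD !e0 !addr0 /tcontract act_sumr //.
  by apply: eq_bigr => k _; rewrite ffunE actZr.
- rewrite [sgn f]/(tsgn f) em es /tcontract sgn_sum.
  by apply: eq_bigr => k _; rewrite ffunE sgnZ.
Qed.

Definition tpure (k : 'I_d) (v : P) : tensor := [ffun l => (l == k)%:R *: v].

Lemma tcontract_surj : is_surj tcontract.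
Proof.
have [_ _ [/eqP e0 _ _] _] := rep.
have [k ek] : exists k, e 0 k != 0.
  apply: contrapT => he; apply: e0; apply/matrixP=> i j; rewrite ord1 mxE.
  by apply/eqP/negPn/negP => ej; apply: he; exists j.
move=> v; exists (tpure k ((e 0 k)^-1 *: v)).
rewrite /tcontract (bigD1 k) //= ffunE eqxx scale1r scalerA divff // scale1r.
by rewrite big1 ?addr0 // => l /negPf nk; rewrite ffunE nk scale0r scaler0.
Qed.

Lemma tensor_acyclic : pe n x0 -> homog true x0 ->
  exists H : tensor -> tensor, H 0 = 0 /\
    forall f : tensor, act x0 (H f) + H (act x0 f) = f.
Proof.
move=> px hx; have [_ _ _ [hr _]] := rep.
(* The factor [sgnop] makes this map odd, so the terms in which x acts on P cancel and r x h + h r x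
   = 1 remains. *)
exists (fun f => mxop h (sgnop f)); split=> [|f].
  have -> : sgnop (0 : Q) = 0 by apply/ffunP=> k; rewrite !ffunE sgn0.
  exact: mxop0r.
rewrite /= !(tactE _ hx) sgnopD (sgnop_actop _ px hx) !sgnop_mxop sgnopK.
rewrite mxopDr !mxopM mxopZr actop_mxop // expr1.
rewrite -[RHS]mxop1 -hr mxopDl; lmod K.
Qed.

Lemma tensor_split (f : tensor) : f = \sum_k tpure k ((f : Q) k).
Proof.
apply/ffunP=> k; rewrite sum_ffunE (bigD1 k) //= ffunE eqxx scale1r big1 ?addr0 //.
by move=> l; rewrite ffunE eq_sym => /negPf->; rewrite scale0r.
Qed.

End TensorRepresentation.

(** * Projective dimension *)

Section Subspaces.
Variables (K : numFieldType) (n : nat) (t : set 'M[K]_(n + n)) (M : smod t).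
Variables (S : set M) (S_sub : subspace S).

Lemma subspaceD u v : S u -> S v -> S (u + v).
Proof. by move=> Su Sv; rewrite -[u]scale1r; apply: (S_sub.2). Qed.

Lemma subspaceZ a u : S u -> S (a *: u).
Proof. by move=> Su; rewrite -[a *: u]addr0; apply: (S_sub.2) => //; apply: (S_sub.1). Qed.

Lemma subspaceB u v : S u -> S v -> S (u - v).
Proof. by move=> Su Sv; rewrite addrC -scaleN1r; apply: (S_sub.2). Qed.

Lemma subspace_sum (I : Type) (r : seq I) (Q : pred I) (F : I -> M) :
  (forall i, S (F i)) -> S (\sum_(i <- r | Q i) F i).
Proof.
move=> SF; elim/big_ind: _ => [|u v Su Sv|//]; [exact: S_sub.1 | exact: subspaceD].
Qed.

End Subspaces.

(** * Finite-dimensional subspaces and local finiteness *)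

Section FiniteDimension.
Variables (K : numFieldType) (n : nat) (t : set 'M[K]_(n + n)) (M : smod t).

Lemma findim_fin (I : finType) (b : I -> M) (S : set M) :
  (forall v, S v -> exists c : I -> K, v = \sum_i c i *: b i) -> findim S.
Proof.
move=> hb; exists #|I|, (fun i => b (enum_val i)) => v /hb[c ->].
exists (fun i => c (enum_val i)); rewrite (reindex (@enum_val I I)) //.
by exists enum_rank => i _; rewrite ?enum_valK ?enum_rankK.
Qed.

Lemma findim_add (S S' : set M) : findim S -> findim S' ->
  findim [set u + v | u in S & v in S'].
Proof.
move=> [k [b hb]] [k' [b' hb']].
apply: (@findim_fin ('I_k + 'I_k')%type
  (fun i => match i with inl j => b j | inr j => b' j end)).
move=> _ [u /hb[c ->]] [v /hb'[c' ->]] <-.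
exists (fun i => match i with inl j => c j | inr j => c' j end).
by rewrite big_sumType.
Qed.

Lemma loc_finite_seq (u : set 'M[K]_(n + n)) (r : seq M) : u `<=` t -> loc_finite M u ->
  exists W : set M, [/\ subspace W, stable u W, findim W & forall v, v \in r -> W v].
Proof.
move=> ut lf; elim: r => [|v r [W [Wsub Wst Wfd Wr]]].
  exists [set 0]; split=> //.
  - by split=> // a _ _ -> ->; rewrite scaler0 addr0.
  - by move=> x _ ux ->; rewrite act0r //; apply: ut.
  - by exists 0%N, (fun=> 0) => v ->; exists (fun=> 0); rewrite big_ord0.
have hv := Uspan_subspace u [set v].
exists [set a + b | a in Uspan u [set v] & b in W]; split.
- split; first by exists 0; [exact: hv.1|exists 0; [exact: Wsub.1|rewrite addr0]].
  move=> a _ _ [p hp [q hq <-]] [p' hp' [q' hq' <-]].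
  exists (a *: p + p'); first exact: hv.2.
  by exists (a *: q + q'); [exact: Wsub.2 | lmod K].
- move=> x _ ux [p hp [q hq <-]]; rewrite actDr; last exact: ut.
  exists (act x p); first exact: Uspan_stable.
  by exists (act x q); first exact: Wst.
- exact: findim_add.
- move=> w; rewrite inE => /orP[/eqP->|/Wr Ww].
    by exists v; [exact: Uspan_sub | exists 0; [exact: Wsub.1 | rewrite addr0]].
  by exists 0; [exact: hv.1 | exists w; rewrite ?add0r].
Qed.

End FiniteDimension.

Section PeFacts.
Variables (K : numFieldType) (n : nat).
Local Notation gl := 'M[K]_(n + n).

Lemma cartan_homog (y : gl) : cartan y -> homog false y.
Proof.
move=> [_ /is_diag_mxP dy]; rewrite /homog /mx_even -{1}[y]submxK.
congr block_mx; apply/matrixP=> i j; rewrite !mxE dy //=.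
  by have := ltn_ord i; lia.
by have := ltn_ord j; lia.
Qed.

(** The second condition expresses that t is graded: it is stable under the parity automorphism of
    g. *)
Definition theta_closed (t : set gl) : Prop := t `<=` pe n /\ forall x, t x -> t (mx_theta x).

Lemma pe_ge0_theta (x : gl) : pe_ge0 n x -> pe_ge0 n (mx_theta x).
Proof.
by move=> [px x0]; split; [exact: pe_theta | rewrite mx_thetaE block_mxKdl x0 oppr0].
Qed.

Lemma nilp_theta_closed : theta_closed Defs.nilp.
Proof.
split=> x [hx ux]; first by case: hx.
by split; [exact: pe_ge0_theta | rewrite mx_thetaE block_mxKul].
Qed.

Lemma par_theta_closed (p0 : set 'M[K]_n) : theta_closed (par p0).
Proof.
split=> x [hx ux]; first by case: hx.
by split; [exact: pe_ge0_theta | rewrite mx_thetaE block_mxKul].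
Qed.

Lemma sgn_act_pe (M : smod (pe n)) (x : gl) (v : M) : pe n x ->
  sgn (act x v) = act (mx_theta x) (sgn v).
Proof. by move=> px; apply: sgn_act_theta; [exact: pe_even | exact: pe_odd]. Qed.

End PeFacts.

(** * Tensoring with E preserves the categories O and O^p *)

Section TensorCategoryO.
Variables (K : numFieldType) (n d : nat) (x0 : 'M[K]_(n + n)).
Variables (r : 'M[K]_(n + n) -> 'M[K]_d) (s h : 'M[K]_d) (e : 'rV[K]_d).
Hypothesis rep : acyclic_rep x0 r s h e.
Variable P : smod (@pe K n).
Local Notation T := (tensor rep P).

Lemma tpure_lin k a (u v : P) : tpure rep k (a *: u + v) = a *: tpure rep k u + tpure rep k v.
Proof. by apply/ffunP=> l; rewrite !ffunE scalerDr !scalerA mulrC. Qed.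

Lemma tpure0 k : tpure rep k (0 : P) = 0.
Proof. by apply/ffunP=> l; rewrite !ffunE scaler0. Qed.

Lemma tpureZ k a (u : P) : tpure rep k (a *: u) = a *: tpure rep k u.
Proof. by rewrite -[a *: u]addr0 tpure_lin tpure0 addr0. Qed.

Lemma tpureD k (u v : P) : tpure rep k (u + v) = tpure rep k u + tpure rep k v.
Proof. by rewrite -[u]scale1r tpure_lin !scale1r. Qed.

Lemma tpure_sum k (I : Type) (l : seq I) (F : I -> P) :
  tpure rep k (\sum_(i <- l) F i) = \sum_(i <- l) tpure rep k (F i).
Proof. by elim/big_rec2: _ => [|i u v _ <-]; rewrite ?tpure0 ?tpureD. Qed.

Lemma mxop_tpure m k (v : P) :
  mxop m (tpure rep k v) = \sum_l m l k *: (tpure rep l v : {ffun 'I_d -> P}).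
Proof.
apply/ffunP=> l; rewrite ffunE sum_ffunE (bigD1 k) //= ffunE eqxx scale1r.
rewrite big1 ?addr0 => [|j /negPf nj]; last by rewrite ffunE nj scale0r scaler0.
rewrite (bigD1 l) //= !ffunE eqxx scale1r big1 ?addr0 // => j nj.
by rewrite !ffunE eq_sym (negPf nj) scale0r scaler0.
Qed.

Lemma act_tpure b x k (v : P) : pe n x -> homog b x ->
  act x (tpure rep k v) = tpure rep k (act x v)
    + \sum_l r x l k *: tpure rep l (if b then sgn v else v) :> T.
Proof.
move=> px hx; pose f : {ffun 'I_d -> P} := tpure rep k v.
transitivity (actop x f + mxop (r x) (if b then sgnop f else f)).
  exact: (tactE rep _ hx).
have -> : (if b then sgnop f else f) = tpure rep k (if b then sgn v else v).
  by case: b {hx} => //; apply/ffunP=> l; rewrite !ffunE sgnZ.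
rewrite mxop_tpure; congr (_ + _); apply/ffunP=> l; rewrite !ffunE.
by rewrite actZr.
Qed.

Lemma tensor_fin_gen : fin_gen P -> fin_gen T.
Proof.
move=> [k [b hb]].
pose g (i : 'I_k * 'I_d * bool) : T :=
  tpure rep i.1.2 (if i.2 then sgn (b i.1.1) else b i.1.1).
exists #|{: 'I_k * 'I_d * bool}|, (fun i => g (enum_val i)).
set U := Uspan _ _; have Us : subspace U := Uspan_subspace _ _.
have Ug i : U (g i) by apply: Uspan_sub; exists (enum_rank i); rewrite ?enum_rankK.
(* x v (x) e_l is x (v (x) e_l) minus terms v (x) e_j, and for odd x these terms involve sgn v.
   Hence S controls v and sgn v at once. *)
pose S : set P := [set v | forall l, U (tpure rep l v) /\ U (tpure rep l (sgn v))].
have Ssub : subspace S.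
  split=> [l|a u v Su Sv l].
    by rewrite sgn0 tpure0; split; apply: Us.1.
  rewrite sgn_lin !tpure_lin.
  by split; apply: Us.2; [case: (Su l)|case: (Sv l)|case: (Su l)|case: (Sv l)].
have hom_st c x v : pe n x -> homog c x -> S v -> S (act x v).
  move=> px hx Sv l.
  have key w : (forall j, U (tpure rep j w)) -> (forall j, U (tpure rep j (sgn w))) ->
      U (tpure rep l (act x w)).
    move=> Uw Usw; have -> : tpure rep l (act x w) = act x (tpure rep l w)
        - \sum_j r x j l *: tpure rep j (if c then sgn w else w) :> T.
      by rewrite (act_tpure _ _ px hx) addrK.
    apply: (subspaceB Us).
      exact: (@Uspan_stable _ _ _ _ _ _ x _ px (Uw l)).
    by apply: (subspace_sum Us) => j; apply: (subspaceZ Us); case: (c).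
  split; first by apply: key => j; case: (Sv j).
  rewrite (sgn_act _ px hx).
  by rewrite tpureZ; apply: (subspaceZ Us); apply: key => j; rewrite ?sgnK; case: (Sv j).
have Sst : stable (pe n) S.
  move=> x v px Sv; rewrite -[x]mx_evenD actDl; [|exact: pe_even|exact: pe_odd].
  apply: (subspaceD Ssub).
    exact: hom_st (pe_even px) (homog_even x) Sv.
  exact: hom_st (pe_odd px) (homog_odd x) Sv.
have ST v : S v.
  have : Uspan (pe n) (range b) v by rewrite hb.
  apply: Uspan_min => // _ [i _ <-] l.
  by split; [apply: (Ug (i, l, false)) | apply: (Ug (i, l, true))].
apply/seteqP; split=> // f _; rewrite [f]tensor_split.
by apply: (subspace_sum Us) => l; have [] := ST ((f : {ffun _ -> _}) l) l.
Qed.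

Lemma tensor_h_semisimple : h_semisimple P -> h_semisimple T.
Proof.
pose ws (M : smod (@pe K n)) (v : M) :=
  exists (k : nat) (mu : 'I_k -> 'rV[K]_n) (u : 'I_k -> M),
    (forall i, weight_vector (mu i) (u i)) /\ v = \sum_(i < k) u i.
have ws0 M : ws M 0.
  by exists 0%N, (fun=> 0), (fun=> 0); split; [case | rewrite big_ord0].
have wsD M u v : ws M u -> ws M v -> ws M (u + v).
  move=> [k [mu [p [hp ->]]]] [k' [mu' [p' [hp' ->]]]].
  exists (k + k')%N, (fun i => match split i with inl j => mu j | inr j => mu' j end).
  exists (fun i => match split i with inl j => p j | inr j => p' j end); split.
    by move=> i; case: (split i).
  rewrite big_split_ord; congr (_ + _); apply: eq_bigr => i _.
    by rewrite (unsplitK (inl i)).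
  by rewrite (unsplitK (inr i)).
have ws_sum (M : smod (@pe K n)) (I : finType) (F : I -> M) :
    (forall i, ws M (F i)) -> ws M (\sum_i F i).
  by move=> hF; elim/big_ind: _ => [|u v|//]; [exact: ws0 | exact: wsD].
move=> hP f; rewrite [f]tensor_split; apply: (ws_sum) => k.
have [m [mu [u [hu ->]]]] := hP ((f : {ffun _ -> _}) k).
rewrite tpure_sum; apply: (ws_sum) => i; have [[_ _ [nu hnu]] _ _ _] := rep.
exists 1%N, (fun=> mu i + nu k), (fun=> tpure rep k (u i)); split; last first.
  by rewrite big_ord1.
move=> _ y cy; rewrite (act_tpure _ _ cy.1 (cartan_homog cy)) hu // (hnu y cy).
rewrite (bigD1 k) //= !mxE eqxx mulr1n big1 => [|l /negPf nl]; last first.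
  by rewrite !mxE nl mulr0n scale0r.
have -> : wt (mu i + nu k) y = wt (mu i) y + wt (nu k) y.
  by rewrite /wt -big_split; apply: eq_bigr => j _; rewrite mxE mulrDl.
by rewrite addr0 scalerDl tpureZ.
Qed.

Lemma tensor_loc_finite (t : set 'M[K]_(n + n)) : theta_closed t ->
  loc_finite P t -> loc_finite T t.
Proof.
move=> [tpe tth] lf f; pose F : {ffun 'I_d -> P} := f.
have [W [Wsub Wst Wfd Wf]] := loc_finite_seq
  ([seq F l | l : 'I_d] ++ [seq sgn (F l) | l : 'I_d]) tpe lf.
(* W may fail to be graded, while the action on P (x) E involves [sgn]. Its largest graded subspace
   still contains the coordinates of f, and it is stable because t is graded. *)
pose W' : set P := [set w | W w /\ W (sgn w)].
pose V : set T := [set g | forall l, W' ((g : {ffun _ -> _}) l)].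
have W'sub : subspace W'.
  split; first by split; rewrite ?sgn0; exact: Wsub.1.
  by move=> a u v [h1 h2] [h3 h4]; split; rewrite ?sgn_lin; exact: Wsub.2.
have W'sgn w : W' w -> W' (sgn w) by case=> h1 h2; split; rewrite ?sgnK.
have W'st : stable t W'.
  move=> x w tx [h1 h2]; split; first exact: Wst.
  by rewrite sgn_act_pe; [apply: Wst => //; exact: tth | exact: tpe].
apply: (@findim_sub _ _ _ _ _ V).
  apply: Uspan_min.
  - split=> [l|a u v hu hv l]; first by rewrite ffunE; exact: W'sub.1.
    by rewrite !ffunE; apply: W'sub.2.
  - move=> x g tx hg l; rewrite /= /tact !ffunE.
    apply: (subspaceD W'sub); [apply: (subspaceD W'sub)|].
    + exact: W'st.
    + by apply: (subspace_sum W'sub) => j; apply: (subspaceZ W'sub).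
    + by apply: (subspace_sum W'sub) => j; rewrite ffunE; apply: (subspaceZ W'sub); apply: W'sgn.
  - move=> _ -> l; split; apply: Wf; rewrite mem_cat; apply/orP; [left|right];
      by apply/mapP; exists l; rewrite ?mem_enum.
have [k [b hb]] := Wfd.
apply: (@findim_fin _ _ _ _ ('I_d * 'I_k)%type (fun i => tpure rep i.1 (b i.2))) => g hg.
have /choice[c hc] : forall l, exists c : 'I_k -> K, (g : {ffun _ -> _}) l = \sum_i c i *: b i.
  by move=> l; apply: hb; case: (hg l).
exists (fun i => c i.1 i.2).
rewrite [LHS]tensor_split -(pair_bigA _ (fun l i => c l i *: tpure rep l (b i))).
apply: eq_bigr => l _ /=.
by rewrite hc tpure_sum; apply: eq_bigr => i _; rewrite tpureZ.
Qed.

Lemma tensor_catO : catO P -> catO T.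
Proof.
move=> [h1 h2 h3]; split; [exact: tensor_fin_gen | exact: tensor_h_semisimple |].
exact: tensor_loc_finite (nilp_theta_closed _ _) h3.
Qed.

Lemma tensor_catOp (p0 : set 'M[K]_n) : catOp p0 P -> catOp p0 T.
Proof.
move=> [h1 h2]; split; first exact: tensor_catO.
exact: tensor_loc_finite (par_theta_closed _) h2.
Qed.

End TensorCategoryO.

(** * Acyclicity of x on projectives and along finite resolutions *)

Section ProjectiveAcyclic.
Variables (K : numFieldType) (n : nat).
Local Notation gl := 'M[K]_(n + n).

(** Stated for subsets, so that the images of differentials can be treated without turning them into
    modules. *)
Definition acyclic_at (x : gl) (M : smod (pe n)) (S : set M) : Prop :=
  forall v, S v -> act x v = 0 -> exists2 w, S w & v = act x w.

Lemma pe_g1_delta (i : 'I_n) : pe n (block_mx 0 (delta_mx i i) 0 0 : gl).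
Proof.
split; rewrite ?block_mxKul ?block_mxKur ?block_mxKdl ?block_mxKdr.
- by rewrite trmx0 oppr0.
- by rewrite trmx_delta.
- by rewrite trmx0 oppr0.
Qed.

Lemma homog_g1 (B : 'M[K]_n) : homog true (block_mx 0 B 0 0).
Proof. by rewrite /homog /mx_odd block_mxKur block_mxKdl. Qed.

Lemma scomm_g1 (B : 'M[K]_n) : scomm (block_mx 0 B 0 0) (block_mx 0 B 0 0) = 0.
Proof.
by rewrite scomm_block !(mulmx0, mul0mx, addr0, subr0, oppr0) block_mx0.
Qed.

Lemma projective_acyclic (A : smod (@pe K n) -> Prop) (i : 'I_n) :
  let x := block_mx 0 (delta_mx i i) 0 0 in
  (forall d (r : gl -> 'M[K]_d) s h e (rep : acyclic_rep x r s h e) P,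
    A P -> A (tensor rep P)) ->
  forall P, projective A P -> acyclic_at x [set: P].
Proof.
move=> x Atensor P [AP Pproj] v _ xv0.
have px := pe_g1_delta i; have hx := homog_g1 (delta_mx i i).
have [d [r [s [h [e rep]]]]] := acyclic_rep_exists K i.
have idhom : is_hom (id : P -> P) by split.
have chom := @tcontract_hom _ _ _ _ _ _ _ _ rep P.
have [g [[glin gact gsgn] gK]] := Pproj _ _ _ id (Atensor _ _ _ _ _ rep _ AP) AP
  chom (@tcontract_surj _ _ _ _ _ _ _ _ rep P) idhom.
have [H [H0 hH]] := tensor_acyclic rep P px hx.
have g0 : g 0 = 0 by have := glin (-1) 0 0; rewrite scaler0 addr0 scaleN1r addNr.
exists (tcontract (H (g v))) => //.
have [_ cact _] := chom.
(* Writing c for the contraction, v = c (g v) = c (x H (g v) + H (x g v)), where x g v = g (x v) = 0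
   and c commutes with x. *)
rewrite -cact // -{1}(gK v) -{1}(hH (g v)) -gact // xv0 g0.
by rewrite H0 addr0.
Qed.

Lemma act_sqr0 (M : smod (pe n)) (x : gl) (v : M) :
  pe n x -> homog true x -> scomm x x = 0 -> act x (act x v) = 0.
Proof.
move=> px hx xx; have := act_scomm v px px hx hx; rewrite xx act0l; last exact: pe0.
rewrite expr1 scaleN1r opprK -mulr2n -scaler_nat => /esym/eqP.
by rewrite scaler_eq0 pnatr_eq0 /= => /eqP.
Qed.

Section Resolution.
Variables (A : smod (@pe K n) -> Prop) (x : gl).
Hypotheses (px : pe n x) (hx : homog true x) (xx : scomm x x = 0).
Hypothesis projA : forall P, projective A P -> acyclic_at x [set: P].

(** Diagram chase in 0 -> im f -> P -> im g -> 0: if x g p = 0 then x p is a cycle in im f, so x p =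
    x q with q in im f; now p - q is a cycle in P, hence x w, and g p = x g w. *)
Lemma acyclic_image (M1 P M2 : smod (@pe K n)) (f : M1 -> P) (g : P -> M2) :
  is_hom g -> [set v | g v = 0] = range f -> acyclic_at x [set: P] ->
  acyclic_at x (range f) -> acyclic_at x (range g).
Proof.
move=> [glin gact _] ex accP accf _ [p _ <-]; rewrite -gact // => gxp0.
have gB u v : g (u - v) = g u - g v.
  by rewrite addrC -scaleN1r glin scaleN1r addrC.
have kerf u : g u = 0 <-> range f u by rewrite -ex.
have [q /kerf gq0 xpq] := accf _ ((kerf _).1 gxp0) (act_sqr0 p px hx xx).
have [//|w _ ew] := accP (p - q) I; first by rewrite actBr // xpq subrr.
by exists (g w); [exists w | rewrite -gact // -ew gB gq0 subr0].
Qed.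

Lemma resolution_acyclic M m : proj_resolution A M m -> acyclic_at x [set: M].
Proof.
move=> [P [diff [eps [Pproj [dhom ehom] [esurj eex] dex P0]]]].
(* Downward induction along the resolution: for i >= m the image is zero, and k bounds the distance
   from i to m. *)
have acc k i : (m <= i + k)%N -> acyclic_at x (range (@diff i)).
  elim: k i => [|k IHk] i.
    rewrite addn0 => mi _ [p _ <-] _; have -> : p = 0 by apply: P0; rewrite ltnS.
    have d0 : diff i 0 = 0.
      by have [dlin _ _] := dhom i; have := dlin (-1) 0 0; rewrite scaler0 addr0 scaleN1r addNr.
    by exists 0; [exists 0 | rewrite act0r].
  rewrite addnS -addSn => /IHk acc.
  exact: acyclic_image (dhom i) (dex i) (projA (Pproj _)) acc.
have h0 : acyclic_at x (range (diff 0%N)) by apply: (acc m); rewrite add0n.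
have := acyclic_image ehom eex (projA (Pproj _)) h0.
have -> : range eps = [set: M].
  by apply/seteqP; split=> // v _; have [u <-] := esurj v; exists u.
by [].
Qed.

Lemma not_acyclic_infinite_pd (M : smod (@pe K n)) (v : M) :
  act x v = 0 -> (forall w, v <> act x w) -> infinite_pd A M.
Proof.
move=> xv0 nv; rewrite /infinite_pd /pd; case: pselect => // ex.
have [d /asboolP res] := ex.
by have [w _ ev] := resolution_acyclic res I xv0; case: (nv w).
Qed.

End Resolution.

End ProjectiveAcyclic.

(** * Gradings and highest weight modules *)

Section Grading.
Variables (K : numFieldType) (n : nat) (k : 'I_n -> nat).
Local Notation gl := 'M[K]_(n + n).
Implicit Types (x y : gl) (q : pred int).

(** The degrees of the basis of the natural module when epsilon_j has degree k j. The blocks B and C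
    thereby get the degrees k i + k j and - k i - k j. *)
Definition wdeg (i : 'I_(n + n)) : int :=
  match split i with inl j => (k j)%:Z | inr j => - (k j)%:Z end.

Definition gmask q y : gl := \matrix_(i, j) if q (wdeg i - wdeg j) then y i j else 0.

Definition gsupp q y : Prop := forall i j, y i j != 0 -> q (wdeg i - wdeg j).

Lemma wdegl i : wdeg (lshift n i) = (k i)%:Z.
Proof. by rewrite /wdeg (unsplitK (inl i)). Qed.

Lemma wdegr i : wdeg (rshift n i) = - (k i)%:Z.
Proof. by rewrite /wdeg (unsplitK (inr i)). Qed.

Lemma gmask_lin q a x y : gmask q (a *: x + y) = a *: gmask q x + gmask q y.
Proof. by apply/matrixP=> i j; rewrite !mxE; case: ifP => _ //; rewrite mulr0 addr0. Qed.

Lemma gmask_supp q y : gsupp q (gmask q y).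
Proof. by move=> i j; rewrite mxE; case: ifP => // _; rewrite eqxx. Qed.

Lemma gmask_id q y : gsupp q y -> gmask q y = y.
Proof.
move=> hy; apply/matrixP=> i j; rewrite mxE; case: ifP => // hq.
by apply/esym/eqP; apply: contraFT hq => /hy.
Qed.

Lemma gmask_disjoint q q' y : gsupp q' y -> (forall a, q' a -> ~~ q a) -> gmask q y = 0.
Proof.
move=> hy hq; apply/matrixP=> i j; rewrite !mxE; case: ifP => // qij.
by apply/eqP; apply: contraTT qij => /hy /hq.
Qed.

Lemma gmaskC q y : gmask q y + gmask (predC q) y = y.
Proof. by apply/matrixP=> i j; rewrite !mxE /=; case: ifP => _; rewrite ?addr0 ?add0r. Qed.

Lemma gmask_pe q y : pe n y -> pe n (gmask q y).
Proof.
move=> [h1 h2 h3]; split; apply/matrixP=> i j.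
- have := congr1 (fun m : 'M_n => m i j) h1; rewrite !mxE !wdegl !wdegr => ->.
  by rewrite [- _ + _]addrC opprK; case: ifP => //; rewrite oppr0.
- have := congr1 (fun m : 'M_n => m i j) h2; rewrite !mxE !wdegl !wdegr !opprK => ->.
  by rewrite [_%:Z + _]addrC.
- have := congr1 (fun m : 'M_n => m i j) h3; rewrite !mxE !wdegl !wdegr => ->.
  rewrite [- (k i)%:Z - _]addrC; case: ifP => //; by rewrite oppr0.
Qed.

Lemma gmask_theta q y : mx_theta (gmask q y) = gmask q (mx_theta y).
Proof.
rewrite !mx_thetaE; apply/matrixP=> i j; rewrite -(splitK i) -(splitK j).
case: (split i) => i1; case: (split j) => j1 /=.
- by rewrite block_mxEul [RHS]mxE block_mxEul !mxE.
- by rewrite block_mxEur [RHS]mxE block_mxEur !mxE; case: ifP; rewrite ?oppr0.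
- by rewrite block_mxEdl [RHS]mxE block_mxEdl !mxE; case: ifP; rewrite ?oppr0.
- by rewrite block_mxEdr [RHS]mxE block_mxEdr !mxE.
Qed.

Lemma gmask_homog q b y : homog b y -> homog b (gmask q y).
Proof.
move=> hy; apply: homogP; rewrite gmask_theta (homog_theta hy).
by apply/matrixP=> i j; rewrite !mxE; case: ifP => //; rewrite mulr0.
Qed.

Lemma gsupp_theta q y : gsupp q y -> gsupp q (mx_theta y).
Proof. by move=> hy; rewrite -(gmask_id hy) gmask_theta; apply: gmask_supp. Qed.

Lemma gsupp_lin q a x y : gsupp q x -> gsupp q y -> gsupp q (a *: x + y).
Proof. by move=> hx hy; rewrite -(gmask_id hx) -(gmask_id hy) -gmask_lin; apply: gmask_supp. Qed.

Lemma gsupp0 q : gsupp q 0.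
Proof. by move=> i j; rewrite mxE eqxx. Qed.

Lemma gsuppZ q a x : gsupp q x -> gsupp q (a *: x).
Proof. by move=> hx; rewrite -[_ *: _]addr0; apply: gsupp_lin (@gsupp0 _). Qed.

Lemma gsuppD q x y : gsupp q x -> gsupp q y -> gsupp q (x + y).
Proof. by move=> hx hy; rewrite -[x]scale1r; apply: gsupp_lin. Qed.

Lemma gsuppN q x : gsupp q x -> gsupp q (- x).
Proof. by move=> hx; rewrite -scaleN1r; apply: gsuppZ. Qed.

Lemma even_theta y : mx_even y = 2^-1 *: (y + mx_theta y).
Proof.
rewrite /mx_theta -{2}[y]mx_evenD addrACA subrr addr0 -mulr2n -scaler_nat scalerA.
by rewrite mulVf ?scale1r ?pnatr_eq0.
Qed.

Lemma gsupp_even q y : gsupp q y -> gsupp q (mx_even y).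
Proof. by move=> hy; rewrite even_theta; apply/gsuppZ/gsuppD => //; apply: gsupp_theta. Qed.

Lemma gsupp_odd q y : gsupp q y -> gsupp q (mx_odd y).
Proof.
move=> hy; have -> : mx_odd y = y - mx_even y by rewrite -{2}[y]mx_evenD addrAC subrr add0r.
by apply/gsuppD => //; apply/gsuppN/gsupp_even.
Qed.

Lemma gsuppM q1 q2 q3 x y : gsupp q1 x -> gsupp q2 y ->
  (forall a b, q1 a -> q2 b -> q3 (a + b)) -> gsupp q3 (x *m y).
Proof.
move=> hx hy hq i j; rewrite mxE => /eqP nz.
have [l] : exists l, x i l * y l j != 0.
  apply: contrapT => h; apply: nz; rewrite big1 // => l _.
  by apply/eqP/negPn/negP => hl; apply: h; exists l.
rewrite mulf_eq0 negb_or => /andP[/hx h1 /hy h2].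
by have := hq _ _ h1 h2; rewrite addrA subrK.
Qed.

Lemma gsupp_scomm q1 q2 q3 b c x y : gsupp q1 x -> gsupp q2 y ->
  homog b x -> homog c y ->
  (forall a b, q1 a -> q2 b -> q3 (a + b)) -> gsupp q3 (scomm x y).
Proof.
move=> hx hy hb hc hq; rewrite (scommE hb hc); apply: gsuppD.
  exact: gsuppM hq.
by apply/gsuppN/gsuppZ; apply: gsuppM hy hx _ => a b' h1 h2; rewrite addrC; apply: hq.
Qed.

Definition gradelt : gl := \matrix_(i, j) if i == j then (wdeg i)%:~R else 0.

Lemma gradelt_cartan : cartan gradelt.
Proof.
split; last by apply/is_diag_mxP=> i j; rewrite mxE -val_eqE => /negPf->.
split; apply/matrixP=> i j; rewrite !mxE ?wdegl ?wdegr -!val_eqE /=.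
- rewrite eqn_add2l eq_sym; case: eqP => [/val_inj->|]; rewrite ?oppr0 //.
  by rewrite mulrNz.
- have -> : (j == n + i :> nat)%N = false by have := ltn_ord j; lia.
  by have -> : (i == n + j :> nat)%N = false by have := ltn_ord i; lia.
- have -> : (n + j == i :> nat)%N = false by have := ltn_ord i; lia.
  have -> : (n + i == j :> nat)%N = false by have := ltn_ord j; lia.
  by rewrite oppr0.
Qed.

Lemma gradelt_scomm b y (d : int) : homog b y -> gsupp (pred1 d) y ->
  scomm gradelt y = d%:~R *: y.
Proof.
move=> hb hy; rewrite (scommE (cartan_homog gradelt_cartan) hb) expr0 scale1r.
apply/matrixP=> i j; rewrite !mxE (bigD1 i) //= mxE eqxx big1 => [|l /negPf nl].
  rewrite (bigD1 j) //= [gradelt j j]mxE eqxx [X in _ - (_ + X)]big1 => [|l /negPf nl].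
    rewrite !addr0 mulrC -mulrBr mulrC -intrB.
    have [->|/hy/eqP->//] := eqVneq (y i j) 0; first by rewrite !mulr0.
  by rewrite mxE nl mulr0.
by rewrite mxE eq_sym nl mul0r.
Qed.

End Grading.

(** * The highest weight vector is not in the image of x *)

Section HighestWeightModules.
Variables (K : numFieldType) (n : nat).
Local Notation gl := 'M[K]_(n + n).
Variables (M : smod (@pe K n)) (v : M).

Definition neg_part (k : 'I_n -> nat) : set gl :=
  [set y | pe n y /\ gsupp k (fun a => a < 0) y].

(** Triangular generation: S consists of the vectors of T that nonnegative elements send into T. It
    is stable under a negative y, since z y u = [z, y] u +- y z u and [z, y] splits into a negative
    and a nonnegative part; hence T is contained in S and is stable under g. *)
Lemma neg_generates (k : 'I_n -> nat) :
  (forall y, pe n y -> gsupp k (fun a => 0 <= a) y -> exists c, act y v = c *: v) ->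
  Uspan (pe n) [set v] `<=` Uspan (neg_part k) [set v].
Proof.
move=> hv; set T := Uspan (neg_part k) _; have Tsub : subspace T := Uspan_subspace _ _.
have Tst : stable (neg_part k) T by exact: Uspan_stable.
have Tv : T v by apply: Uspan_sub.
pose S : set M := [set u | T u /\ forall c y, pe n y -> homog c y ->
  gsupp k (fun a => 0 <= a) y -> T (act y u)].
have Shom c y u : pe n y -> homog c y -> gsupp k (fun a => a < 0) y -> S u -> S (act y u).
  move=> py hy sy [Tu Su]; split; first exact: (Tst _ _ (conj py sy) Tu).
  move=> b z pz hz sz.
  have -> : act z (act y u) = act (scomm z y) u + (-1) ^+ (b && c) *: act y (act z u).
    by rewrite (act_scomm _ pz py hz hy) subrK.
  apply: (subspaceD Tsub).
    have pzy := pe_scomm pz py.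
    rewrite -(gmaskC k (fun a => a < 0) (scomm z y)) actDl; try exact: gmask_pe.
    apply: (subspaceD Tsub).
      exact: (Tst _ _ (conj (gmask_pe _ _ pzy) (@gmask_supp _ _ _ _ _)) Tu).
    apply: (Su (b (+) c)); [exact: gmask_pe | exact/gmask_homog/homog_scomm |].
    by move=> i j /(@gmask_supp _ _ k (predC (fun a => a < 0))) /=; rewrite -leNgt.
  apply: (subspaceZ Tsub); apply: (Tst _ _ (conj py sy)); exact: (Su b).
have Ssub : subspace S.
  split=> [|a u w [Tu Su] [Tw Sw]].
    by split=> [|c y py _ _]; [exact: Tsub.1 | rewrite act0r //; exact: Tsub.1].
  split=> [|c y py hy sy]; first exact: Tsub.2.
  by rewrite act_linr //; apply: Tsub.2; [apply: (Su c) | apply: (Sw c)].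
have TS : T `<=` S.
  apply: Uspan_min => // [y u [py sy] Su|_ ->].
    rewrite -[y]mx_evenD actDl; [|exact: pe_even|exact: pe_odd].
    apply: (subspaceD Ssub).
      by apply: (Shom false) => //; [exact: pe_even | exact: homog_even | exact: gsupp_even].
    by apply: (Shom true) => //; [exact: pe_odd | exact: homog_odd | exact: gsupp_odd].
  by split=> // c y py _ /(hv y py)[a ->]; apply: (subspaceZ Tsub).
apply: Uspan_min => // [y u py Tu|_ -> //].
rewrite -[y](gmaskC k (fun a => a < 0)) actDl; try exact: gmask_pe.
apply: (subspaceD Tsub).
  exact: (Tst _ _ (conj (gmask_pe _ _ py) (@gmask_supp _ _ _ _ _)) Tu).
set z := gmask _ _ _; have pz : pe n z by apply: gmask_pe.
have sz : gsupp k (fun a => 0 <= a) z.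
  by move=> i j /(@gmask_supp _ _ k (predC (fun a => a < 0))) /=; rewrite -leNgt.
have [_ Su] := TS _ Tu.
rewrite -[z]mx_evenD actDl; [|exact: pe_even|exact: pe_odd].
apply: (subspaceD Tsub).
  by apply: (Su false); [exact: pe_even | exact: homog_even | exact: gsupp_even].
by apply: (Su true); [exact: pe_odd | exact: homog_odd | exact: gsupp_odd].
Qed.

Variables (lambda : 'rV[K]_n) (i0 : 'I_n).
Hypothesis i0_last : i0 = n.-1 :> nat.
Hypotheses (v_neq0 : v != 0) (v_weight : weight_vector lambda v).
Hypothesis v_nilp : forall y, Defs.nilp y -> act y v = 0.
Hypothesis v_gen : Uspan (pe n) [set v] = [set: M].

(* With these degrees x has degree 0 while every root of the opposite of the
   Borel subalgebra has negative degree. *)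
Definition hdeg (j : 'I_n) : nat := n.-1 - j.
Local Notation hk := (gradelt K hdeg).
Local Notation kl := (wt lambda hk).
Local Notation x := (block_mx 0 (delta_mx i0 i0) 0 0 : gl).

(** For these degrees the nonnegative part of g is b: the only position of C with nonnegative degree
    is the last diagonal one, where C vanishes by antisymmetry. *)
Lemma nonneg_act y : pe n y -> gsupp hdeg (fun a => 0 <= a) y ->
  exists c, act y v = c *: v.
Proof.
move=> py sy; have [p1 p2 p3] := py.
pose D : gl := \matrix_(i, j) if i == j then y i j else 0.
have cD : cartan D.
  split; last by apply/is_diag_mxP=> i j; rewrite mxE -val_eqE => /negPf->.
  split; apply/matrixP=> i j.
  - have := congr1 (fun m : 'M_n => m i j) p1; rewrite !mxE -!val_eqE /= eqn_add2l eq_sym.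
    by case: ifP => // _; rewrite oppr0.
  - rewrite !mxE -!val_eqE /=.
    have -> : (j == n + i :> nat)%N = false by have := ltn_ord j; lia.
    by have -> : (i == n + j :> nat)%N = false by have := ltn_ord i; lia.
  - rewrite !mxE -!val_eqE /=.
    have -> : (n + j == i :> nat)%N = false by have := ltn_ord i; lia.
    have -> : (n + i == j :> nat)%N = false by have := ltn_ord j; lia.
    by rewrite oppr0.
have pD : pe n D by case: cD.
have pyD : pe n (y - D) by apply: pe_add => //; apply: pe_opp.
have nyD : Defs.nilp (y - D).
  split; first split=> //.
    apply/matrixP=> i j; rewrite !mxE -!val_eqE /=.
    have -> : (n + i == j :> nat)%N = false by have := ltn_ord j; lia.
    rewrite subr0; apply/eqP; apply/negPn/negP => nz.
    have := sy _ _ nz; rewrite wdegl wdegr /hdeg => dij.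
    have ij : i = j by apply: val_inj => /=; have := ltn_ord i; have := ltn_ord j; lia.
    have := congr1 (fun m : 'M_n => m i j) p3; rewrite !mxE ij => /eqP.
    rewrite -addr_eq0 -mulr2n -mulr_natr mulf_eq0 pnatr_eq0 orbF.
    by move: nz; rewrite ij => /negPf->.
  move=> i j ji; rewrite !mxE -!val_eqE /=; case: eqP => [/val_inj->|ij].
    by rewrite subrr.
  rewrite subr0; apply/eqP; apply/negPn/negP => nz.
  have := sy _ _ nz; rewrite !wdegl /hdeg.
  by have := ltn_ord i; have := ltn_ord j; lia.
exists (wt lambda D); rewrite -[y](subrK D) actDl // v_nilp // add0r.
exact: v_weight.
Qed.

(** [Uspan] over the empty set is the linear span. The eigenvalues of the single element [hk]
    replace the weights. *)
Definition lower : set M :=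
  Uspan classical_sets.set0 [set u | exists a : nat, act hk u = (kl - a.+1%:R) *: u].

Lemma lower_sub : subspace lower.
Proof. exact: Uspan_subspace. Qed.

Lemma pe_hk : pe n hk.
Proof. by have [] := @gradelt_cartan K n hdeg. Qed.

Lemma eigen_act (b : bool) y (d : int) (c : K) (u : M) : pe n y -> homog b y ->
  gsupp hdeg (pred1 d) y -> act hk u = c *: u ->
  act hk (act y u) = (c + d%:~R) *: act y u.
Proof.
move=> py hy sy hu.
have := act_scomm u pe_hk py (cartan_homog (gradelt_cartan K hdeg)) hy.
rewrite (gradelt_scomm hy sy) hu actZr // actZl //; last exact: pe0.
by rewrite expr0 scale1r => /eqP; rewrite eq_sym subr_eq => /eqP->; rewrite scalerDl addrC.
Qed.

Lemma eigen_lower (a : nat) y (u : M) : neg_part hdeg y ->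
  act hk u = (kl - a%:R) *: u -> lower (act y u).
Proof.
move=> [py sy] hu.
have hom_lower (b : bool) z : pe n z -> homog b z -> gsupp hdeg (fun a => a < 0) z ->
    lower (act z u).
  (* The components of z by degree, the index r standing for degree -(r + 1); degrees are at most 2
     (n - 1) in absolute value, so n + n indices suffice. *)
  move=> pz hz sz; pose f (r : 'I_(n + n)) := gmask hdeg (pred1 (- r.+1%:Z)) z.
  have -> : z = \sum_r f r.
    apply/matrixP=> i j; rewrite summxE.
    have [z0|nz] := eqVneq (z i j) 0.
      by rewrite z0 big1 // => r _; rewrite mxE z0; case: ifP.
    have dij := sz _ _ nz.
    have lt : (`|(wdeg hdeg i - wdeg hdeg j)%R|.-1 < n + n)%N.
      move: (dij); rewrite -(splitK i) -(splitK j).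
      case: (split i) => i1; case: (split j) => j1 /=; rewrite ?wdegl ?wdegr /hdeg;
        have := ltn_ord i1; have := ltn_ord j1; lia.
    rewrite (bigD1 (Ordinal lt)) //= mxE /=.
    have -> : (wdeg hdeg i - wdeg hdeg j ==
       - (`|(wdeg hdeg i - wdeg hdeg j)%R|.-1.+1)%:Z)%R by lia.
    rewrite big1 ?addr0 // => r; rewrite -val_eqE /= => nr; rewrite mxE.
    by case: ifP => // /eqP e; move: nr; rewrite e; lia.
  have pf r : pe n (f r) by apply: gmask_pe.
  have -> : act (\sum_r f r) u = \sum_r act (f r) u.
    have [] : pe n (\sum_r f r) /\ act (\sum_r f r) u = \sum_r act (f r) u; last by [].
    elim/big_ind2: _ => [|y1 w1 y2 w2 [q1 e1] [q2 e2]|r _].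
    - by split; [exact: pe0 | apply: act0l; exact: pe0].
    - by split; [exact: pe_add | rewrite actDl // e1 e2].
    - by [].
  apply: (subspace_sum lower_sub) => r; apply: Uspan_sub; exists (a + r)%N.
  rewrite (eigen_act (pf r) (gmask_homog _ _ hz) (@gmask_supp _ _ _ _ _) hu).
  by rewrite -addnS natrD opprD addrA mulrNz.
rewrite -[y]mx_evenD actDl; [|exact: pe_even|exact: pe_odd].
apply: (subspaceD lower_sub).
  by apply: (hom_lower false); [exact: pe_even | exact: homog_even | exact: gsupp_even].
by apply: (hom_lower true); [exact: pe_odd | exact: homog_odd | exact: gsupp_odd].
Qed.

Lemma lower_ind (S : set M) : subspace S ->
  (forall (u : M) (a : nat), act hk u = (kl - a.+1%:R) *: u -> S u) -> lower `<=` S.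
Proof.
by move=> hS hu; apply: Uspan_min => // u [a /hu].
Qed.

Lemma preimage_sub y : pe n y -> subspace [set u : M | lower (act y u)].
Proof.
move=> py; split=> [|a u w hu hw]; first by rewrite /= act0r //; exact: lower_sub.1.
by rewrite /= act_linr //; apply: lower_sub.2.
Qed.

Lemma top_decomposition u : exists c : K, lower (u - c *: v).
Proof.
pose W : set M := [set u | exists c : K, lower (u - c *: v)].
have eigv : act hk v = (kl - 0%:R) *: v.
  by rewrite subr0; apply: v_weight; exact: gradelt_cartan.
have : Uspan (neg_part hdeg) [set v] u.
  by apply: (neg_generates nonneg_act); rewrite v_gen.
suff /(_ u) : Uspan (neg_part hdeg) [set v] `<=` W by [].
apply: Uspan_min.
- split=> [|a u1 u2 [c1 h1] [c2 h2]].
    by exists 0; rewrite scale0r subr0; exact: lower_sub.1.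
  exists (a * c1 + c2).
  have -> : a *: u1 + u2 - (a * c1 + c2) *: v = a *: (u1 - c1 *: v) + (u2 - c2 *: v).
    by lmod K.
  exact: lower_sub.2.
- move=> y w ny [c hw]; have py : pe n y by case: ny.
  exists 0; rewrite scale0r subr0.
  have -> : act y w = c *: act y v + act y (w - c *: v).
    by rewrite actBr // actZr // addrC subrK.
  apply: lower_sub.2; first exact: eigen_lower ny eigv.
  have /(_ _ hw) : lower `<=` [set u : M | lower (act y u)].
    by apply: lower_ind => [|u1 a]; [exact: preimage_sub | exact: eigen_lower].
  by [].
- by move=> _ ->; exists 1; rewrite scale1r subrr; exact: lower_sub.1.
Qed.

(** The product of hk - (kl - m) over 1 <= m <= N. For large N it kills any given element of
    [lower], whereas on v it is the scalar N!, which is nonzero in characteristic 0. *)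
Fixpoint annihilator (N : nat) (u : M) : M :=
  if N is m.+1 then act hk (annihilator m u) - (kl - m.+1%:R) *: annihilator m u else u.

Lemma annihilator_lin N a u w :
  annihilator N (a *: u + w) = a *: annihilator N u + annihilator N w.
Proof.
elim: N => //= N ->; rewrite act_linr; last exact: pe_hk.
by lmod K.
Qed.

Lemma annihilator_eigen N (a : nat) (u : M) : act hk u = (kl - a%:R) *: u ->
  annihilator N u = (\prod_(j < N) (j.+1%:R - a%:R)) *: u.
Proof.
move=> hu; elim: N => [|N IHN] /=; first by rewrite big_ord0 scale1r.
rewrite IHN actZr; last exact: pe_hk.
by rewrite hu big_ord_recr /=; lmod K.
Qed.

Lemma top_notin_lower : ~ lower v.
Proof.
pose S : set M := [set u | exists N0, forall N, (N0 <= N)%N -> annihilator N u = 0].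
have ann0 N : annihilator N 0 = 0.
  by have := annihilator_lin N (-1) 0 0; rewrite scaler0 addr0 scaleN1r addNr.
have LS : lower `<=` S.
  apply: lower_ind.
    split=> [|a u w [N1 h1] [N2 h2]]; first by exists 0%N => N _; exact: ann0.
    exists (maxn N1 N2) => N; rewrite geq_max => /andP[hN1 hN2].
    by rewrite annihilator_lin h1 // h2 // scaler0 addr0.
  move=> u a hu; exists a.+1 => N aN; rewrite (annihilator_eigen N hu).
  by rewrite (bigD1 (Ordinal aN)) //= subrr mul0r scale0r.
move=> /LS[N /(_ N (leqnn N))]; rewrite (@annihilator_eigen N 0%N); last first.
  by rewrite subr0; apply: v_weight; exact: gradelt_cartan.
move=> /eqP; rewrite scaler_eq0 (negPf v_neq0) orbF prodf_seq_eq0 => /hasP[j _ /=].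
by rewrite subr0 pnatr_eq0.
Qed.

Lemma hw_x_kills : act x v = 0.
Proof.
apply: v_nilp; split; last by move=> i j _; rewrite block_mxKul mxE.
by split; [exact: pe_g1_delta | rewrite block_mxKdl].
Qed.

(** The component of w along v is killed by x, so v would be x of an element of [lower]; but x has
    degree 0 and preserves [lower]. *)
Lemma hw_not_image w : v <> act x w.
Proof.
move=> ev; apply: top_notin_lower; have [c hc] := top_decomposition w.
have px : pe n x := pe_g1_delta K i0.
have -> : v = act x (w - c *: v) by rewrite actBr // actZr // hw_x_kills scaler0 subr0.
have sx : gsupp hdeg (pred1 0) x.
  move=> i j; rewrite -(splitK i) -(splitK j).
  case: (split i) => i1; case: (split j) => j1 /=;
    rewrite ?block_mxEul ?block_mxEur ?block_mxEdl ?block_mxEdr !mxE ?eqxx //.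
  case: (eqVneq i1 i0) => [->|_]; case: (eqVneq j1 i0) => [->|_]; rewrite ?eqxx //
    wdegl wdegr /hdeg i0_last.
  by lia.
have /(_ _ hc) : lower `<=` [set u : M | lower (act x u)]; last by [].
apply: lower_ind => [|u a hu]; first exact: preimage_sub.
apply: Uspan_sub; exists a.
by rewrite (eigen_act px (homog_g1 _) sx hu) addr0.
Qed.

End HighestWeightModules.

(** * Induced modules *)

Section SuperJacobi.
Variables (K : numFieldType) (n : nat).
Local Notation gl := 'M[K]_(n + n).
Implicit Types x y z : gl.

Lemma scomm_linr a x y z : scomm z (a *: x + y) = a *: scomm z x + scomm z y.
Proof.
rewrite /scomm mx_even_lin mx_odd_lin !mulmxDl !mulmxDr -!scalemxAl -!scalemxAr.
lmod K.
Qed.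

Lemma scomm_linl a x y z : scomm (a *: x + y) z = a *: scomm x z + scomm y z.
Proof.
rewrite /scomm mx_even_lin mx_odd_lin !mulmxDl !mulmxDr -!scalemxAl -!scalemxAr.
lmod K.
Qed.

Lemma scommDl x y z : scomm (x + y) z = scomm x z + scomm y z.
Proof. by rewrite -[x]scale1r scomm_linl !scale1r. Qed.

Lemma scommDr x y z : scomm z (x + y) = scomm z x + scomm z y.
Proof. by rewrite -[x]scale1r scomm_linr !scale1r. Qed.

Lemma scomm_jacobi a b c x y z : homog a x -> homog b y -> homog c z ->
  scomm (scomm x y) z
  = scomm x (scomm y z) - (-1) ^+ (a && b) *: scomm y (scomm x z).
Proof.
move=> hx hy hz.
rewrite (scommE (homog_scomm hx hy) hz) (scommE hx (homog_scomm hy hz)).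
rewrite (scommE hy (homog_scomm hx hz)) (scommE hx hy) (scommE hy hz) (scommE hx hz).
rewrite !(mulmxBl, mulmxBr) -!scalemxAl -!scalemxAr !mulmxA.
by case: a hx => _; case: b hy => _; case: c hz => _; rewrite /= ?expr0 ?expr1; lmod K.
Qed.

Lemma scomm_flip b c x y : homog b x -> homog c y ->
  scomm x y = - (-1) ^+ (b && c) *: scomm y x.
Proof.
move=> hx hy; rewrite (scommE hx hy) (scommE hy hx).
by case: b {hx}; case: c {hy}; rewrite /= ?expr0 ?expr1; lmod K.
Qed.

End SuperJacobi.

(** Of the nine terms of the expansion three vanish; all others except (y0, y0') contain yp or yp',
    and (yp, yp') is counted twice. *)
Lemma biadditive_parts (K : numFieldType) (V : lmodType K) (f : V -> V) (B : V -> V -> V)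
    (yn y0 yp yn' y0' yp' : V) :
  {morph f : x y / x + y} -> (forall x y z, B (x + y) z = B x z + B y z) ->
  (forall x y z, B z (x + y) = B z x + B z y) ->
  f (B yn yn') = 0 -> f (B yn y0') = 0 -> f (B y0 yn') = 0 ->
  f (B (yn + y0 + yp) (yn' + y0' + yp')) = f (B yp (yn' + y0' + yp'))
    + (f (B (yn + y0 + yp) yp') + (f (B y0 y0') - f (B yp yp'))).
Proof. by move=> fD Bl Br enn en0 e0n; rewrite !(Bl, Br, fD) enn en0 e0n; lmod K. Qed.

Opaque scomm.

(** * The degree-zero and the positive part of a bracket *)

Section GradedBracket.
Variables (K : numFieldType) (n : nat) (k : 'I_n -> nat).
Local Notation gl := 'M[K]_(n + n).
Local Notation m0 := (gmask k (pred1 (0 : int))).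
Local Notation mp := (gmask k (fun a : int => 0 < a)).
Implicit Types (x y z : gl) (q : pred int).

Lemma gmaskD q x y : gmask k q (x + y) = gmask k q x + gmask k q y.
Proof. by rewrite -[x]scale1r gmask_lin !scale1r. Qed.

Local Notation mn := (gmask k (fun a : int => a < 0)).

Lemma gmask_trichotomy y : y = mn y + m0 y + mp y.
Proof.
apply/matrixP=> i j; rewrite !mxE /=.
by case: ltrgtP => _; rewrite ?addr0 ?add0r.
Qed.

Lemma gmask_scomm0 q q1 q2 b c y y' : homog b y -> homog c y' -> gsupp k q1 y ->
  gsupp k q2 y' -> (forall a a', q1 a -> q2 a' -> ~~ q (a + a')) ->
  gmask k q (scomm y y') = 0.
Proof.
move=> hy hy' sy sy' hq; apply: (@gmask_disjoint _ _ _ _ (predC q)) => //.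
exact: gsupp_scomm sy sy' hy hy' hq.
Qed.

Lemma gmask_scomm_id q q1 q2 b c y y' : homog b y -> homog c y' -> gsupp k q1 y ->
  gsupp k q2 y' -> (forall a a', q1 a -> q2 a' -> q (a + a')) ->
  gmask k q (scomm y y') = scomm y y'.
Proof. by move=> hy hy' sy sy' hq; apply/gmask_id/(gsupp_scomm sy sy' hy hy'). Qed.

Section Parts.
Variables (b c : bool) (yn y0 yp yn' y0' yp' : gl).
Hypotheses (hn : homog b yn) (h0 : homog b y0) (hp : homog b yp).
Hypotheses (hn' : homog c yn') (h0' : homog c y0') (hp' : homog c yp').
Hypotheses (sn : gsupp k (fun a : int => a < 0) yn) (s0 : gsupp k (pred1 (0 : int)) y0)
  (sp : gsupp k (fun a : int => 0 < a) yp).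
Hypotheses (sn' : gsupp k (fun a : int => a < 0) yn') (s0' : gsupp k (pred1 (0 : int)) y0')
  (sp' : gsupp k (fun a : int => 0 < a) yp').

Lemma m0_scomm_parts :
  m0 (scomm (yn + y0 + yp) (yn' + y0' + yp')) = m0 (scomm yp (yn' + y0' + yp'))
    + (m0 (scomm (yn + y0 + yp) yp') + (scomm y0 y0' - 0)).
Proof.
have e00 : m0 (scomm y0 y0') = scomm y0 y0'.
  by apply: gmask_scomm_id h0 h0' s0 s0' _ => a a' /=; lia.
have epp : m0 (scomm yp yp') = 0.
  by apply: gmask_scomm0 hp hp' sp sp' _ => a a' /=; lia.
refine (etrans (@biadditive_parts K _ (m0) (@scomm K n) yn y0 yp yn' y0' yp' _ _ _ _ _ _)
  (f_equal2 (fun u v => _ + (_ + (u - v))) e00 epp)).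
- exact: gmaskD.
- exact: scommDl.
- exact: scommDr.
- by apply: gmask_scomm0 hn hn' sn sn' _ => a a' /=; lia.
- by apply: gmask_scomm0 hn h0' sn s0' _ => a a' /=; lia.
- by apply: gmask_scomm0 h0 hn' s0 sn' _ => a a' /=; lia.
Qed.

Lemma mp_scomm_parts :
  mp (scomm (yn + y0 + yp) (yn' + y0' + yp')) = mp (scomm yp (yn' + y0' + yp'))
    + (mp (scomm (yn + y0 + yp) yp') + (0 - scomm yp yp')).
Proof.
have e00 : mp (scomm y0 y0') = 0.
  by apply: gmask_scomm0 h0 h0' s0 s0' _ => a a' /=; lia.
have epp : mp (scomm yp yp') = scomm yp yp'.
  by apply: gmask_scomm_id hp hp' sp sp' _ => a a' /=; lia.
refine (etrans (@biadditive_parts K _ (mp) (@scomm K n) yn y0 yp yn' y0' yp' _ _ _ _ _ _)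
  (f_equal2 (fun u v => _ + (_ + (u - v))) e00 epp)).
- exact: gmaskD.
- exact: scommDl.
- exact: scommDr.
- by apply: gmask_scomm0 hn hn' sn sn' _ => a a' /=; lia.
- by apply: gmask_scomm0 hn h0' sn s0' _ => a a' /=; lia.
- by apply: gmask_scomm0 h0 hn' s0 sn' _ => a a' /=; lia.
Qed.

End Parts.

Lemma gmask_flip q b c y y' : homog b y -> homog c y' ->
  (- (-1) ^+ (b && c)) *: gmask k q (scomm y' y) = gmask k q (scomm y y').
Proof.
move=> hy hy'; rewrite (scomm_flip hy hy').
apply/matrixP=> i j; rewrite !mxE.
by case: ifP => _; rewrite ?mulr0.
Qed.

(** The bracket is expressed through what [wact] sees at the empty word: degree-zero parts, positive
    parts as letters, and brackets of a letter with y or y'. *)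
Lemma m0_scomm b c y y' : homog b y -> homog c y' ->
  m0 (scomm y y') = scomm (m0 y) (m0 y')
    + (m0 (scomm (mp y) y') + (- (-1) ^+ (b && c)) *: m0 (scomm (mp y') y)).
Proof.
move=> hy hy'; have H q := gmask_homog k q hy; have H' q := gmask_homog k q hy'.
have S q x := @gmask_supp K n k q x.
have := m0_scomm_parts (H _) (H _) (H _) (H' _) (H' _) (H' _)
  (S _ y) (S _ y) (S _ y) (S _ y') (S _ y') (S _ y').
rewrite -!gmask_trichotomy -(gmask_flip _ hy (H' _)) subr0 => ->.
by rewrite addrA addrC.
Qed.

Lemma mp_scomm b c y y' : homog b y -> homog c y' ->
  mp (scomm y y') = 1 *: mp (scomm (mp y) y')
    + ((- (-1) ^+ (b && c)) *: mp (scomm (mp y') y) + (-1) *: scomm (mp y) (mp y')).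
Proof.
move=> hy hy'; have H q := gmask_homog k q hy; have H' q := gmask_homog k q hy'.
have S q x := @gmask_supp K n k q x.
have := mp_scomm_parts (H _) (H _) (H _) (H' _) (H' _) (H' _)
  (S _ y) (S _ y) (S _ y) (S _ y') (S _ y') (S _ y').
by rewrite -!gmask_trichotomy -(gmask_flip _ hy (H' _)) scale1r scaleN1r sub0r.
Qed.

End GradedBracket.

Transparent scomm.

(** * Functions on words and the embedding of N into the induced module *)

Section InducedNonzero.
Variables (K : numFieldType) (n : nat) (k : 'I_n -> nat).
Local Notation gl := 'M[K]_(n + n).
Variables (t : set gl) (N : smod t).
Local Notation m0 := (gmask k (pred1 (0 : int))).
Local Notation mp := (gmask k (fun a : int => 0 < a)).
Hypothesis tP : forall y, t y <-> pe n y /\ gsupp k (fun a : int => 0 <= a) y.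
Hypothesis pos_act : forall y (u : N), pe n y -> gsupp k (fun a : int => 0 < a) y ->
  act y u = 0.
Implicit Types (x y z : gl) (w : seq gl) (F G : seq gl -> N).

Definition letter z := [/\ pe n z, gsupp k (fun a : int => 0 < a) z & exists b, homog b z].
Definition word w := forall z, z \in w -> letter z.

Lemma word0 : word [::]. Proof. by []. Qed.

Lemma word_cons z w : letter z -> word w -> word (z :: w).
Proof. by move=> hz hw y; rewrite inE => /orP[/eqP->|/hw]. Qed.

Lemma word_inv z w : word (z :: w) -> letter z /\ word w.
Proof.
move=> h; split=> [|y yw]; apply: h; rewrite inE ?eqxx //.
by rewrite yw orbT.
Qed.

Lemma word_cat w w' : word w -> word w' -> word (w ++ w').
Proof. by move=> h h' z; rewrite mem_cat => /orP[/h|/h']. Qed.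

(** When F is read as a function on U(g), this is the action of the letter z, namely u |-> F (u
    z). *)
Definition shift z F := fun w => F (z :: w).

(* Functions on words of positive elements, F (z_1 ... z_m) standing for the
   top component of z_m ... z_1 applied to a vector. *)
Fixpoint wact y F w : N :=
  match w with
  | [::] => act (m0 y) (F [::]) + F [:: mp (mx_even y)] + F [:: mp (mx_odd y)]
  | z :: w' => wact (mx_even y) (shift z F) w' + wact (mx_odd y) (shift (mx_theta z) F) w'
               + wact (scomm z y) F w'
  end.

(** Linearity is asked for letters of equal parity, because letters are homogeneous. *)
Definition multilin F := forall b a z z' w w', letter z -> letter z' ->
  homog b z -> homog b z' -> word w -> word w' ->
  F (w ++ (a *: z + z') :: w') = a *: F (w ++ z :: w') + F (w ++ z' :: w').

(** A word lists its factors from right to left, so that z :: z' stands for the product z' z. *)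
Definition bracket_rel F := forall b c z z' w w', letter z -> letter z' ->
  homog b z -> homog c z' -> word w -> word w' ->
  F (w ++ scomm z' z :: w')
  = F (w ++ z :: z' :: w') - (-1) ^+ (b && c) *: F (w ++ z' :: z :: w').

Definition good F := multilin F /\ bracket_rel F.

Lemma letter_lin b a z z' : letter z -> letter z' -> homog b z -> homog b z' ->
  letter (a *: z + z').
Proof.
move=> [p s _] [p' s' _] h h'; split; [exact: pe_lin | exact: gsupp_lin |].
by exists b; apply: homog_add => //; apply: homog_scale.
Qed.

Lemma letter0 : letter 0.
Proof. by split; [exact: pe0 | exact: gsupp0 | exists false; exact: homog0]. Qed.

Lemma letter_scomm b c z z' : letter z -> letter z' -> homog b z -> homog c z' ->
  letter (scomm z z').
Proof.
move=> [p s _] [p' s' _] h h'; split; first exact: pe_scomm.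
  apply: (gsupp_scomm s s' h h') => a a'; exact: addr_gt0.
by exists (b (+) c); apply: homog_scomm.
Qed.

Lemma letter_theta z : letter z -> letter (mx_theta z).
Proof.
move=> [p s [b h]]; split; [exact: pe_theta | exact: gsupp_theta |].
by exists b; apply: homog_thetaP.
Qed.

Lemma letter_mp b y : pe n y -> homog b y -> letter (mp y).
Proof.
move=> py hy; split; [exact: gmask_pe | exact: gmask_supp |].
by exists b; apply: gmask_homog.
Qed.

Lemma nonneg_m0 y : pe n y -> t (m0 y).
Proof.
move=> py; apply/tP; split; first exact: gmask_pe.
by move=> i j /(@gmask_supp _ _ k (pred1 0)) /= /eqP ->.
Qed.

Lemma good_shift z F : letter z -> good F -> good (shift z F).
Proof.
move=> hz [ml br]; split.
  by move=> b a y y' w w' *; apply: (ml b a y y' (z :: w)) => //; apply: word_cons.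
by move=> b c y y' w w' *; apply: (br b c y y' (z :: w)) => //; apply: word_cons.
Qed.

Lemma good_lin a F G : good F -> good G -> good (fun w => a *: F w + G w).
Proof.
move=> [mF bF] [mG bG]; split.
  move=> b c z z' w w' lz lz' hz hz' hw hw'.
  by rewrite (mF b) // (mG b) //; lmod K.
move=> b c z z' w w' lz lz' hz hz' hw hw'.
by rewrite (bF b c) // (bG b c) //; lmod K.
Qed.

Lemma good_eq F G : (forall w, word w -> F w = G w) -> good F -> good G.
Proof.
move=> FG [mF bF]; split.
  move=> b a z z' w w' lz lz' hz hz' hw hw'; rewrite -!FG; first exact: (mF b).
  - by apply: word_cat => //; apply: word_cons.
  - by apply: word_cat => //; apply: word_cons.
  - by apply: word_cat => //; apply: word_cons => //; apply: (letter_lin a lz lz' hz).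
move=> b c z z' w w' lz lz' hz hz' hw hw'; rewrite -!FG; first exact: (bF b c).
- by apply: word_cat => //; do 2![apply: word_cons => //].
- by apply: word_cat => //; do 2![apply: word_cons => //].
- by apply: word_cat => //; apply: word_cons => //; exact: (letter_scomm lz' lz hz' hz).
Qed.

Lemma wact_linr y a F G w : pe n y -> word w ->
  wact y (fun w => a *: F w + G w) w = a *: wact y F w + wact y G w.
Proof.
elim: w y F G => [|z w IHw] y F G py hw /=.
  by rewrite act_linr; [lmod K | exact: nonneg_m0].
have [[pz _ _] {}hw] := word_inv hw.
have E y' z' : pe n y' -> wact y' (shift z' (fun w => a *: F w + G w)) w
    = a *: wact y' (shift z' F) w + wact y' (shift z' G) w.
  by move=> py'; apply: (IHw _ (shift z' F) (shift z' G)).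
have pe' := pe_even py; have po' := pe_odd py; have ps := pe_scomm pz py.
by rewrite !E ?IHw //; lmod K.
Qed.

Lemma wact_eq y F G w : (forall w, word w -> F w = G w) -> pe n y -> word w ->
  wact y F w = wact y G w.
Proof.
elim: w y F G => [|z w IHw] y F G FG py hw /=.
  have word1 b y' : pe n y' -> homog b y' -> word [:: mp y'].
    by move=> p h; apply: word_cons word0; apply: letter_mp p h.
  rewrite !FG //.
    exact: word1 (pe_odd py) (homog_odd y).
  exact: word1 (pe_even py) (homog_even y).
have [lz {}hw] := word_inv hw; have [pz _ _] := lz.
congr (_ + _ + _); apply: IHw => //.
- by move=> w' hw'; apply/FG/word_cons.
- exact: pe_even.
- by move=> w' hw'; apply/FG/word_cons => //; apply: letter_theta.
- exact: pe_odd.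
- exact: pe_scomm.
Qed.

Lemma wact_linl a x y F w : good F -> pe n x -> pe n y -> word w ->
  wact (a *: x + y) F w = a *: wact x F w + wact y F w.
Proof.
elim: w x y F => [|z w IHw] x y F gF px py hw /=.
  have [mF _] := gF; rewrite mx_even_lin mx_odd_lin !gmask_lin.
  rewrite act_linl; [|exact: nonneg_m0|exact: nonneg_m0].
  have pxe := pe_even px; have pye := pe_even py.
  have pxo := pe_odd px; have pyo := pe_odd py.
  have lxe := letter_mp pxe (homog_even x); have lye := letter_mp pye (homog_even y).
  have lxo := letter_mp pxo (homog_odd x); have lyo := letter_mp pyo (homog_odd y).
  rewrite (mF false a _ _ [::] [::]) ?(mF true a _ _ [::] [::]) //=; first by lmod K.
  - exact/gmask_homog/homog_odd.
  - exact/gmask_homog/homog_odd.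
  - exact/gmask_homog/homog_even.
  - exact/gmask_homog/homog_even.
have [lz {}hw] := word_inv hw; have [pz _ _] := lz.
rewrite mx_even_lin mx_odd_lin scomm_linr !IHw //; first by lmod K.
all: try exact: pe_even; try exact: pe_odd; try exact: pe_scomm.
all: by apply: good_shift => //; apply: letter_theta.
Qed.

Lemma wact0l F w : good F -> word w -> wact 0 F w = 0.
Proof.
move=> gF hw; have := wact_linl (-1) gF (@pe0 _ _) (@pe0 _ _) hw.
by rewrite scaler0 addr0 scaleN1r addNr.
Qed.

Lemma wact0r y w : pe n y -> word w -> wact y (fun=> 0) w = 0.
Proof.
move=> py hw; transitivity (wact y (fun=> -1 *: 0 + 0 : N) w).
  by apply: wact_eq => // w' _; rewrite scaler0 addr0.
by rewrite (wact_linr (-1) (fun=> 0) (fun=> 0)) // scaleN1r addNr.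
Qed.

Lemma wactZr y a F w : pe n y -> word w ->
  wact y (fun w => a *: F w) w = a *: wact y F w.
Proof.
move=> py hw; transitivity (wact y (fun w => a *: F w + 0) w).
  by apply: wact_eq => // w' _; rewrite addr0.
by rewrite (wact_linr a F (fun=> 0)) // wact0r // addr0.
Qed.

Lemma good_scale_letter F c a z w w' : good F -> letter z -> homog c z ->
  word w -> word w' -> F (w ++ (a *: z) :: w') = a *: F (w ++ z :: w').
Proof.
move=> [mF _] lz hz hw hw'.
have F0 : F (w ++ 0 :: w') = 0.
  have := mF c (-1) 0 0 w w' letter0 letter0 (homog0 _ _ _) (homog0 _ _ _) hw hw'.
  by rewrite scaler0 addr0 scaleN1r addNr.
by rewrite -[a *: z]addr0 (mF c) ?F0 ?addr0 //; [exact: letter0 | exact: homog0].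
Qed.

(** For homogeneous arguments the recursion is u z y = +- u y z + u [z, y] in U(g). *)
Lemma wact_cons b c y z F w : good F -> pe n y -> homog b y -> letter z ->
  homog c z -> word w ->
  wact y F (z :: w) = (-1) ^+ (b && c) *: wact y (shift z F) w + wact (scomm z y) F w.
Proof.
move=> gF py hy lz hz hw /=; rewrite (mx_even_homog hy) (mx_odd_homog hy).
have gz := good_shift lz gF.
case: b hy => hy /=; rewrite wact0l //; last first.
- exact: good_shift (letter_theta lz) gF.
- by rewrite expr0 scale1r addr0.
rewrite add0r; congr (_ + _); rewrite -wactZr //; apply: wact_eq => // w' hw'.
by rewrite /shift (homog_theta hz); apply: (good_scale_letter _ gF lz hz word0).
Qed.

Lemma wact_nil b y F : good F -> homog b y ->
  wact y F [::] = act (m0 y) (F [::]) + F [:: mp y].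
Proof.
move=> gF hy; rewrite /= (mx_even_homog hy) (mx_odd_homog hy).
have F0 : F [:: 0] = 0.
  by have := good_scale_letter 0 gF letter0 (homog0 _ _ false) word0 word0; rewrite !scale0r.
have mp0 : mp 0 = 0 :> gl by apply/matrixP=> i j; rewrite !mxE if_same.
by case: b hy => _; rewrite mp0 F0 addr0.
Qed.

Opaque scomm wact gmask.

Lemma wact_shift_lin y b a z z' F w : good F -> pe n y -> letter z -> letter z' ->
  homog b z -> homog b z' -> word w ->
  wact y (shift (a *: z + z') F) w = a *: wact y (shift z F) w + wact y (shift z' F) w.
Proof.
move=> [mF _] py lz lz' hz hz' hw; rewrite -wact_linr //.
by apply: wact_eq => // w' hw'; apply: (mF b a z z' [::]).
Qed.

Lemma wact_shift_scomm y b c z z' F w : good F -> pe n y -> letter z -> letter z' ->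
  homog b z -> homog c z' -> word w ->
  wact y (shift (scomm z' z) F) w = wact y (shift z' (shift z F)) w
    - (-1) ^+ (b && c) *: wact y (shift z (shift z' F)) w.
Proof.
move=> [_ bF] py lz lz' hz hz' hw.
rewrite addrC -scaleNr -wact_linr //.
by apply: wact_eq => // w' hw'; rewrite addrC scaleNr; apply: (bF b c z z' [::]).
Qed.

Lemma wact_good_homog b y F : good F -> pe n y -> homog b y -> good (wact y F).
Proof.
move=> gF py hy; split.
  move=> c a z z' w w' lz lz' hz hz' hw hw'.
  have lzz := letter_lin a lz lz' hz hz'; have [pz _ _] := lz; have [pz' _ _] := lz'.
  have hzz : homog c (a *: z + z') by apply: homog_add => //; apply: homog_scale.
  elim: w b y F gF py hy hw => [|z1 w IHw] b y F gF py hy hw.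
    rewrite !cat0s (wact_cons gF py hy lzz hzz hw') (wact_cons gF py hy lz hz hw').
    rewrite (wact_cons gF py hy lz' hz' hw') (wact_shift_lin _ gF py lz lz' hz hz' hw').
    rewrite scomm_linl (wact_linl _ gF) //; try exact: pe_scomm.
    by lmod K.
  have [lz1 {}hw] := word_inv hw; have [pz1 _ [c1 hz1]] := lz1.
  rewrite !cat_cons !(wact_cons gF py hy lz1 hz1); first last.
  - by apply: word_cat => //; apply: word_cons.
  - by apply: word_cat => //; apply: word_cons.
  - by apply: word_cat => //; apply: word_cons.
  rewrite (IHw _ _ _ (good_shift lz1 gF) py hy hw).
  rewrite (IHw _ _ _ gF (pe_scomm pz1 py) (homog_scomm hz1 hy) hw).
  by lmod K.
move=> c c' z z' w w' lz lz' hz hz' hw hw'.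
have [pz _ _] := lz; have [pz' _ _] := lz'.
have lzz := letter_scomm lz' lz hz' hz; have hzz := homog_scomm hz' hz.
(* The recursion replaces F by a shift and y by a bracket, so both are generalized. Once the prefix
   is used up, the relation for z' and z becomes the Jacobi identity for z', z and y. *)
elim: w b y F gF py hy hw => [|z1 w IHw] b y F gF py hy hw.
  have pzy := pe_scomm pz py; have pzy' := pe_scomm pz' py.
  have hzy := homog_scomm hz hy; have hzy' := homog_scomm hz' hy.
  have gz := good_shift lz gF; have gz' := good_shift lz' gF.
  rewrite !cat0s (wact_cons gF py hy lzz hzz hw').
  rewrite (wact_cons gF py hy lz hz); last exact: word_cons.
  rewrite (wact_cons gF py hy lz' hz'); last exact: word_cons.
  rewrite (wact_cons gz py hy lz' hz' hw') (wact_cons gz' py hy lz hz hw').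
  rewrite (wact_cons gF pzy hzy lz' hz' hw') (wact_cons gF pzy' hzy' lz hz hw').
  rewrite (wact_shift_scomm gF py lz lz' hz hz' hw') (scomm_jacobi hz' hz hy).
  rewrite addrC -scaleNr [X in wact X F w']addrC.
  rewrite (wact_linl _ gF); [|exact: pe_scomm|exact: pe_scomm|by []].
  by case: (b); case: (c); case: (c'); rewrite /= ?expr0 ?expr1; lmod K.
have [lz1 {}hw] := word_inv hw; have [pz1 _ [c1 hz1]] := lz1.
have hw1 : word (w ++ [:: z, z' & w']) by apply: word_cat => //; do 2![apply: word_cons => //].
have hw2 : word (w ++ [:: z', z & w']) by apply: word_cat => //; do 2![apply: word_cons => //].
have hw3 : word (w ++ scomm z' z :: w') by apply: word_cat => //; apply: word_cons.
rewrite !cat_cons !(wact_cons gF py hy lz1 hz1) //.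
rewrite (IHw _ _ _ (good_shift lz1 gF) py hy hw).
rewrite (IHw _ _ _ gF (pe_scomm pz1 py) (homog_scomm hz1 hy) hw).
by lmod K.
Qed.

Lemma wact_even_odd y F w : good F -> pe n y -> word w ->
  wact y F w = wact (mx_even y) F w + wact (mx_odd y) F w.
Proof.
move=> gF py hw; rewrite -[wact (mx_even y) F w]scale1r.
by rewrite -wact_linl ?scale1r ?mx_evenD //; [exact: pe_even | exact: pe_odd].
Qed.

Lemma wact_good y F : good F -> pe n y -> good (wact y F).
Proof.
move=> gF py; apply: (@good_eq (fun w => 1 *: wact (mx_even y) F w + wact (mx_odd y) F w)).
  by move=> w hw; rewrite scale1r -wact_even_odd.
apply: good_lin.
  exact: wact_good_homog gF (pe_even py) (homog_even y).
exact: wact_good_homog gF (pe_odd py) (homog_odd y).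
Qed.

(** The recursion yields +- F (z1 :: z :: w) + F ([z1, z] :: w), and [bracket_rel] recombines these
    into F (z :: z1 :: w). *)
Lemma wact_letter z F w : good F -> letter z -> word w -> wact z F w = F (z :: w).
Proof.
move=> gF lz; have [pz sz [b hz]] := lz.
elim: w z F b gF lz pz sz hz => [|z1 w IHw] z F b gF lz pz sz hz hw.
  have hs a : (0 : int) < a -> ~~ pred1 (0 : int) a by move=> /= a0; rewrite gt_eqF.
  rewrite (wact_nil gF hz) (gmask_disjoint sz hs) act0l; last first.
    by rewrite -(gmask_disjoint sz hs); apply: nonneg_m0.
  by rewrite add0r (gmask_id sz).
have [lz1 {}hw] := word_inv hw; have [pz1 sz1 [c hz1]] := lz1.
rewrite (wact_cons gF pz hz lz1 hz1 hw).
rewrite (IHw z _ b (good_shift lz1 gF)) //.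
have lzz := letter_scomm lz1 lz hz1 hz; have [pzz szz _] := lzz.
rewrite (IHw _ _ (c (+) b) gF) //; last exact: homog_scomm.
have [_ bF] := gF; have := bF b c z z1 [::] w lz lz1 hz hz1 word0 hw.
by rewrite !cat0s /shift => ->; lmod K.
Qed.

Lemma nonnegZ d x : t x -> t (d *: x).
Proof. by move=> /tP[px sx]; apply/tP; split; [exact: pe_scale | exact: gsuppZ]. Qed.

Lemma nonnegD x y : t x -> t y -> t (x + y).
Proof.
by move=> /tP[px sx] /tP[py sy]; apply/tP; split; [exact: pe_add | exact: gsuppD].
Qed.

Lemma nonneg0 : t 0.
Proof. by apply/tP; split; [exact: pe0 | exact: gsupp0]. Qed.

Lemma act_m0_scomm b c y y' (u : N) : pe n y -> pe n y' -> homog b y -> homog c y' ->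
  act (m0 (scomm y y')) u = act (m0 y) (act (m0 y') u)
    - (-1) ^+ (b && c) *: act (m0 y') (act (m0 y) u)
    + (act (m0 (scomm (mp y) y')) u
       - (-1) ^+ (b && c) *: act (m0 (scomm (mp y') y)) u).
Proof.
move=> py py' hy hy'; have t1 := nonneg_m0 py; have t2 := nonneg_m0 py'.
have h1 := gmask_homog k (pred1 0) hy; have h2 := gmask_homog k (pred1 0) hy'.
have t3 : t (m0 (scomm (mp y) y')) by apply/nonneg_m0/pe_scomm => //; apply: gmask_pe.
have t4 : t (m0 (scomm (mp y') y)) by apply/nonneg_m0/pe_scomm => //; apply: gmask_pe.
have t5 : t (scomm (m0 y) (m0 y')).
  apply/tP; split; first by apply: pe_scomm; apply: gmask_pe.
  apply: gsupp_scomm (@gmask_supp _ _ _ _ y) (@gmask_supp _ _ _ _ y') h1 h2 _.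
  by move=> i j /eqP-> /eqP->.
rewrite (m0_scomm k hy hy') (actDl u t5 (nonnegD t3 (nonnegZ _ t4))) (actDl u t3 (nonnegZ _ t4)).
by rewrite (actZl _ u nonneg0 t4) (act_scomm u t1 t2 h1 h2) scaleNr.
Qed.

Lemma good_mp_scomm b c y y' F : good F -> pe n y -> pe n y' -> homog b y -> homog c y' ->
  F [:: mp (scomm y y')] = F [:: mp (scomm (mp y) y')]
    - (-1) ^+ (b && c) *: F [:: mp (scomm (mp y') y)]
    - (F [:: mp y'; mp y] - (-1) ^+ (c && b) *: F [:: mp y; mp y']).
Proof.
move=> [mF bF] py py' hy hy'.
have lz := letter_mp py hy; have lz' := letter_mp py' hy'.
have hz := gmask_homog k (fun a : int => 0 < a) hy.
have hz' := gmask_homog k (fun a : int => 0 < a) hy'.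
have [pz _ _] := lz; have [pz' _ _] := lz'.
have h1 := homog_scomm hz hy'; have h2 := homog_scomm hz' hy; rewrite addbC in h2.
have l1 := letter_mp (pe_scomm pz py') h1; have l2 := letter_mp (pe_scomm pz' py) h2.
have l3 := letter_scomm lz lz' hz hz'; have h3 := homog_scomm hz hz'.
have g1 := gmask_homog k (fun a : int => 0 < a) h1.
have g2 := gmask_homog k (fun a : int => 0 < a) h2.
have l30 : letter ((-1) *: scomm (mp y) (mp y')).
  by rewrite -[X in letter X]addr0; apply: (letter_lin (-1) l3 letter0 h3 (homog0 _ _ _)).
have h30 := homog_scale (-1) h3.
have l23 := letter_lin (- (-1) ^+ (b && c)) l2 l30 g2 h30.
have h23 := homog_add (homog_scale (- (-1) ^+ (b && c)) g2) h30.
rewrite (mp_scomm k hy hy').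
rewrite (mF _ 1 _ _ [::] [::] l1 l23 g1 h23 word0 word0) /=.
rewrite (mF _ _ _ _ [::] [::] l2 l30 g2 h30 word0 word0) /=.
have /= -> := good_scale_letter (-1) (conj mF bF) l3 h3 word0 word0.
have /= -> := bF c b _ _ [::] [::] lz' lz hz' hz word0 word0.
by lmod K.
Qed.

(** Both sides expand into the action on N and values of F at words of length at most two;
    [act_m0_scomm] and [good_mp_scomm] match them. *)
Lemma wact_scomm_nil b c y y' F : good F -> pe n y -> pe n y' -> homog b y ->
  homog c y' ->
  wact (scomm y y') F [::]
  = wact y (wact y' F) [::] - (-1) ^+ (b && c) *: wact y' (wact y F) [::].
Proof.
move=> gF py py' hy hy'.
have gy := wact_good gF py; have gy' := wact_good gF py'.
have lz := letter_mp py hy; have lz' := letter_mp py' hy'.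
have hz := gmask_homog k (fun a : int => 0 < a) hy.
have hz' := gmask_homog k (fun a : int => 0 < a) hy'.
have [pz _ _] := lz; have [pz' _ _] := lz'.
have h1 := homog_scomm hz hy'; have h2 := homog_scomm hz' hy.
have p1 := pe_scomm pz py'; have p2 := pe_scomm pz' py.
have E1 := wact_nil gF (homog_scomm hy hy').
have E2 := wact_nil gy' hy; have E3 := wact_nil gy hy'.
have E4 := wact_nil gF hy; have E5 := wact_nil gF hy'.
have E6 := wact_cons gF py' hy' lz hz word0; have E7 := wact_cons gF py hy lz' hz' word0.
have E8 := wact_nil (good_shift lz gF) hy'; have E9 := wact_nil (good_shift lz' gF) hy.
have E10 := wact_nil gF h1; have E11 := wact_nil gF h2.
have t1 := nonneg_m0 py; have t2 := nonneg_m0 py'.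
rewrite E1 E2 E3 E4 E5 E6 E7 E8 E9 E10 E11 /shift.
rewrite (act_m0_scomm _ py py' hy hy') (good_mp_scomm gF py py' hy hy').
rewrite !(actDr _ _ t1) !(actDr _ _ t2).
by case: (b); case: (c); rewrite /= ?expr0 ?expr1; lmod K.
Qed.

(** Moving the first letter z past y and y' leaves the relation on the shorter word for the pairs
    (y, y'), ([z, y], y') and (y, [z, y']), assembled by the Jacobi identity. *)
Lemma wact_scomm b c y y' F w : good F -> pe n y -> pe n y' -> homog b y ->
  homog c y' -> word w ->
  wact (scomm y y') F w
  = wact y (wact y' F) w - (-1) ^+ (b && c) *: wact y' (wact y F) w.
Proof.
elim: w b c y y' F => [|z w IHw] b c y y' F gF py py' hy hy' hw.
  exact: wact_scomm_nil.
have [lz {}hw] := word_inv hw; have [pz sz [a hz]] := lz.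
have gy := wact_good gF py; have gy' := wact_good gF py'.
have gz := good_shift lz gF.
have E d u d' u' : pe n u -> homog d u -> pe n u' -> homog d' u' ->
    wact u (shift z (wact u' F)) w
    = (-1) ^+ (d' && a) *: wact u (wact u' (shift z F)) w + wact u (wact (scomm z u') F) w.
  move=> pu hu pu' hu'; rewrite -wact_linr //; apply: wact_eq => // w' hw'.
  by rewrite -(wact_cons gF pu' hu' lz hz hw').
rewrite (wact_cons gF (pe_scomm py py') (homog_scomm hy hy') lz hz hw).
rewrite (wact_cons gy' py hy lz hz hw) (wact_cons gy py' hy' lz hz hw).
rewrite (E b y c y') // (E c y' b y) //.
rewrite (IHw b c) //.
have pzy := pe_scomm pz py; have pzy' := pe_scomm pz py'.
have hzy := homog_scomm hz hy; have hzy' := homog_scomm hz hy'.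
have := IHw (a (+) b) c _ _ _ gF pzy py' hzy hy' hw.
have := IHw b (a (+) c) _ _ _ gF py pzy' hy hzy' hw.
have -> : scomm z (scomm y y')
    = (-1) ^+ (a && b) *: scomm y (scomm z y') + scomm (scomm z y) y'.
  by rewrite (scomm_jacobi hz hy hy') addrC subrK.
rewrite (wact_linl ((-1) ^+ (a && b)) gF (pe_scomm py pzy') (pe_scomm pzy py') hw).
move=> -> ->.
by case: (a); case: (b); case: (c); rewrite /= ?expr0 ?expr1; lmod K.
Qed.

Fixpoint iword (m : iterm N) (w : seq gl) : N :=
  match m with
  | IZero => 0
  | IAdd m1 m2 => iword m1 w + iword m2 w
  | IScale a m => a *: iword m w
  | IGen v => if w is [::] then v else 0
  | IAct x m => if `[< pe n x >] then wact x (iword m) w else 0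
  end.

Lemma good_zero : good (fun=> 0).
Proof.
by split=> [b a z z' w w'|b c z z' w w'] *; rewrite scaler0 ?addr0 ?subr0.
Qed.

Lemma good_iword m : good (iword m).
Proof.
elim: m => /= [|m1 g1 m2 g2|a m g|v|x m g].
- exact: good_zero.
- apply: (@good_eq (fun w => 1 *: iword m1 w + iword m2 w)); last exact: good_lin.
  by move=> w _; rewrite scale1r.
- apply: (@good_eq (fun w => a *: iword m w + 0)); last exact: good_lin good_zero.
  by move=> w _; rewrite addr0.
- split=> [b a z z' [|z1 w]|b c z z' [|z1 w]] *; rewrite /= ?scaler0 ?addr0 ?subr0 //.
- case: asboolP => px; last exact: good_zero.
  exact: wact_good.
Qed.

(** This is the balancing relation of the induced module. At the empty word only the degree-zero
    part of y acts; at z :: w the bracket [z, y] is again a letter, so the function is evaluated at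
    a nonempty word, where it vanishes. *)
Lemma iword_gen_act b y (v : N) w : t y -> homog b y -> word w ->
  wact y (iword (IGen v)) w = iword (IGen (act y v)) w.
Proof.
move=> ty hy; have [py sy] := (tP y).1 ty; have gv := good_iword (IGen v).
case: w => [_|z w hw].
  rewrite (wact_nil gv hy) /= addr0.
  have ey : y = m0 y + mp y.
    rewrite {1}(gmask_trichotomy k y) (@gmask_disjoint _ _ _ (fun a => a < 0) _ y sy) ?add0r //.
    by move=> a; rewrite -leNgt.
  have tmp : t (mp y).
    apply/tP; split; first exact: gmask_pe.
    by move=> i j /(@gmask_supp _ _ k (fun a : int => 0 < a)); apply: ltW.
  rewrite [in RHS]ey (actDl _ (nonneg_m0 py) tmp).
  by rewrite (pos_act v (gmask_pe k _ py) (@gmask_supp _ _ _ (fun a : int => 0 < a) y)) addr0.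
have [lz {}hw] := word_inv hw; have [pz sz [a hz]] := lz.
rewrite (wact_cons gv py hy lz hz hw).
have lzy : letter (scomm z y).
  split; [exact: pe_scomm | | by exists (a (+) b); apply: homog_scomm].
  by apply: gsupp_scomm sz sy hz hy _ => i j *; exact: ltr_pwDl.
have -> : shift z (iword (IGen v)) = (fun=> 0) by [].
rewrite (wact_letter gv lzy hw) wact0r //=.
by rewrite scaler0 addr0.
Qed.

Lemma ieq_iword m m' : ieq m m' -> forall w, word w -> iword m w = iword m' w.
Proof.
elim=> /=.
- by [].
- by move=> m1 m2 _ IH w hw; rewrite IH.
- by move=> m1 m2 m3 _ IH1 _ IH2 w hw; rewrite IH1 ?IH2.
- by move=> m1 m1' m2 m2' _ IH1 _ IH2 w hw; rewrite IH1 ?IH2.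
- by move=> a m1 m2 _ IH w hw; rewrite IH.
- move=> x m1 m2 _ IH w hw; case: asboolP => // px.
  exact: wact_eq.
- by move=> *; rewrite addrA.
- by move=> *; rewrite addrC.
- by move=> *; rewrite add0r.
- by move=> *; rewrite scale0r.
- by move=> *; rewrite scale1r.
- by move=> *; rewrite scalerA.
- by move=> *; rewrite scalerDr.
- by move=> *; rewrite scalerDl.
- move=> x a m1 m2 w hw; case: asboolP => px; first exact: wact_linr.
  by rewrite scaler0 addr0.
- move=> a x y m1 px py w hw; rewrite !asboolT //; last exact: pe_lin.
  exact: wact_linl (good_iword _) px py hw.
- move=> b c x y m1 px py hx hy w hw; rewrite !asboolT //; last exact: pe_scomm.
  rewrite scaleNr; have g := good_iword m1.
  rewrite (wact_scomm g px py hx hy hw); congr (_ - _ *: _).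
- by move=> x m1 px w hw; rewrite asboolF.
- by move=> a u v [|z w] _ //=; rewrite scaler0 addr0.
- move=> b y v ty hy w hw; rewrite asboolT; last by case: ((tP y).1 ty).
  exact: (iword_gen_act v ty hy hw).
Qed.

Lemma ind_gen_inj0 (v : N) : ind_gen v = 0 -> v = 0.
Proof. by move=> /icls_eq /ieq_iword /(_ [::] word0). Qed.

End InducedNonzero.

Transparent scomm wact gmask.

(** * Generators of simple and of induced modules *)

Section Generators.
Variables (K : numFieldType) (n : nat).
Local Notation gl := 'M[K]_(n + n).

(** Simplicity concerns graded submodules, so a homogeneous highest weight vector is required. One
    of v0 + sgn v0 and v0 - sgn v0 is nonzero, since their sum is 2 v0. *)
Lemma simple_hw_generator (s t : set gl) (M : smod s) (lambda : 'rV[K]_n) :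
  cartan `<=` s ->
  (forall x, t x -> [/\ s x, s (mx_even x), s (mx_odd x) & t (mx_theta x)]) ->
  simple_hw M t lambda ->
  exists v : M, [/\ v != 0, weight_vector lambda v,
    forall x, t x -> Defs.nilp x -> act x v = 0 & Uspan t [set v] = [set: M]].
Proof.
move=> hs ht [[_ simple] [v0 [v0n v0w v0k]]].
have [c [v [vn vw vk sv]]] : exists (c : K) (v : M), [/\ v != 0, weight_vector lambda v,
    forall x, t x -> Defs.nilp x -> act x v = 0 & sgn v = c *: v].
  have key (c : K) : c * c = 1 -> v0 + c *: sgn v0 != 0 ->
      exists (c : K) (v : M), [/\ v != 0, weight_vector lambda v,
    forall x, t x -> Defs.nilp x -> act x v = 0 & sgn v = c *: v].
    move=> cc vn; exists c, (v0 + c *: sgn v0); split=> //.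
    - move=> x cx; have sx := hs _ cx; have hx := cartan_homog cx.
      have := sgn_act v0 sx hx; rewrite expr0 scale1r => e.
      by rewrite actDr // actZr // -e v0w // sgnZ; lmod K.
    - move=> x tx nx; have [sx se so th] := ht _ tx.
      have [_ nth] := nilp_theta_closed K n; have [_ se' so' _] := ht _ th.
      have := sgn_act_theta v0 se' so'; rewrite mx_thetaK v0k ?sgn0 => [e|//|]; last exact: nth.
      by rewrite actDr // actZr // -e v0k // scaler0 addr0.
    - by rewrite sgnD sgnZ sgnK scalerDr scalerA cc scale1r addrC.
  have [e1|n1] := eqVneq (v0 + 1 *: sgn v0) 0; last by apply: key n1; rewrite mulr1.
  apply: (key (-1)); first by rewrite mulrNN mulr1.
  apply: contra v0n => /eqP e2.
  have : 2 *: v0 = 0.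
    transitivity ((v0 + 1 *: sgn v0) + (v0 + (-1) *: sgn v0)); first by lmod K.
    by rewrite e1 e2 addr0.
  by move=> /eqP; rewrite scaler_eq0 pnatr_eq0.
exists v; split=> //.
pose T := Uspan t [set v]; have Tsub : subspace T := Uspan_subspace _ _.
have [e0|//] : T = [set 0] \/ T = [set: M].
  apply: simple => //; first exact: Uspan_stable.
  suff TS : T `<=` [set u | T u /\ T (sgn u)] by move=> u /TS[].
  apply: Uspan_min.
  - split=> [|a u w [h1 h2] [h3 h4]]; first by rewrite /= sgn0; split; exact: Tsub.1.
    by split; rewrite ?sgn_lin; apply: Tsub.2.
  - move=> x u tx [h1 h2]; have [sx se so th] := ht _ tx.
    split; first exact: (@Uspan_stable _ _ _ _ _ _ x u tx h1).
    rewrite (sgn_act_theta _ se so).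
    exact: (@Uspan_stable _ _ _ _ _ _ _ _ th h2).
  - move=> _ ->; have Tv : T v by apply: Uspan_sub.
    by split; rewrite // sv; apply: (subspaceZ Tsub).
have : T v by apply: Uspan_sub.
by rewrite e0 => ev; move: vn; rewrite ev eqxx.
Qed.

Lemma ind_gen_act (t : set gl) (N : smod t) x (v : N) : pe n x ->
  t x -> t (mx_even x) -> t (mx_odd x) ->
  act x (ind_gen v : Ind N) = ind_gen (act x v).
Proof.
move=> px tx te to.
have h b y : t y -> homog b y -> act y (ind_gen v : Ind N) = ind_gen (act y v).
  by move=> ty hy; rewrite [LHS]ind_actE; apply/icls_eq; apply: ieq_gen_act hy.
rewrite act_even_odd; [|exact: pe_even|exact: pe_odd].
rewrite (h _ _ te (homog_even x)) (h _ _ to (homog_odd x)) (act_even_odd v te to).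
have := ieq_gen_lin 1 (act (mx_even x) v) (act (mx_odd x) v).
by move=> /icls_eq; rewrite icls_lin !scale1r => /esym.
Qed.

Lemma ind_gen_lin (t : set gl) (N : smod t) a (u v : N) :
  ind_gen (a *: u + v) = a *: ind_gen u + ind_gen v :> Ind N.
Proof. by have /icls_eq := ieq_gen_lin a u v; rewrite icls_lin. Qed.

Lemma ind_generated (t : set gl) (N : smod t) (T : set (Ind N)) :
  subspace T -> stable (pe n) T -> (forall v : N, T (ind_gen v)) -> T = [set: Ind N].
Proof.
move=> Tsub Tst Tgen; apply/seteqP; split=> // u _.
elim/icls_ind: u; elim=> [|m1 h1 m2 h2|a m h|v|x m h].
- exact: Tsub.1.
- by rewrite -ind_addE; apply: (subspaceD Tsub).
- by rewrite -ind_scaleE; apply: (subspaceZ Tsub).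
- exact: Tgen.
- have [px|npx] := pselect (pe n x); first by rewrite -ind_actE; apply: Tst.
  by have /icls_eq -> := ieq_act_out m npx; exact: Tsub.1.
Qed.

End Generators.

Section InducedHighestWeight.
Variables (K : numFieldType) (n : nat) (k : 'I_n -> nat).
Local Notation gl := 'M[K]_(n + n).
Hypothesis k_mono : forall i j : 'I_n, (i <= j)%N -> (k j <= k i)%N.
Variables (t l : set gl) (N : smod t) (lambda : 'rV[K]_n).
Hypothesis tP : forall y, t y <-> pe n y /\ gsupp k (fun a : int => 0 <= a) y.
Hypothesis lP : forall y, l y <-> pe n y /\ gsupp k (pred1 (0 : int)) y.
Hypothesis pos_act : forall y (u : N), pe n y -> gsupp k (fun a : int => 0 < a) y ->
  act y u = 0.
Hypothesis N_hw : simple_hw N l lambda.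

Lemma cartan_levi : cartan `<=` l.
Proof.
move=> y cy; have [py /is_diag_mxP dy] := cy; apply/lP; split=> // i j nz.
have -> : i = j by apply/val_inj/eqP; apply: contraNT nz => /dy/eqP.
by rewrite /= subrr.
Qed.

Lemma nilp_par : Defs.nilp `<=` t.
Proof.
move=> y [[py dy] uy]; have [p1 _ _] := py; apply/tP; split=> // i j.
rewrite -(splitK i) -(splitK j).
case: (split i) => i1; case: (split j) => j1 /=; rewrite ?wdegl ?wdegr.
- have [ji|ij] := leqP j1 i1.
    by have := uy i1 j1 ji; rewrite !mxE => ->; rewrite eqxx.
  by have := k_mono (ltnW ij); lia.
- by lia.
- by have := congr1 (fun m : 'M_n => m i1 j1) dy; rewrite !mxE => ->; rewrite eqxx.
- have := congr1 (fun m : 'M_n => m i1 j1) p1; rewrite !mxE => ->.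
  have [ij|ji] := leqP i1 j1.
    by have := uy j1 i1 ij; rewrite !mxE => ->; rewrite oppr0 eqxx.
  by have := k_mono (ltnW ji); lia.
Qed.

Lemma t_parts x : t x -> [/\ t (mx_even x), t (mx_odd x) & t (mx_theta x)].
Proof.
move=> /tP[px sx]; split; apply/tP; split.
- exact: pe_even. - exact: gsupp_even. - exact: pe_odd. - exact: gsupp_odd.
- exact: pe_theta. - exact: gsupp_theta.
Qed.

Lemma levi_par x : l x -> t x.
Proof. by move=> /lP[px sx]; apply/tP; split=> // i j /sx /eqP->. Qed.

Lemma induced_hw : exists u : Ind N, [/\ u != 0, weight_vector lambda u,
  forall x, Defs.nilp x -> act x u = 0 & Uspan (pe n) [set u] = [set: Ind N]].
Proof.
have tpe x : t x -> pe n x by move=> /tP[].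
have [|x /[dup] lx /levi_par /[dup] tx /t_parts[te to th]|v [vn vw vk vg]] :=
  simple_hw_generator _ _ N_hw.
- by move=> x /cartan_levi/levi_par.
- split=> //; move: lx => /lP[px sx]; apply/lP.
  by split; [exact: pe_theta | exact: gsupp_theta].
have genact x (w : N) : t x -> act x (ind_gen w : Ind N) = ind_gen (act x w).
  by move=> /[dup] tx /t_parts[te to _]; apply: ind_gen_act => //; exact: tpe.
have gen0 : ind_gen (0 : N) = 0 :> Ind N by exact: icls_gen0.
exists (ind_gen v); split.
- apply: contra vn => /eqP e; apply/eqP; exact: (ind_gen_inj0 tP pos_act e).
- move=> x cx; rewrite genact; last by apply/levi_par/cartan_levi.
  by rewrite vw // -[_ *: v]addr0 ind_gen_lin gen0 addr0.
- move=> x nx; have tx := nilp_par nx; rewrite genact //.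
  have [px sx] := (tP x).1 tx.
  (* The degree-zero part of x lies in l and in n, so it kills v; the positive part kills all of
     N. *)
  have ex : x = gmask k (pred1 0) x + gmask k (fun a => 0 < a) x.
    rewrite {1}(gmask_trichotomy k x).
    rewrite (@gmask_disjoint _ _ _ (fun a => a < 0) _ x sx) ?add0r //.
    by move=> a; rewrite -leNgt.
  have l0 : l (gmask k (pred1 0) x).
    by apply/lP; split; [exact: gmask_pe | exact: gmask_supp].
  have tp : t (gmask k (fun a : int => 0 < a) x).
    apply/tP; split; first exact: gmask_pe.
    by move=> i j /(@gmask_supp _ _ k (fun a : int => 0 < a)); apply: ltW.
  have n0 : Defs.nilp (gmask k (pred1 (0 : int)) x).
    have [[_ dx] ux] := nx; split; first split.
    + exact: gmask_pe.
    + apply/matrixP=> i j; have := congr1 (fun m : 'M_n => m i j) dx; rewrite !mxE => ->.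
      by case: ifP.
    + by move=> i j ji; have := ux i j ji; rewrite !mxE => ->; case: ifP.
  rewrite ex (actDl _ (levi_par l0) tp) (vk _ l0 n0) add0r.
  rewrite (pos_act v (gmask_pe k _ px) (@gmask_supp _ _ _ (fun a : int => 0 < a) x)).
  exact: gen0.
set T := Uspan _ _; have Tsub : subspace T := Uspan_subspace _ _.
have Tst : stable (pe n) T by exact: Uspan_stable.
apply: ind_generated => // w.
have : Uspan l [set v] w by rewrite vg.
suff /(_ w) : Uspan l [set v] `<=` [set w : N | T (ind_gen w)] by [].
apply: Uspan_min => [|x u lx Tu|_ -> /=].
- split=> [|a p q hp hq]; first by rewrite /= gen0; exact: Tsub.1.
  by rewrite /= ind_gen_lin; apply: Tsub.2.
- by rewrite /= -genact; [apply: Tst => //; exact/tpe/levi_par | exact: levi_par].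
- exact: Uspan_sub.
Qed.

End InducedHighestWeight.

(** * Infinite projective dimension of highest weight modules *)

Section HighestWeightPd.
Variables (K : numFieldType) (n : nat) (n_gt0 : (0 < n)%N) (p0 : set 'M[K]_n).
Variables (M : smod (@pe K n)) (v : M) (lambda : 'rV[K]_n).
Hypotheses (v_neq0 : v != 0) (v_weight : weight_vector lambda v).
Hypothesis v_nilp : forall y, Defs.nilp y -> act y v = 0.
Hypothesis v_gen : Uspan (pe n) [set v] = [set: M].

Lemma hw_infinite_pd : [/\ exists2 x, assoc_var M x & x != 0,
  infinite_pd (@catO K n) M & infinite_pd (catOp p0) M].
Proof.
have lt : (n.-1 < n)%N by rewrite prednK.
pose i0 := Ordinal lt; pose x : 'M[K]_(n + n) := block_mx 0 (delta_mx i0 i0) 0 0.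
have px : pe n x := pe_g1_delta K i0.
have hx : homog true x := homog_g1 _.
have xx : scomm x x = 0 := scomm_g1 _.
have xv0 : act x v = 0 := @hw_x_kills _ _ _ _ i0 v_nilp.
have nv w : v <> act x w.
  exact: (@hw_not_image _ _ _ _ _ i0 erefl v_neq0 v_weight v_nilp v_gen w).
split.
- exists x; first by split=> //; exists v; split=> // -[w _ ew]; apply: (nv w).
  apply/eqP => /(congr1 (fun m => ursubmx m i0 i0)) /eqP.
  by rewrite block_mxKur !mxE !eqxx oner_eq0.
- apply: (not_acyclic_infinite_pd px hx xx _ xv0 nv) => P.
  by apply: projective_acyclic => d r s h e rep P'; apply: tensor_catO.
- apply: (not_acyclic_infinite_pd px hx xx _ xv0 nv) => P.
  by apply: projective_acyclic => d r s h e rep P'; apply: tensor_catOp.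
Qed.

End HighestWeightPd.

Section Quotients.
Variables (K : numFieldType) (n : nat).

Lemma hw_quotient (D M : smod (@pe K n)) (f : D -> M) (u : D) (lambda : 'rV[K]_n) :
  is_hom f -> is_surj f -> nonzero M -> weight_vector lambda u ->
  (forall x, Defs.nilp x -> act x u = 0) -> Uspan (pe n) [set u] = [set: D] ->
  [/\ f u != 0, weight_vector lambda (f u), forall x, Defs.nilp x -> act x (f u) = 0
    & Uspan (pe n) [set f u] = [set: M]].
Proof.
move=> [flin fact _] fsurj [m mn] uw uk ug.
have f0 : f 0 = 0 by have := flin (-1) 0 0; rewrite scaler0 addr0 scaleN1r addNr.
have fgen (T : set M) : subspace T -> stable (pe n) T -> T (f u) -> forall w, T w.
  move=> Tsub Tst Tfu w; have [d <-] := fsurj w.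
  have : Uspan (pe n) [set u] d by rewrite ug.
  suff /(_ d) : Uspan (pe n) [set u] `<=` [set d | T (f d)] by [].
  apply: Uspan_min => [|x c px Tc|_ -> //].
  - split=> [|a p q hp hq]; first by rewrite /= f0; exact: Tsub.1.
    by rewrite /= flin; apply: Tsub.2.
  - by rewrite /= fact //; apply: Tst.
split.
- apply: contra mn => /eqP fu0; apply/eqP; apply: (fgen [set 0]) => //.
    by split=> // a _ _ -> ->; rewrite scaler0 addr0.
  by move=> x _ px ->; apply: act0r.
- move=> x cx; rewrite -fact; last by case: cx.
  by rewrite uw // -[_ *: u]addr0 flin f0 addr0.
- by move=> x nx; rewrite -fact ?uk // ; case: nx => -[].
- apply/seteqP; split=> // w _; apply: fgen; [exact: Uspan_subspace | exact: Uspan_stable|].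
  exact: Uspan_sub.
Qed.

End Quotients.

(** * The grading attached to a parabolic subalgebra *)

Section ParabolicGrading.
Variables (K : numFieldType) (n : nat) (p0 : set 'M[K]_n).
Hypothesis p0_par : parabolic p0.
Local Notation gl := 'M[K]_(n + n).

Let q (i j : 'I_n) : bool := `[< p0 (delta_mx i j) >].

(* The roots of p0 define a total preorder on the indices; this is its rank
   function. *)
Definition par_rank (i : 'I_n) : nat := #|[pred j | `[< p0 (delta_mx i j) >]]|.

Lemma p0_0 : p0 0.
Proof. by have [_ _] := p0_par; apply=> i j _; rewrite mxE. Qed.

Lemma p0_scale a A : p0 A -> p0 (a *: A).
Proof. by have [lin _ _] := p0_par => hA; rewrite -[_ *: _]addr0; apply: lin p0_0. Qed.

Lemma p0_sum (I : finType) (F : I -> 'M[K]_n) : (forall i, p0 (F i)) -> p0 (\sum_i F i).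
Proof.
have [lin _ _] := p0_par => hF; elim/big_ind: _ => [|A B hA hB|//]; first exact: p0_0.
by rewrite -[A]scale1r; apply: lin.
Qed.

Lemma par_upper (i j : 'I_n) : (i <= j)%N -> q i j.
Proof.
move=> ij; apply/asboolP; have [_ _] := p0_par; apply=> a b ba; rewrite mxE.
by case: eqP => // ea; case: eqP => // eb; move: ba; rewrite ea eb ltnNge ij.
Qed.

Lemma par_trans (i j l : 'I_n) : q i j -> q j l -> q i l.
Proof.
move=> /asboolP h1 /asboolP h2; have [->|il] := eqVneq i l; first exact: par_upper.
apply/asboolP; have [_ br _] := p0_par; have := br _ _ h1 h2.
by rewrite !mul_delta_mx_cond eqxx eq_sym (negPf il) mulr0n subr0.
Qed.

(** If E_ij is not in p0 then j < i and E_ji is in p0; the set counted at i is then contained in the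
    one counted at j, and it misses j. *)
Lemma par_rankP (i j : 'I_n) : q i j = (par_rank j <= par_rank i)%N.
Proof.
apply/idP/idP => [hij|]; first by apply/subset_leq_card/fintype.subsetP => l; apply: par_trans.
apply: contraTT => nij; rewrite -ltnNge; apply/proper_card/properP; split.
  apply/fintype.subsetP => l; apply: par_trans; apply: par_upper.
  by apply: contraNT nij; rewrite -ltnNge => /ltnW; exact: par_upper.
by exists j; rewrite ?inE; [exact: par_upper | exact: nij].
Qed.

(** Strict positivity of the rank puts g_1 in positive and g_{-1} in negative degree. *)
Lemma par_rank_gt0 i : (0 < par_rank i)%N.
Proof. by apply/card_gt0P; exists i; rewrite inE; apply: par_upper. Qed.

Lemma par_rank_mono (i j : 'I_n) : (i <= j)%N -> (par_rank j <= par_rank i)%N.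
Proof. by move=> /par_upper; rewrite par_rankP. Qed.

(** Root vectors are extracted by [[E_ii, A], E_jj] = A_ij E_ij + A_ji E_ji; for j < i the second
    term is upper triangular, hence in p0, and can be subtracted. *)
Lemma p0_entry A i j : p0 A -> A i j != 0 -> q i j.
Proof.
move=> pA nz; have [/par_upper //|ji] := leqP i j.
have [lin br up] := p0_par; apply/asboolP.
have pd a : p0 (delta_mx a a) by apply/asboolP/par_upper.
have dAd a b : delta_mx a a *m A *m delta_mx b b = A a b *: delta_mx a b.
  apply/matrixP=> u w; rewrite !mxE (bigD1 b) //= big1 ?addr0 => [|l /negPf nl].
    rewrite !mxE (bigD1 a) //= big1 ?addr0 => [|l /negPf nl].
      by rewrite !mxE !eqxx andbT /= mulrAC -natrM mulnb mulrC.
    by rewrite mxE nl andbF mul0r.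
  by rewrite [delta_mx b b _ _]mxE nl mulr0.
have ij : i != j by apply: contraTneq ji => ->; rewrite ltnn.
have := br _ _ (br _ _ (pd i) pA) (pd j).
have e1 : A *m delta_mx i i *m delta_mx j j = 0.
  by rewrite -mulmxA mul_delta_mx_cond (negPf ij) mulr0n mulmx0.
have e2 : delta_mx j j *m (delta_mx i i *m A) = 0.
  by rewrite mulmxA mul_delta_mx_cond eq_sym (negPf ij) mulr0n mul0mx.
rewrite mulmxBl mulmxBr e1 e2 dAd [delta_mx j j *m (A *m _)]mulmxA dAd.
rewrite subr0 sub0r opprK => pB.
have pji : p0 (delta_mx j i) by apply/asboolP/par_upper/ltnW.
have := lin (- A j i) _ _ pji pB; rewrite addrCA scaleNr addNr addr0 => /(p0_scale (A i j)^-1).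
by rewrite scalerA mulVf // scale1r.
Qed.

Lemma par_gsupp (y : gl) : par p0 y <->
  pe n y /\ gsupp par_rank (fun a : int => 0 <= a) y.
Proof.
split=> [[[py dy] uy]|[py sy]].
  have [p1 _ _] := py; split=> // i j; rewrite -(splitK i) -(splitK j).
  case: (split i) => i1; case: (split j) => j1 /=; rewrite ?wdegl ?wdegr.
  - move=> nz; have : q i1 j1 by apply: (p0_entry uy); rewrite !mxE.
    by rewrite par_rankP; lia.
  - by lia.
  - by have := congr1 (fun m : 'M_n => m i1 j1) dy; rewrite !mxE => ->; rewrite eqxx.
  - have := congr1 (fun m : 'M_n => m i1 j1) p1; rewrite !mxE => -> nz.
    have : q j1 i1 by apply: (p0_entry uy); rewrite !mxE;
      apply: contra nz => /eqP->; rewrite oppr0.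
    by rewrite par_rankP; lia.
split; first split=> //.
  apply/matrixP=> i j; rewrite !mxE; apply/eqP/negPn/negP => /sy.
  by rewrite wdegl wdegr; have := par_rank_gt0 i; have := par_rank_gt0 j; lia.
rewrite [ulsubmx y]matrix_sum_delta; apply: p0_sum => i; apply: p0_sum => j.
have [->|nz] := eqVneq (ulsubmx y i j) 0; first by rewrite scale0r; exact: p0_0.
apply: p0_scale; apply/asboolP; change (is_true (q i j)).
move: nz; rewrite !mxE => /sy; rewrite !wdegl par_rankP; lia.
Qed.

Lemma levi_rootE i j : levi_root p0 i j <-> par_rank i = par_rank j.
Proof.
have h a b : p0 (delta_mx a b) <-> (par_rank b <= par_rank a)%N.
  by rewrite -par_rankP; split=> /asboolP.
rewrite /levi_root !h; split=> [[h1 h2]|->]; last by rewrite leqnn.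
by apply/eqP; rewrite eqn_leq h1 h2.
Qed.

Lemma levi_gsupp (y : gl) : levi p0 y <-> pe n y /\ gsupp par_rank (pred1 (0 : int)) y.
Proof.
split=> [[[py ry dy] uy]|[py sy]].
  have [p1 _ _] := py; split=> // i j; rewrite -(splitK i) -(splitK j).
  case: (split i) => i1; case: (split j) => j1 /=; rewrite ?wdegl ?wdegr.
  - move=> nz; have /levi_rootE -> : levi_root p0 i1 j1 by apply: uy; rewrite !mxE.
    by rewrite subrr.
  - by have := congr1 (fun m : 'M_n => m i1 j1) ry; rewrite !mxE => ->; rewrite eqxx.
  - by have := congr1 (fun m : 'M_n => m i1 j1) dy; rewrite !mxE => ->; rewrite eqxx.
  - have := congr1 (fun m : 'M_n => m i1 j1) p1; rewrite !mxE => -> nz.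
    have /levi_rootE -> : levi_root p0 j1 i1.
      by apply: uy; rewrite !mxE; apply: contra nz => /eqP->; rewrite oppr0.
    by rewrite subrr.
split; first split=> //.
- apply/matrixP=> i j; rewrite !mxE; apply/eqP/negPn/negP => /sy /=.
  by rewrite wdegl wdegr; have := par_rank_gt0 i; have := par_rank_gt0 j; lia.
- apply/matrixP=> i j; rewrite !mxE; apply/eqP/negPn/negP => /sy /=.
  by rewrite wdegl wdegr; have := par_rank_gt0 i; have := par_rank_gt0 j; lia.
- move=> i j; rewrite !mxE => /sy /=; rewrite !wdegl => e; apply/levi_rootE; lia.
Qed.

Lemma nilrad_gsupp (y : gl) : pe n y -> gsupp par_rank (fun a : int => 0 < a) y ->
  nilrad p0 y.
Proof.
move=> py sy; split; first by apply/par_gsupp; split=> // i j /sy; apply: ltW.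
move=> i j /levi_rootE e; rewrite !mxE; apply/eqP/negPn/negP => /sy.
by rewrite !wdegl e subrr.
Qed.

End ParabolicGrading.

(** * The grading with nonnegative part g_0 + g_1 *)

Section KacGrading.
Variables (K : numFieldType) (n : nat).
Local Notation gl := 'M[K]_(n + n).
Local Notation one := (fun _ : 'I_n => 1%N).

Lemma pe_ge0_gsupp (y : gl) : pe_ge0 n y <-> pe n y /\ gsupp one (fun a : int => 0 <= a) y.
Proof.
split=> [[py dy]|[py sy]]; split=> //.
  move=> i j; rewrite -(splitK i) -(splitK j).
  case: (split i) => i1; case: (split j) => j1 /=; rewrite ?wdegl ?wdegr //.
  by have := congr1 (fun m : 'M_n => m i1 j1) dy; rewrite !mxE => ->; rewrite eqxx.
by apply/matrixP=> i j; rewrite !mxE; apply/eqP/negPn/negP => /sy; rewrite wdegl wdegr.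
Qed.

Lemma pe_0_gsupp (y : gl) : pe_0 n y <-> pe n y /\ gsupp one (pred1 (0 : int)) y.
Proof.
split=> [[py ry dy]|[py sy]].
  split=> // i j; rewrite -(splitK i) -(splitK j).
  case: (split i) => i1; case: (split j) => j1 /=; rewrite ?wdegl ?wdegr //.
  - by have := congr1 (fun m : 'M_n => m i1 j1) ry; rewrite !mxE => ->; rewrite eqxx.
  - by have := congr1 (fun m : 'M_n => m i1 j1) dy; rewrite !mxE => ->; rewrite eqxx.
by split=> //; apply/matrixP=> i j; rewrite !mxE; apply/eqP/negPn/negP => /sy /=;
  rewrite wdegl wdegr.
Qed.

Lemma pe_1_gsupp (y : gl) : pe n y -> gsupp one (fun a : int => 0 < a) y -> pe_1 n y.
Proof.
move=> py sy; split=> //; apply/matrixP=> i j; rewrite !mxE; apply/eqP/negPn/negP => /sy.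
  by rewrite !wdegl subrr.
by rewrite wdegl wdegr.
Qed.

End KacGrading.

Local Open Scope complex_scope.

Theorem proposition36 (R : realType) (n : nat) (n_gt0 : (0 < n)%N)
    (p0 : set 'M[R[i]]_n) (p0_parabolic : parabolic p0)
    (lambda : 'rV[R[i]]_n) (lambda_dominant : dominant p0 lambda) :
  [/\ forall N : smod (par p0), is_Llevi lambda N ->
      forall M : smod (pe n), catOp p0 M -> nonzero M ->
        (exists f : Delta N -> M, is_hom f /\ is_surj f) ->
        [/\ exists2 x, assoc_var M x & x != 0,
            infinite_pd (@catO _ n) M
          & infinite_pd (catOp p0) M],
      forall L : smod (pe n), is_L lambda L ->
        infinite_pd (@catO _ n) L /\ infinite_pd (catOp p0) L,
      forall N : smod (pe_ge0 n), is_L0 lambda N ->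
        infinite_pd (@catO _ n) (Kac N) /\ infinite_pd (catOp p0) (Kac N)
    & forall N : smod (par p0), is_Llevi lambda N ->
        infinite_pd (@catO _ n) (Delta N) /\ infinite_pd (catOp p0) (Delta N)].
Proof.
have delta_hw (N : smod (par p0)) : is_Llevi lambda N -> exists u : Delta N,
    [/\ u != 0, weight_vector lambda u, forall x, Defs.nilp x -> act x u = 0
      & Uspan (pe n) [set u] = [set: Delta N]].
  move=> [hw nil]; apply: (@induced_hw _ _ (par_rank p0) (par_rank_mono p0_parabolic)
    _ (levi p0) N lambda (par_gsupp p0_parabolic) (levi_gsupp p0_parabolic) _ hw).
  by move=> y w py sy; apply/nil/nilrad_gsupp.
split.
- move=> N hN M _ Mn [f [fhom fsurj]].
  have [u [un uw uk ug]] := delta_hw N hN.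
  have [vn vw vk vg] := hw_quotient fhom fsurj Mn uw uk ug.
  exact: (hw_infinite_pd n_gt0 p0 vn vw vk vg).
- move=> L hL; have [|x px|v [vn vw vk vg]] := simple_hw_generator _ _ hL.
  + by move=> x [].
  + by split=> //; [exact: pe_even | exact: pe_odd | exact: pe_theta].
  have vk' x : Defs.nilp x -> act x v = 0 by move=> nx; apply: vk => //; case: nx => -[].
  by have [] := hw_infinite_pd n_gt0 p0 vn vw vk' vg.
- move=> N [hw nil].
  have [|y w py sy|u [un uw uk ug]] := @induced_hw _ _ (fun=> 1%N) _ _ (pe_0 n) N lambda
    (@pe_ge0_gsupp _ n) (@pe_0_gsupp _ n) _ hw.
  + by [].
  + exact/nil/pe_1_gsupp.
  by have [] := hw_infinite_pd n_gt0 p0 un uw uk ug.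
- move=> N hN; have [u [un uw uk ug]] := delta_hw N hN.
  by have [] := hw_infinite_pd n_gt0 p0 un uw uk ug.
Qed.
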